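(* Let $G$ be a countable group satisfying property RD with respect to a length function $\mathcal{L}$, and let $\mu$ be a probability measure on $G$ with finite Shannon entropy and with finite $\alpha$-moment with respect to $1+\mathcal{L}$ for some $\alpha>0$, i.e.\ $\sum_{s\in G}\mu(s)(1+\mathcal{L}(s))^\alpha<\infty$. Then \[ h(G,\mu)=c(G,\mu), \] that is, $h(G,\mu)=\lim_{p\to\infty}-p\log r_{\mathrm{PF}_q(G)}(\mu)$, where $\frac1p+\frac1q=1$.
   Context: $G$ is a countable discrete group with identity $e$. For probability measures $\mu,\nu$ on $G$, $\mu*\nu(s)=\sum_{t\in G}\mu(t)\nu(t^{-1}s)$, and $\mu^{*n}$ is the $n$-fold convolution power. The Shannon entropy is $H(G,\mu)=-\sum_{s}\mu(s)\log\mu(s)$ (with $0\log 0=0$), and the Avez entropy is $h(G,\mu)=\lim_{n\to\infty}\frac1n H(G,\mu^{*n})$. A length function is $\mathcal{L}:G\to[0,\infty)$ with $\mathcal{L}(e)=0$, $\mathcal{L}(s^{-1})=\mathcal{L}(s)$, $\mathcal{L}(st)\le\mathcal{L}(s)+\mathcal{L}(t)$. $G$ has property RD with respect to $\mathcal{L}$ if there is $d\in\mathbb{N}$ such that the inclusion $\mathbb{C}[G]\hookrightarrow C^*_r(G)$ extends to a bounded linear map $\ell^2(G,\omega)\to C^*_r(G)$, where $\omega(s)=(1+\mathcal{L}(s))^d$ and $\ell^2(G,\omega)=\{f:\sum_s|f(s)|^2\omega(s)^2<\infty\}$. For $1<q<\infty$, $\lambda_q:\ell^1(G)\to B(\ell^q(G))$,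 $\lambda_q(f)g=f*g$, is the left-regular representation, and $\mathrm{PF}_q(G)$ (the algebra of $q$-pseudofunctions) is the norm closure of $\lambda_q(\ell^1(G))$ in $B(\ell^q(G))$; $r_{\mathrm{PF}_q(G)}(\mu)$ denotes the spectral radius of $\lambda_q(\mu)$ in this Banach algebra. The convolution entropy is $c(G,\mu)=\lim_{p\to\infty}-p\log r_{\mathrm{PF}_q(G)}(\mu)$ with $\frac1p+\frac1q=1$. *)

(* Defs.v *)
From HB Require Import structures.
From mathcomp Require Import all_boot all_order all_algebra.
From mathcomp Require Import all_classical all_reals all_analysis.
From mathcomp Require Import complex.
Import numFieldNormedType.Exports.
Set Implicit Arguments. Unset Strict Implicit. Unset Printing Implicit Defensive.
Import Order.TTheory GRing.Theory Num.Theory.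
Local Open Scope classical_set_scope.
Local Open Scope ring_scope.

(* Conventions: real numbers are an arbitrary R : realType, complex numbers
   are R[i] (mathcomp-real-closed).  The countable discrete group is a
   countType G with an explicit multiplication, inverse and identity.
   Sums over G are \esum (sums of nonnegative extended reals over a set);
   absolutely convergent complex sums are split into positive/negative parts
   of real and imaginary parts. *)

Section RDDefs.
Variable R : realType.
Local Notation C := (R[i]).
Variables (G : countType) (mul : G -> G -> G) (inv : G -> G) (e : G).

Definition is_group : Prop :=
  (forall s t u, mul s (mul t u) = mul (mul s t) u) /\
  (forall s, mul e s = s /\ mul s e = s) /\
  (forall s, mul (inv s) s = e /\ mul s (inv s) = e).

Definition is_length_function (L : G -> R) : Prop :=
  (forall s, 0 <= L s) /\ L e = 0 /\ (forall s, L (inv s) = L s) /\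
  (forall s t, L (mul s t) <= L s + L t).

Definition is_prob (mu : G -> R) : Prop :=
  (forall s, 0 <= mu s) /\ (\esum_(s in [set: G]) (mu s)%:E = 1)%E.

Definition conv (mu nu : G -> R) : G -> R :=
  fun s => fine (\esum_(t in [set: G]) (mu t * nu (mul (inv t) s))%:E).

Definition dirac_e : G -> R := fun s => if s == e then 1 else 0.

Fixpoint convpow (mu : G -> R) (n : nat) : G -> R :=
  match n with 0 => dirac_e | n'.+1 => conv (convpow mu n') mu end.

Definition shannon (mu : G -> R) : \bar R :=
  \esum_(s in [set: G]) (if mu s == 0 then 0 else - (mu s * ln (mu s)))%:E.

Definition avez (mu : G -> R) : R :=
  limn (fun n => fine (shannon (convpow mu n)) / n%:R).

Definition rsum (h : G -> R) : R :=
  fine (\esum_(s in [set: G]) (Num.max (h s) 0)%:E)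
  - fine (\esum_(s in [set: G]) (Num.max (- h s) 0)%:E).

Definition csum (f : G -> C) : C :=
  Complex (rsum (fun s => complex.Re (f s))) (rsum (fun s => complex.Im (f s))).

Definition lqsum (q : R) (g : G -> C) : \bar R :=
  \esum_(s in [set: G]) ((Normc.normc (g s)) `^ q)%:E.

Definition lqnorm (q : R) (g : G -> C) : \bar R :=
  if lqsum q g == +oo%E then +oo%E else ((fine (lqsum q g)) `^ q^-1)%:E.

Definition lam (f : G -> C) (g : G -> C) : G -> C :=
  fun s => csum (fun t => f t * g (mul (inv t) s)).

Definition opnorm (q : R) (A : (G -> C) -> (G -> C)) : \bar R :=
  ereal_sup [set lqnorm q (A g) | g in [set g | (lqnorm q g <= 1)%E]].

Definition in_PF (q : R) (B : (G -> C) -> (G -> C)) : Prop :=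
  exists fs : nat -> G -> C,
    (forall n, (lqsum 1 (fs n) < +oo)%E) /\
    (fun n => opnorm q (fun g s => B g s - lam (fs n) g s)) @ \oo --> 0%E.

Definition PF_invertible (q : R) (T : (G -> C) -> (G -> C)) : Prop :=
  exists B, in_PF q B /\
    forall g, (lqsum q g < +oo)%E -> B (T g) = g /\ T (B g) = g.

Definition mu_C (mu : G -> R) : G -> C := fun s => Complex (mu s) 0.

Definition PF_spectrum (q : R) (mu : G -> R) : set C :=
  [set z | ~ PF_invertible q (fun g s => z * g s - lam (mu_C mu) g s)].

Definition PF_specrad (q : R) (mu : G -> R) : R :=
  sup [set Normc.normc z | z in PF_spectrum q mu].

(* property RD w.r.t. L: ||lambda(f)||_{C*_r} <= K ||f||_{l^2(G,omega)} for f in C[G],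
   with omega = (1+L)^d, and ||.||_{C*_r} the operator norm on l^2(G) *)
Definition has_RD (L : G -> R) : Prop :=
  exists d : nat, exists K : R,
    forall f : G -> C, finite_set [set s | f s != 0] ->
      (opnorm 2 (lam f) <=
       (K * Num.sqrt (fine (\esum_(s in [set: G])
              (Normc.normc (f s) ^+ 2 * ((1 + L s) ^+ d) ^+ 2)%:E)))%:E)%E.

End RDDefs.

(* Main.v *)
From HB Require Import structures.
From mathcomp Require Import all_boot all_order all_algebra.
From mathcomp Require Import all_classical all_reals all_analysis.
From mathcomp Require Import complex.
From mathcomp Require Import lra ring.
Require Import Defs.
Import numFieldNormedType.Exports.
Import Order.TTheory GRing.Theory Num.Theory.
Set Implicit Arguments. Unset Strict Implicit. Unset Printing Implicit Defensive.
Local Open Scope classical_set_scope.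
Local Open Scope ring_scope.

(** Write [mu_n] for the [n]-th convolution power, [H_n] for its entropy,
    [T] for [lambda_q(mu)] and [1/p + 1/q = 1].  Fekete's lemma gives
    [h = lim H_n / n = inf H_n / n].

    Jensen's inequality yields [||mu_n||_q >= exp (- H_n / p)].  Let [g] be the
    exponential growth rate of [||mu_n||_q].  If [g - T] were invertible, the
    truncated resolvents [x_N = sum_(n < N) w^-(n+1) mu_n] with [w < g], for which
    [(g - T) x_N = (g - w) x_N + delta_e - w^-N mu_N], would force
    [sum_(n < N) a_n <= C (1 + a_N)] for [a_n = (||mu_n||_q / w^n)^q], with [C]
    independent of [w]; hence [a_n] would grow at a rate bounded away from [1]
    as [w] tends to [g], which is absurd.  So [g] belongs to the spectrum and
    [- p ln r <= h].

    Conversely, for nonnegative functions Hoelder's inequality alone interpolates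
    between [l^1] and the rapid decay estimate on [l^2], and gives
    [||T^n|| <= K^(2/p) (sum mu_n^(1+t) om^(2t))^((p-2)/p)] with [t = 1/(p-2)] and
    [om = (1 + L)^d].  By Cauchy-Schwarz the sum is controlled by
    [sum mu_n^(1+2t)], whose logarithm is [- 2 t H_n + o(t)], and by a power of
    the moment of [mu_n], which is at most linear in [n].  The Neumann series then
    bounds the spectrum, and letting [p] and then [n] tend to infinity gives
    [liminf (- p ln r) >= h]. *)

(** [PF_specrad] is a supremum of moduli over the spectrum, not a limit of norms. The lower bound
    must therefore exhibit a spectral point, and the upper bound must build an inverse that lies in
    the algebra. As [in_PF] does not ask for linearity, a putative inverse is only known to be
    bounded on the unit ball; homogeneity has to be borrowed from [z - T].

    The weight [t = 1/(p-2)] comes from writing [mu_n = u^(1-2/p) v^(2/p)] with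
    [v = mu_n^(1/2) / om], a function of weighted l^2 norm at most 1; this determines
    [u = mu_n^(1+t) om^(2t)].

    Finite entropy does not bound [sum mu_n (ln mu_n)^2], yet this sum is the second-order error in
    [ln sum mu_n^(1+2t)]. The expansion is therefore restricted to a finite set [X] that carries
    almost all of [H_n]. In the resulting bound for [p ln r], the error from the moment and from [K]
    has order [ln n / n] and does not depend on [p], while the second-order error tends to 0 with
    [1/p] for fixed [n] and [X]. Hence the order of choices: [n], then [X], then [p]. *)

(** * Unordered sums in the extended nonnegative reals *)

Section esum_tools.
Local Open Scope ereal_scope.
Variables (R : realType) (T : choiceType).
Implicit Types (a b f : T -> \bar R).

Lemma esumT_ge0 f : (forall x, 0 <= f x) -> 0 <= \esum_(x in [set: T]) f x.
Proof. by move=> f0; apply: esum_ge0 => x _. Qed.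

Lemma le_esumT a b : (forall x, a x <= b x) ->
  \esum_(x in [set: T]) a x <= \esum_(x in [set: T]) b x.
Proof. by move=> ab; apply: le_esum => x _. Qed.

Lemma eq_esumT a b : (forall x, a x = b x) ->
  \esum_(x in [set: T]) a x = \esum_(x in [set: T]) b x.
Proof. by move=> ab; apply: eq_esum => x _. Qed.

Lemma esumTD a b : (forall x, 0 <= a x) -> (forall x, 0 <= b x) ->
  \esum_(x in [set: T]) (a x + b x) =
  \esum_(x in [set: T]) a x + \esum_(x in [set: T]) b x.
Proof. by move=> a0 b0; rewrite esumD. Qed.

Lemma esum_term_le f x : (forall y, 0 <= f y) ->
  f x <= \esum_(y in [set: T]) f y.
Proof.
move=> f0; apply: esum_ge; exists [set x]; first by split.
by rewrite fsbig_set1.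
Qed.

Lemma esum_eq0 f : (forall x, 0 <= f x) -> \esum_(x in [set: T]) f x = 0 ->
  forall x, f x = 0.
Proof.
by move=> f0 e x; apply/eqP; rewrite eq_le f0 andbT -e esum_term_le.
Qed.

(** Finite partial sums give one inequality; applying it to [c^-1] gives the other one for finite
    nonzero [c]. For [c = +oo] a single nonzero term already makes both sides infinite. *)
Lemma esumTZl (c : \bar R) f : 0 <= c -> (forall x, 0 <= f x) ->
  \esum_(x in [set: T]) (c * f x) = c * \esum_(x in [set: T]) f x.
Proof.
move=> c0 f0.
have le1 (d : \bar R) g : 0 <= d -> (forall x, 0 <= g x) ->
    \esum_(x in [set: T]) (d * g x) <= d * \esum_(x in [set: T]) g x.
  move=> d0 g0; apply: ge_ereal_sup => _ [X [finX XT] <-].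
  rewrite fsbig_finite//= -ge0_sume_distrr// lee_wpmul2l//.
  by apply: esum_ge; exists X => //; rewrite fsbig_finite.
apply/eqP; rewrite eq_le le1//=.
case: c c0 => [c| |] // c0.
- have [->|cn0] := eqVneq c 0%R.
    by rewrite mul0e esumT_ge0// => x; rewrite mul0e.
  have cp : (0 < c)%R by rewrite lt0r cn0 -lee_fin.
  have : \esum_(x in [set: T]) f x <=
         (c^-1)%:E * \esum_(x in [set: T]) (c%:E * f x).
    rewrite (@eq_esumT f (fun x => (c^-1)%:E * (c%:E * f x))); last first.
      by move=> x; rewrite muleA -EFinM mulVf ?mul1e// gt_eqF.
    apply: (le1 (c^-1)%:E (fun x => c%:E * f x)) => [|x].
      by rewrite lee_fin invr_ge0 (ltW cp).
    by rewrite mule_ge0.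
  move=> /(lee_wpmul2l c0) /le_trans; apply.
  by rewrite muleA -EFinM divff ?mul1e.
- have [->|] := eqVneq (\esum_(x in [set: T]) f x) 0.
    by rewrite mule0 esumT_ge0// => x; rewrite mule_ge0.
  move=> S0; have [x fx] : exists x, f x != 0.
    apply/not_existsP => H; move/negP: S0; apply; apply/eqP.
    by apply: esum1 => x _; apply/eqP/negPn/negP/H.
  apply: (@le_trans _ _ +oo); first by rewrite leey.
  have fxy : +oo * f x = +oo :> \bar R by rewrite gt0_mulye// lt0e fx f0.
  rewrite -{1}fxy.
  by apply: (@esum_term_le (fun x => +oo * f x)) => y; rewrite mule_ge0.
Qed.

Lemma esumTZr (c : \bar R) f : 0 <= c -> (forall x, 0 <= f x) ->
  \esum_(x in [set: T]) (f x * c) = (\esum_(x in [set: T]) f x) * c.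
Proof.
by move=> c0 f0; rewrite muleC -esumTZl//; apply: eq_esumT => x; rewrite muleC.
Qed.

Lemma esum_bij (T' : choiceType) (h : T' -> T) (h' : T -> T') f :
  cancel h h' -> cancel h' h ->
  \esum_(x in [set: T]) f x = \esum_(x in [set: T']) f (h x).
Proof.
move=> hK h'K; apply: reindex_esum; split => //.
- by move=> x y _ _ /(congr1 h'); rewrite !hK.
- by move=> y _; exists (h' y).
Qed.

End esum_tools.

Lemma esum_swap (R : realType) (T T' : choiceType) (f : T -> T' -> \bar R) :
  (forall x y, 0 <= f x y)%E ->
  \esum_(x in [set: T]) \esum_(y in [set: T']) f x y =
  \esum_(y in [set: T']) \esum_(x in [set: T]) f x y.
Proof.
move=> f0.
rewrite (@esum_esum _ _ _ [set: T] (fun=> [set: T']) f)//.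
rewrite (@esum_esum _ _ _ [set: T'] (fun=> [set: T]) (fun y x => f x y))//.
have -> : [set: T] `*`` (fun=> [set: T']) = setT by apply/seteqP; split.
have -> : [set: T'] `*`` (fun=> [set: T]) = setT by apply/seteqP; split.
by rewrite (@esum_bij _ _ _ (fun k : T' * T => (k.2, k.1))
  (fun k : T * T' => (k.2, k.1)))//; case.
Qed.

(** * Powers, and the inequalities of Hoelder and Jensen for unordered sums *)

Section power_tools.
Local Open Scope ereal_scope.
Variable R : realType.
Implicit Types (x y : \bar R) (r s : R).

Lemma le_poweR r x y : (0 <= r)%R -> 0 <= x -> x <= y -> x `^ r <= y `^ r.
Proof.
move=> r0 x0 xy; apply: gt0_ler_poweR => //; rewrite in_itv/= leey andbT//.
exact: le_trans xy.
Qed.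

Lemma poweR_merge x r s t : (0 < r)%R -> (0 < s)%R -> (r + s = t)%R ->
  x `^ r * x `^ s = x `^ t.
Proof.
by move=> r0 s0 <-; rewrite poweRD//; apply: add_neq0_poweRD_def; rewrite gt_eqF ?addr_gt0.
Qed.

Lemma weighted_amgm (a b th : R) : (0 <= a)%R -> (0 <= b)%R -> (0 < th < 1)%R ->
  (a `^ (1 - th) * b `^ th <= (1 - th) * a + th * b)%R.
Proof.
move=> a0 b0 /andP[th0 th1].
have t1 : (0 < 1 - th)%R by lra.
have := @conjugate_powR R (a `^ (1 - th))%R (b `^ th)%R (1 - th)^-1%R th^-1%R.
rewrite !powR_ge0 !invr_gt0 t1 th0 !invrK subrK => /(_ erefl erefl erefl erefl erefl).
rewrite -!powRrM !divff ?gt_eqF// !powRr1//.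
by rewrite (mulrC (1 - th)%R a) (mulrC th b).
Qed.

End power_tools.

Lemma powR_exprn (R : realType) (x q : R) (n : nat) : 0 <= x ->
  (x ^+ n) `^ q = (x `^ q) ^+ n.
Proof.
by move=> x0; rewrite -(powR_mulrn n x0) -(powR_mulrn n (powR_ge0 x q)) powRAC.
Qed.

Section hoelder.
Local Open Scope ereal_scope.
Variables (R : realType) (T : choiceType).
Implicit Types (a b : T -> \bar R).

(** With A and B the two sums, weighted AM-GM is applied to a/A and b/B and summed. The values 0 and
    +oo of A or B are settled beforehand, because the quotients need positive finite
    denominators. *)
Lemma esum_hoelder a b (th : R) : (0 < th < 1)%R ->
  (forall x, 0 <= a x) -> (forall x, 0 <= b x) ->
  \esum_(x in [set: T]) (a x `^ (1 - th) * b x `^ th) <=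
  (\esum_(x in [set: T]) a x) `^ (1 - th) * (\esum_(x in [set: T]) b x) `^ th.
Proof.
move=> /[dup] th01 /andP[th0 th1] a0 b0.
have t1 : (0 < 1 - th)%R by rewrite subr_gt0.
set A := \esum_(x in [set: T]) a x; set B := \esum_(x in [set: T]) b x.
have A0 : 0 <= A by exact: esumT_ge0.
have B0 : 0 <= B by exact: esumT_ge0.
have RHS0 : 0 <= A `^ (1 - th) * B `^ th by rewrite mule_ge0 ?poweR_ge0.
have [AE|An0] := eqVneq A 0.
  rewrite esum1// => x _.
  by rewrite (esum_eq0 a0 AE) poweR0r ?gt_eqF// mul0e.
have [BE|Bn0] := eqVneq B 0.
  rewrite esum1// => x _.
  by rewrite (esum_eq0 b0 BE) (@poweR0r _ th) ?gt_eqF// mule0.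
have [AE|Afin] := eqVneq A +oo.
  rewrite AE poweRyr ?gt_eqF// gt0_mulye ?leey//.
  by rewrite poweR_gt0// lt0e Bn0.
have [BE|Bfin] := eqVneq B +oo.
  rewrite BE (@poweRyr _ th) ?gt_eqF// gt0_muley ?leey//.
  by rewrite poweR_gt0// lt0e An0.
have afin x : a x < +oo.
  by apply: le_lt_trans (esum_term_le x a0) _; rewrite ltey.
have bfin x : b x < +oo.
  by apply: le_lt_trans (esum_term_le x b0) _; rewrite ltey.
have Af : A \is a fin_num by rewrite ge0_fin_numE// ltey.
have Bf : B \is a fin_num by rewrite ge0_fin_numE// ltey.
pose A' := fine A; pose B' := fine B.
have AE : A = A'%:E by rewrite fineK.
have BE : B = B'%:E by rewrite fineK.
have A'0 : (0 < A')%R by rewrite -lte_fin -AE lt0e An0.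
have B'0 : (0 < B')%R by rewrite -lte_fin -BE lt0e Bn0.
pose K := (A' `^ (1 - th) * B' `^ th)%R.
have K0 : (0 <= K)%R by rewrite mulr_ge0 ?powR_ge0.
apply: (@le_trans _ _ (\esum_(x in [set: T])
   ((K * (1 - th) / A')%:E * a x + (K * th / B')%:E * b x))).
  apply: le_esumT => x.
  have ax : a x \is a fin_num by rewrite ge0_fin_numE.
  have bx : b x \is a fin_num by rewrite ge0_fin_numE.
  rewrite -(fineK ax) -(fineK bx).
  set ax' := fine (a x); set bx' := fine (b x).
  have ax0 : (0 <= ax')%R by rewrite fine_ge0.
  have bx0 : (0 <= bx')%R by rewrite fine_ge0.
  rewrite !poweR_EFin -!EFinM -EFinD lee_fin.
  have -> : (ax' `^ (1 - th) * bx' `^ th =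
    K * ((ax' / A') `^ (1 - th) * (bx' / B') `^ th))%R.
    rewrite !powRM ?invr_ge0 ?(ltW A'0) ?(ltW B'0)//.
    rewrite -!powR_inv1 ?(ltW A'0) ?(ltW B'0)// -!powRrM.
    rewrite !mulN1r !powRN /K.
    by field; rewrite !gt_eqF// ?powR_gt0.
  have -> : (K * (1 - th) / A' * ax' + K * th / B' * bx' =
    K * ((1 - th) * (ax' / A') + th * (bx' / B')))%R by ring.
  by rewrite ler_wpM2l// weighted_amgm// divr_ge0// ltW.
have cA : 0 <= (K * (1 - th) / A')%:E.
  by rewrite lee_fin divr_ge0 ?(ltW A'0)// mulr_ge0// ltW.
have cB : 0 <= (K * th / B')%:E.
  by rewrite lee_fin divr_ge0 ?(ltW B'0)// mulr_ge0// ltW.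
rewrite esumTD; [|by move=> x; exact: mule_ge0..].
rewrite !esumTZl//.
have -> : A `^ (1 - th) * B `^ th = K%:E by rewrite AE BE.
rewrite -/A -/B AE BE -!EFinM -EFinD lee_fin.
rewrite le_eqVlt; apply/orP; left; apply/eqP; field.
by rewrite !gt_eqF.
Qed.

(** Hoelder applied to the splitting a b = a^(1-1/q) (a b^q)^(1/q). The total mass of [a] is left
    arbitrary, so that the inequality also serves for l^1 functions and for the geometric weights of
    a Neumann series. *)
Lemma esum_jensen a b (q : R) : (1 < q)%R ->
  (forall x, 0 <= a x) -> (forall x, 0 <= b x) ->
  (\esum_(x in [set: T]) (a x * b x)) `^ q <=
  (\esum_(x in [set: T]) a x) `^ (q - 1) * \esum_(x in [set: T]) (a x * b x `^ q).
Proof.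
move=> q1 a0 b0.
have q0 : (0 < q)%R by lra.
have th01 : (0 < q^-1 < 1)%R by rewrite invr_gt0 q0 invf_lt1.
have S0 : 0 <= \esum_(x in [set: T]) a x by exact: esumT_ge0.
have S'0 : 0 <= \esum_(x in [set: T]) (a x * b x `^ q).
  by apply: esumT_ge0 => x; rewrite mule_ge0// poweR_ge0.
have H := @esum_hoelder a (fun x => a x * b x `^ q) q^-1 th01 a0.
have {}H : \esum_(x in [set: T]) (a x * b x) <=
  (\esum_(x in [set: T]) a x) `^ (1 - q^-1) *
  (\esum_(x in [set: T]) (a x * b x `^ q)) `^ q^-1.
  apply: le_trans (H _); last by move=> x; rewrite mule_ge0// poweR_ge0.
  apply: le_esumT => x; rewrite poweRM ?poweR_ge0// -poweRrM divff ?gt_eqF//.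
  rewrite poweRe1// muleA (@poweR_merge _ _ _ _ 1%R) ?poweRe1//.
  - by rewrite subr_gt0; case/andP: th01.
  - by rewrite invr_gt0.
  - by rewrite subrK.
have := le_poweR (ltW q0) _ H; rewrite poweRM ?poweR_ge0// -!poweRrM.
rewrite mulVf ?gt_eqF// (poweRe1 S'0) mulrBl mul1r mulVf ?gt_eqF//.
by apply; apply: esumT_ge0 => x; rewrite mule_ge0.
Qed.

End hoelder.

(** * Convolution of nonnegative functions on a group *)

Section convolution.
Local Open Scope ereal_scope.
Variables (R : realType) (G : countType) (mul : G -> G -> G).
Variables (inv : G -> G) (e : G).
Hypothesis gp : is_group mul inv e.
Implicit Types (u v w : G -> \bar R) (mu nu : G -> R).

(** Values in [\bar R] make associativity and Fubini free of summability conditions; on probability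
    measures it agrees with [conv] ([EFin_conv]). *)
Definition econv u v : G -> \bar R :=
  fun s => \esum_(t in [set: G]) (u t * v (mul (inv t) s)).

Let mulA s t r : mul s (mul t r) = mul (mul s t) r. Proof. exact: gp.1. Qed.
Let mul1g s : mul e s = s. Proof. by have [_ [/(_ s)[]]] := gp. Qed.
Let mulg1 s : mul s e = s. Proof. by have [_ [/(_ s)[]]] := gp. Qed.
Let mulVg s : mul (inv s) s = e. Proof. by have [_ [_ /(_ s)[]]] := gp. Qed.
Let mulgV s : mul s (inv s) = e. Proof. by have [_ [_ /(_ s)[]]] := gp. Qed.

Lemma group_mulK s : cancel (mul s) (mul (inv s)).
Proof. by move=> x; rewrite mulA mulVg mul1g. Qed.

Lemma group_mulVK s : cancel (mul (inv s)) (mul s).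
Proof. by move=> x; rewrite mulA mulgV mul1g. Qed.

Lemma group_invM s t : inv (mul s t) = mul (inv t) (inv s).
Proof.
apply: (can_inj (group_mulK (mul s t))).
by rewrite mulgV -mulA (mulA t) mulgV mul1g mulgV.
Qed.

Lemma group_invK s : inv (inv s) = s.
Proof. by apply: (can_inj (group_mulK (inv s))); rewrite mulgV mulVg. Qed.

Lemma esum_translate_inv v s :
  \esum_(t in [set: G]) v (mul (inv t) s) = \esum_(t in [set: G]) v t.
Proof.
symmetry; apply: (@esum_bij _ _ _ (fun t => mul (inv t) s) (fun t => mul s (inv t))).
- by move=> t; rewrite group_invM group_mulVK group_invK.
- by move=> t; rewrite group_invM group_invK -mulA mulVg mulg1.
Qed.

Lemma esum_translate v t :
  \esum_(s in [set: G]) v (mul (inv t) s) = \esum_(s in [set: G]) v s.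
Proof.
symmetry; apply: (@esum_bij _ _ _ (mul (inv t)) (mul t)).
- exact: group_mulVK.
- exact: group_mulK.
Qed.

Lemma econv_ge0 u v s : (forall t, 0 <= u t) -> (forall t, 0 <= v t) ->
  0 <= econv u v s.
Proof. by move=> u0 v0; apply: esumT_ge0 => t; exact: mule_ge0. Qed.

Lemma le_econv u u' v v' s : (forall t, 0 <= u t) -> (forall t, 0 <= v t) ->
  (forall t, u t <= u' t) -> (forall t, v t <= v' t) ->
  econv u v s <= econv u' v' s.
Proof. by move=> u0 v0 uu vv; apply: le_esumT => t; exact: lee_pmul. Qed.

Lemma econvZr c u v s : 0 <= c -> (forall t, 0 <= u t) -> (forall t, 0 <= v t) ->
  econv u (fun t => c * v t) s = c * econv u v s.
Proof.
move=> c0 u0 v0; rewrite -esumTZl//; last by move=> t; exact: mule_ge0.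
by apply: eq_esumT => t; rewrite muleCA.
Qed.

Lemma econvA u v w : (forall t, 0 <= u t) -> (forall t, 0 <= v t) ->
  (forall t, 0 <= w t) -> econv (econv u v) w = econv u (econv v w).
Proof.
move=> u0 v0 w0; apply/funext => s; rewrite /econv.
have E x : (\esum_(t in [set: G]) (u t * v (mul (inv t) x))) * w (mul (inv x) s)
    = \esum_(t in [set: G]) (u t * v (mul (inv t) x) * w (mul (inv x) s)).
  by rewrite esumTZr// => t; rewrite mule_ge0.
rewrite (eq_esumT E) esum_swap; last by move=> x t; rewrite !mule_ge0.
apply: eq_esumT => t.
rewrite -esumTZl//; last by move=> x; rewrite mule_ge0.
rewrite (@esum_bij _ _ _ (mul t) (mul (inv t))) //;
  [|exact: group_mulK|exact: group_mulVK].
by apply: eq_esumT => x; rewrite group_mulK group_invM mulA muleA.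
Qed.

Lemma esum_econv u v : (forall t, 0 <= u t) -> (forall t, 0 <= v t) ->
  \esum_(s in [set: G]) econv u v s =
  (\esum_(s in [set: G]) u s) * (\esum_(s in [set: G]) v s).
Proof.
move=> u0 v0; rewrite /econv esum_swap; last by move=> s t; rewrite mule_ge0.
rewrite -esumTZr//; last exact: esumT_ge0.
by apply: eq_esumT => t; rewrite esumTZl// esum_translate.
Qed.

Let dirac0 s : (0 <= @dirac_e R G e s)%R.
Proof. by rewrite /dirac_e; case: ifP. Qed.

Lemma esum_dirac (f : G -> \bar R) s : (forall t, 0 <= f t) ->
  \esum_(t in [set: G]) ((dirac_e R s t)%:E * f t) = f s.
Proof.
move=> f0; have H t : ((dirac_e R s t)%:E * f t) = if t \in [set s] then f t else 0.
  rewrite /dirac_e; case: ifPn => [/eqP->|ts]; first by rewrite mem_set// mul1e.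
  by rewrite memNset ?mul0e//; apply/eqP.
by rewrite (eq_esumT H) -esum_mkcond esum_set1.
Qed.

Let inv1 : inv e = e. Proof. by rewrite -[LHS]mul1g mulgV. Qed.

Lemma econv1g v : (forall t, 0 <= v t) -> econv (EFin \o dirac_e R e) v = v.
Proof.
move=> v0; apply/funext => s; rewrite /econv /=.
by rewrite (@esum_dirac (fun t => v (mul (inv t) s)))// inv1 mul1g.
Qed.

Lemma econvg1 v : (forall t, 0 <= v t) -> econv v (EFin \o dirac_e R e) = v.
Proof.
move=> v0; apply/funext => s; rewrite /econv /=.
rewrite -[RHS](@esum_dirac v s)//; apply: eq_esumT => t; rewrite muleC.
congr (_%:E * _); rewrite /dirac_e; congr (if _ then _ else _).
apply/eqP/eqP => [H|->]; last by rewrite mulVg.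
by rewrite -(group_mulVK t s) H mulg1.
Qed.

Lemma prob_le1 mu s : is_prob mu -> (mu s <= 1)%R.
Proof.
move=> [mu0 mu1]; rewrite -lee_fin -mu1.
by apply: (@esum_term_le _ _ (EFin \o mu)) => y; rewrite lee_fin.
Qed.

Lemma EFin_conv mu nu s : is_prob mu -> is_prob nu ->
  (conv mul inv mu nu s)%:E = econv (EFin \o mu) (EFin \o nu) s.
Proof.
move=> [mu0 mu1] [nu0 nu1]; rewrite /conv -/(econv (EFin \o mu) (EFin \o nu) s).
have c0 t : 0 <= econv (EFin \o mu) (EFin \o nu) t.
  by apply: econv_ge0 => x /=; rewrite lee_fin.
rewrite fineK// ge0_fin_numE//.
apply: le_lt_trans (esum_term_le s c0) _.
by rewrite esum_econv//= ?mu1 ?nu1 ?mule1 ?ltry// => t; rewrite lee_fin.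
Qed.

Lemma is_prob_conv mu nu : is_prob mu -> is_prob nu ->
  is_prob (conv mul inv mu nu).
Proof.
move=> pm pn; move: (pm) (pn) => [mu0 mu1] [nu0 nu1]; split=> [s|].
  by rewrite -lee_fin EFin_conv// econv_ge0// => x /=; rewrite lee_fin.
under eq_esumT do rewrite EFin_conv//.
by rewrite esum_econv//= ?mu1 ?nu1 ?mule1// => t; rewrite lee_fin.
Qed.

Lemma is_prob_dirac : is_prob (dirac_e R e).
Proof.
split => //; rewrite -[RHS](@esum_dirac (fun=> 1) e)//.
by apply: eq_esumT => t; rewrite mule1.
Qed.

Lemma is_prob_convpow mu n : is_prob mu -> is_prob (convpow mul inv e mu n).
Proof.
move=> pm; elim: n => [|n ih] /=; first exact: is_prob_dirac.
exact: is_prob_conv.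
Qed.

(** [convpow] multiplies by [mu] on the right only; this law also supplies the left form, which is
    what a right inverse of z - T requires. *)
Lemma econv_convpowD mu m n : is_prob mu ->
  econv (EFin \o convpow mul inv e mu m) (EFin \o convpow mul inv e mu n) =
  EFin \o convpow mul inv e mu (m + n).
Proof.
move=> pm.
have p0 k s : 0 <= (EFin \o convpow mul inv e mu k) s.
  by rewrite lee_fin; exact: (is_prob_convpow k pm).1.
elim: n => [|n ih]; first by rewrite addn0 econvg1.
have S k : EFin \o convpow mul inv e mu k.+1 =
    econv (EFin \o convpow mul inv e mu k) (EFin \o mu).
  by apply/funext => s /=; rewrite EFin_conv//; exact: is_prob_convpow.
rewrite addnS !S -ih econvA// => t; rewrite lee_fin; exact: pm.1.
Qed.

Lemma convpow1 mu : is_prob mu -> convpow mul inv e mu 1 = mu.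
Proof.
move=> pm; apply/funext => s /=; apply: EFin_inj.
rewrite EFin_conv//; last exact: is_prob_dirac.
by rewrite econv1g// => t; rewrite lee_fin; exact: pm.1.
Qed.

Lemma convpowD mu m n : is_prob mu ->
  convpow mul inv e mu (m + n) =
  conv mul inv (convpow mul inv e mu m) (convpow mul inv e mu n).
Proof.
move=> pm; apply/funext => s; apply: EFin_inj.
rewrite EFin_conv ?econv_convpowD//; exact: is_prob_convpow.
Qed.

End convolution.

(** * Entropy of convolutions and Fekete's lemma *)

Section entropy.
Local Open Scope ereal_scope.
Variables (R : realType) (G : countType) (mul : G -> G -> G).
Variables (inv : G -> G) (e : G).
Hypothesis gp : is_group mul inv e.
Implicit Types (mu nu : G -> R).

Lemma shannonE mu : shannon mu = \esum_(s in [set: G]) (- (mu s * ln (mu s)))%:E.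
Proof.
by apply: eq_esumT => s; case: eqP => [->|//]; rewrite mul0r oppr0.
Qed.

Lemma entropy_term_ge0 mu s : is_prob mu -> 0 <= (- (mu s * ln (mu s)))%:E.
Proof.
by move=> pm; rewrite lee_fin oppr_ge0 mulr_ge0_le0 ?pm.1// ln_le0 ?prob_le1.
Qed.

Lemma shannon_ge0 mu : is_prob mu -> 0 <= shannon mu.
Proof. by move=> pm; rewrite shannonE esumT_ge0// => s; exact: entropy_term_ge0. Qed.

(** Let y be the value of the convolution at s, a sum of products x_t. As x_t <= y, the quantity - y
    ln y = sum x_t (- ln y) is at most sum phi(x_t) with phi(x) = - x ln x. Then phi(a b) = phi(a) b
    + a phi(b) splits the double sum into the two entropies. *)
Lemma shannon_conv mu nu : is_prob mu -> is_prob nu ->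
  shannon (conv mul inv mu nu) <= shannon mu + shannon nu.
Proof.
move=> pm pn; move: (pm) (pn) => [mu0 mu1] [nu0 nu1].
have pc := is_prob_conv gp pm pn.
pose phi (x : R) := (- (x * ln x))%R.
have m1 t s : (mu t * nu s <= 1)%R by rewrite mulr_ile1 ?prob_le1.
have m0 t s : (0 <= mu t * nu s)%R by rewrite mulr_ge0.
have ph0 t s : 0 <= (phi (mu t * nu s))%:E.
  by rewrite lee_fin oppr_ge0 mulr_ge0_le0// ln_le0.
rewrite shannonE.
apply: (@le_trans _ _ (\esum_(s in [set: G]) \esum_(t in [set: G])
    (phi (mu t * nu (mul (inv t) s)))%:E)).
  apply: le_esumT => s; set y := conv mul inv mu nu s.
  have yE := EFin_conv gp s pm pn; rewrite -/y in yE.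
  have y0 : (0 <= y)%R by exact: pc.1.
  have y1 : (y <= 1)%R by exact: prob_le1.
  rewrite -mulrN mulrC EFinM yE /econv -esumTZl//; last 2 first.
  - by rewrite lee_fin oppr_ge0 ln_le0.
  - by move=> t; rewrite /= -EFinM lee_fin.
  apply: le_esumT => t /=; rewrite -!EFinM lee_fin /phi.
  have := m0 t (mul (inv t) s); rewrite le_eqVlt => /predU1P[<-|mp].
    by rewrite mulr0 mul0r oppr0.
  rewrite -mulrN mulrC ler_wpM2l// lerN2.
  have my : (mu t * nu (mul (inv t) s) <= y)%R.
    rewrite -lee_fin yE.
    apply: (@esum_term_le _ _ (fun t => (mu t * nu (mul (inv t) s))%:E)) => z.
    by rewrite lee_fin.
  by rewrite ler_ln// ?posrE//; exact: lt_le_trans my.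
rewrite esum_swap//.
have phM a b : (0 <= a)%R -> (0 <= b)%R -> phi (a * b)%R = (phi a * b + a * phi b)%R.
  rewrite /phi le_eqVlt => /predU1P[<-|a0]; first by rewrite !mul0r; lra.
  rewrite le_eqVlt => /predU1P[<-|b0]; first by rewrite !(mulr0,mul0r); lra.
  by rewrite lnM ?posrE//; ring.
have phn0 s : 0 <= (phi (nu s))%:E by exact: entropy_term_ge0.
have phm0 s : 0 <= (phi (mu s))%:E by exact: entropy_term_ge0.
have nuE0 s : 0 <= (nu s)%:E by rewrite lee_fin.
have muE0 s : 0 <= (mu s)%:E by rewrite lee_fin.
have E t : \esum_(s in [set: G]) (phi (mu t * nu (mul (inv t) s)))%:E =
   (phi (mu t))%:E + (mu t)%:E * shannon nu.
  rewrite (esum_translate gp (fun s => (phi (mu t * nu s))%:E)).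
  under eq_esumT do rewrite phM// EFinD !EFinM.
  rewrite esumTD; last 2 first.
  - by move=> s; rewrite mule_ge0// lee_fin.
  - by move=> s; rewrite mule_ge0// lee_fin.
  rewrite (esumTZl (phm0 t) (fun s => nuE0 s)) (esumTZl (muE0 t) phn0).
  by rewrite nu1 mule1 shannonE.
under eq_esumT do rewrite E.
rewrite esumTD//; last by move=> t; rewrite mule_ge0 ?lee_fin ?shannon_ge0.
rewrite (esumTZr (shannon_ge0 pn) muE0) mu1 mul1e [shannon mu]shannonE.
exact: lexx.
Qed.

Lemma shannon_dirac : shannon (dirac_e R e) = 0.
Proof.
by rewrite shannonE esum1// => s _; rewrite /dirac_e; case: ifP;
  rewrite ?ln1 ?mulr0 ?mul0r ?oppr0.
Qed.

End entropy.

(** Division of n by a nearly optimal m bounds H n by n (H m / m) + C. The constant absorbs the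
    remainder below m and the value H 0, which is not assumed to vanish. *)
Lemma fekete (R : realType) (H : nat -> R) :
  (forall n, 0 <= H n) -> (forall m n, H (m + n)%N <= H m + H n) ->
  exists2 h, (fun n => H n / n%:R) @ \oo --> h & forall n, (0 < n)%N -> h <= H n / n%:R.
Proof.
move=> H0 sub.
pose A := [set H n / n%:R | n in [set n | (0 < n)%N]].
have A0 : has_inf A.
  split; first by exists (H 1%N / 1%:R); exists 1%N.
  by exists 0 => _ [n _ <-]; rewrite divr_ge0.
have lb n : (0 < n)%N -> inf A <= H n / n%:R.
  by move=> n0; apply: ge_inf; [exact: A0.2|exists n].
exists (inf A) => //.
have HM k n : H (k * n)%N + 0 <= k%:R * H n + H 0%N.
  elim: k => [|k ih]; first by rewrite mul0n mul0r addr0 add0r.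
  by rewrite mulSn -natr1; have := sub n (k * n)%N; lra.
have Hle i : H i <= i%:R * H 1%N + H 0%N.
  by have := HM i 1%N; rewrite muln1 addr0.
apply/cvgrPdist_le => eps eps0.
have [_ [m m0 <-] Hm] := inf_adherent (divr_gt0 eps0 (ltr0n _ 2)) A0.
pose C := m%:R * H 1%N + H 0%N + H 0%N.
have C0 : 0 <= C by rewrite !addr_ge0// mulr_ge0.
have mR : (0 : R) < m%:R by rewrite ltr0n.
near=> n.
have n0 : (0 < n)%N by near: n; exact: nbhs_infty_gt.
have nR : (0 : R) < n%:R by rewrite ltr0n.
have nC : 2 * C / eps <= n%:R by near: n; exact: nbhs_infty_ger.
rewrite distrC ger0_norm ?subr_ge0 ?lb//.
have : H n <= n%:R * (H m / m%:R) + C.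
  rewrite {1}(divn_eq n m); apply: le_trans (sub _ _) _.
  have h1 := HM (n %/ m)%N m; have h2 := Hle (n %% m)%N.
  have h3 : (n %% m)%:R * H 1%N <= m%:R * H 1%N.
    by rewrite ler_wpM2r// ler_nat ltnW// ltn_mod.
  have h4 : (n %/ m)%:R * H m <= n%:R * (H m / m%:R).
    have -> : n%:R * (H m / m%:R) = n%:R / m%:R * H m by ring.
    rewrite ler_wpM2r// ler_pdivlMr// -natrM ler_nat.
    exact: leq_divM.
  rewrite /C; lra.
move=> h5; rewrite lerBlDl ler_pdivrMr//.
have h6 : C <= eps / 2 * n%:R.
  by move: nC; rewrite ler_pdivrMr//; lra.
have h7 : n%:R * (H m / m%:R) <= n%:R * (inf A + eps / 2).
  by rewrite ler_wpM2l ?(ltW nR)// ltW.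
lra.
Unshelve. all: by end_near. Qed.

Local Notation normc := Normc.normc.

(** * Absolutely convergent real and complex sums *)

Section rsum_theory.
Variables (R : realType) (T : countType).
Implicit Types (h k a b : T -> R).

(** Any decomposition of h into summable nonnegative parts gives the same difference, since P + b
    and Q + a agree termwise. This is the route to linearity: positive and negative parts are not
    additive themselves. *)
Lemma rsumE a b h : (forall x, 0 <= a x) -> (forall x, 0 <= b x) ->
  (\esum_(x in [set: T]) (a x)%:E < +oo)%E ->
  (\esum_(x in [set: T]) (b x)%:E < +oo)%E ->
  (forall x, h x = a x - b x) ->
  rsum h = fine (\esum_(x in [set: T]) (a x)%:E) - fine (\esum_(x in [set: T]) (b x)%:E).
Proof.
move=> a0 b0 Sa Sb hE.
have m0 (x : R) : (0 <= (Num.max x 0)%:E)%E by rewrite lee_fin le_max lexx orbT.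
have ea0 x : (0 <= (a x)%:E)%E by rewrite lee_fin.
have eb0 x : (0 <= (b x)%:E)%E by rewrite lee_fin.
rewrite /rsum; set P := esum _ _; set Q := esum _ _.
have Pa : (P <= \esum_(x in [set: T]) (a x)%:E)%E.
  apply: le_esumT => x; rewrite lee_fin ge_max a0 andbT hE.
  by rewrite lerBlDr lerDl.
have Qb : (Q <= \esum_(x in [set: T]) (b x)%:E)%E.
  apply: le_esumT => x; rewrite lee_fin ge_max b0 andbT hE opprB.
  by rewrite lerBlDr lerDl.
have E : (P + \esum_(x in [set: T]) (b x)%:E = Q + \esum_(x in [set: T]) (a x)%:E)%E.
  rewrite -!esumTD//; apply: eq_esumT => x; rewrite -!EFinD hE; congr EFin.
  by rewrite /Num.max; case: ifPn; case: ifPn; rewrite ?opprB; lra.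
have fin (x : \bar R) : (0 <= x -> x < +oo -> x \is a fin_num)%E.
  by move=> ? ?; rewrite ge0_fin_numE.
have Pf : P \is a fin_num by apply: fin; [exact: esumT_ge0|exact: le_lt_trans Sa].
have Qf : Q \is a fin_num by apply: fin; [exact: esumT_ge0|exact: le_lt_trans Sb].
have Af := fin _ (esumT_ge0 ea0) Sa.
have Bf := fin _ (esumT_ge0 eb0) Sb.
by have := congr1 fine E; rewrite !fineD//; lra.
Qed.

Let pos h : T -> R := fun x => Num.max (h x) 0.
Let neg h : T -> R := fun x => Num.max (- h x) 0.

Let pos_ge0 h x : 0 <= pos h x. Proof. by rewrite le_max lexx orbT. Qed.
Let neg_ge0 h x : 0 <= neg h x. Proof. by rewrite le_max lexx orbT. Qed.
Let pos_neg h x : h x = pos h x - neg h x.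
Proof. by rewrite /pos /neg /Num.max; case: ifPn; case: ifPn; lra. Qed.

Definition rsummable h := (\esum_(x in [set: T]) `|h x|%:E < +oo)%E.

Let pos_le h x : ((pos h x)%:E <= `|h x|%:E)%E.
Proof. by rewrite lee_fin ge_max normr_ge0 ler_norm. Qed.
Let neg_le h x : ((neg h x)%:E <= `|h x|%:E)%E.
Proof. by rewrite lee_fin ge_max normr_ge0 -normrN ler_norm. Qed.

Let pos_fin h : rsummable h -> (\esum_(x in [set: T]) (pos h x)%:E < +oo)%E.
Proof. by apply: le_lt_trans; apply: le_esumT. Qed.
Let neg_fin h : rsummable h -> (\esum_(x in [set: T]) (neg h x)%:E < +oo)%E.
Proof. by apply: le_lt_trans; apply: le_esumT. Qed.

Lemma esum_fin_num (f : T -> \bar R) : (forall x, 0 <= f x)%E ->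
  (\esum_(x in [set: T]) f x < +oo)%E -> (\esum_(x in [set: T]) f x)%E \is a fin_num.
Proof. by move=> f0; rewrite ge0_fin_numE// esumT_ge0. Qed.

Let fineD' a b : (forall x, 0 <= a x) -> (forall x, 0 <= b x) ->
  (\esum_(x in [set: T]) (a x)%:E < +oo)%E ->
  (\esum_(x in [set: T]) (b x)%:E < +oo)%E ->
  fine (\esum_(x in [set: T]) (a x + b x)%:E) =
  fine (\esum_(x in [set: T]) (a x)%:E) + fine (\esum_(x in [set: T]) (b x)%:E) /\
  (\esum_(x in [set: T]) (a x + b x)%:E < +oo)%E.
Proof.
move=> a0 b0 Sa Sb.
have E : (\esum_(x in [set: T]) (a x + b x)%:E =
   \esum_(x in [set: T]) (a x)%:E + \esum_(x in [set: T]) (b x)%:E)%E.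
  by rewrite -esumTD//= => x; rewrite lee_fin.
rewrite E; split; last exact: lte_add_pinfty.
by rewrite fineD// esum_fin_num// => x; rewrite lee_fin.
Qed.

Lemma rsumD h k : rsummable h -> rsummable k ->
  rsum (fun x => h x + k x) = rsum h + rsum k.
Proof.
move=> sh sk.
have [e1 f1] := fineD' (pos_ge0 h) (pos_ge0 k) (pos_fin sh) (pos_fin sk).
have [e2 f2] := fineD' (neg_ge0 h) (neg_ge0 k) (neg_fin sh) (neg_fin sk).
rewrite (@rsumE (fun x => pos h x + pos k x) (fun x => neg h x + neg k x))//.
- by rewrite e1 e2 /rsum -/(pos h) -/(neg h) -/(pos k) -/(neg k); lra.
- by move=> x; rewrite addr_ge0.
- by move=> x; rewrite addr_ge0.
- by move=> x; rewrite (pos_neg h) (pos_neg k); lra.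
Qed.

Let fineZ c a : 0 <= c -> (forall x, 0 <= a x) ->
  (\esum_(x in [set: T]) (a x)%:E < +oo)%E ->
  fine (\esum_(x in [set: T]) (c * a x)%:E) =
  c * fine (\esum_(x in [set: T]) (a x)%:E) /\
  (\esum_(x in [set: T]) (c * a x)%:E < +oo)%E.
Proof.
move=> c0 a0 Sa.
have E : (\esum_(x in [set: T]) (c * a x)%:E = c%:E * \esum_(x in [set: T]) (a x)%:E)%E.
  by rewrite -esumTZl//= => x; rewrite lee_fin.
have fa : (\esum_(x in [set: T]) (a x)%:E)%E \is a fin_num.
  by rewrite esum_fin_num// => x; rewrite lee_fin.
rewrite E; split; first by rewrite fineM.
by rewrite -(fineK fa) -EFinM ltry.
Qed.

Lemma rsumZ c h : rsummable h -> rsum (fun x => c * h x) = c * rsum h.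
Proof.
move=> sh; have [c0|c0] := leP 0 c.
  have [e1 f1] := fineZ c0 (pos_ge0 h) (pos_fin sh).
  have [e2 f2] := fineZ c0 (neg_ge0 h) (neg_fin sh).
  rewrite (@rsumE (fun x => c * pos h x) (fun x => c * neg h x))//.
  - by rewrite e1 e2 /rsum -/(pos h) -/(neg h); lra.
  - by move=> x; rewrite mulr_ge0.
  - by move=> x; rewrite mulr_ge0.
  - by move=> x; rewrite -mulrBr -pos_neg.
have c1 : 0 <= - c by lra.
have [e1 f1] := fineZ c1 (pos_ge0 h) (pos_fin sh).
have [e2 f2] := fineZ c1 (neg_ge0 h) (neg_fin sh).
rewrite (@rsumE (fun x => - c * neg h x) (fun x => - c * pos h x))//.
- by rewrite e1 e2 /rsum -/(pos h) -/(neg h); lra.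
- by move=> x; rewrite mulr_ge0.
- by move=> x; rewrite mulr_ge0.
- by move=> x; rewrite -mulrBr {1}(pos_neg h); lra.
Qed.

Lemma rsum_abs h : (`|rsum h|%:E <= \esum_(x in [set: T]) `|h x|%:E)%E.
Proof.
have [->|] := eqVneq (\esum_(x in [set: T]) `|h x|%:E)%E +oo%E; first by rewrite leey.
rewrite -ltey => sh.
have n0 x : (0 <= `|h x|%:E)%E by rewrite lee_fin.
have hf := esum_fin_num n0 sh.
have p0 x : (0 <= (pos h x)%:E)%E by rewrite lee_fin.
have q0 x : (0 <= (neg h x)%:E)%E by rewrite lee_fin.
have P : 0 <= fine (\esum_(x in [set: T]) (pos h x)%:E) <=
    fine (\esum_(x in [set: T]) `|h x|%:E).
  rewrite fine_ge0 ?esumT_ge0//= fine_le//; first exact: esum_fin_num (pos_fin sh).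
  exact: le_esumT.
have Q : 0 <= fine (\esum_(x in [set: T]) (neg h x)%:E) <=
    fine (\esum_(x in [set: T]) `|h x|%:E).
  rewrite fine_ge0 ?esumT_ge0//= fine_le//; first exact: esum_fin_num (neg_fin sh).
  exact: le_esumT.
rewrite -(fineK hf) lee_fin /rsum -/(pos h) -/(neg h) ler_norml.
by case/andP: P => ? ?; case/andP: Q => ? ?; lra.
Qed.

Lemma rsum_ge0E h : (forall x, 0 <= h x) ->
  rsum h = fine (\esum_(x in [set: T]) (h x)%:E).
Proof.
move=> h0; rewrite /rsum (eq_esumT (b := fun x => (h x)%:E)); last first.
  by move=> x; congr EFin; apply/max_idPl.
rewrite [X in _ - fine X]esum1 ?subr0// => x _; congr EFin.
by apply/max_idPr; rewrite oppr_le0.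
Qed.

Lemma rsum_single h x0 : (forall x, x != x0 -> h x = 0) -> rsum h = h x0.
Proof.
move=> hx.
have H (g : R -> R) : g 0 = 0 -> (forall y, 0 <= g y) ->
    \esum_(x in [set: T]) (g (h x))%:E = (g (h x0))%:E.
  move=> g0 gp; have K x : (g (h x))%:E = if x \in [set x0] then (g (h x))%:E else 0%E.
    case: (eqVneq x x0) => [->|xx]; first by rewrite mem_set.
    by rewrite memNset ?hx ?g0//; apply/eqP.
  by rewrite (eq_esumT K) -esum_mkcond esum_set1// lee_fin.
rewrite /rsum (H (fun y => Num.max y 0)); last 2 first.
- by rewrite maxxx.
- by move=> y; rewrite le_max lexx orbT.
rewrite (H (fun y => Num.max (- y) 0)); last 2 first.
- by rewrite oppr0 maxxx.
- by move=> y; rewrite le_max lexx orbT.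
by rewrite /= /Num.max; case: ifPn; case: ifPn; lra.
Qed.

Lemma eq_rsum h k : h =1 k -> rsum h = rsum k.
Proof. by move=> /funext ->. Qed.

End rsum_theory.

Lemma rsum_bij (R : realType) (T T' : countType) (f : T' -> T) (f' : T -> T') (h : T -> R) :
  cancel f f' -> cancel f' f -> rsum h = rsum (h \o f).
Proof.
by move=> fK f'K; rewrite /rsum (esum_bij _ fK f'K) [in X in _ - X](esum_bij _ fK f'K).
Qed.

Section rsum_fubini.
Variables (R : realType) (T T' : countType) (h : T -> T' -> R).
Hypothesis sh : (\esum_(x in [set: T]) \esum_(y in [set: T']) `|h x y|%:E < +oo)%E.

(** The sums of the positive and negative parts of each row decompose the row sum, in general not
    into its own positive and negative part; [rsumE] allows such a decomposition. *)
Lemma rsum_rsum : rsum (fun x => rsum (h x)) =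
  fine (\esum_(x in [set: T]) \esum_(y in [set: T']) (Num.max (h x y) 0)%:E) -
  fine (\esum_(x in [set: T]) \esum_(y in [set: T']) (Num.max (- h x y) 0)%:E).
Proof.
have H (g : R -> R) : (forall y, 0 <= g y <= `|y|) ->
    (\esum_(x in [set: T]) \esum_(y in [set: T']) (g (h x y))%:E < +oo)%E /\
    forall x, (fine (\esum_(y in [set: T']) (g (h x y))%:E))%:E =
      \esum_(y in [set: T']) (g (h x y))%:E.
  move=> g01.
  have g0 x y : (0 <= (g (h x y))%:E)%E.
    by rewrite lee_fin; case/andP: (g01 (h x y)).
  have s : (\esum_(x in [set: T]) \esum_(y in [set: T']) (g (h x y))%:E < +oo)%E.
    apply: le_lt_trans sh; apply: le_esumT => x; apply: le_esumT => y.
    by rewrite lee_fin; case/andP: (g01 (h x y)).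
  split=> // x; rewrite fineK// esum_fin_num//.
  apply: le_lt_trans s.
  apply: (@esum_term_le _ _ (fun x => \esum_(y in [set: T']) (g (h x y))%:E)).
  by move=> z; exact: esumT_ge0.
have p (y : R) : 0 <= Num.max y 0 <= `|y|.
  by rewrite le_max lexx orbT ge_max normr_ge0 ler_norm.
have n (y : R) : 0 <= Num.max (- y) 0 <= `|y|.
  by rewrite le_max lexx orbT ge_max normr_ge0 -normrN ler_norm.
have [sp ep] := H _ p; have [sn en] := H _ n.
rewrite (@rsumE _ _ (fun x => fine (\esum_(y in [set: T']) (Num.max (h x y) 0)%:E))
  (fun x => fine (\esum_(y in [set: T']) (Num.max (- h x y) 0)%:E)))//.
- by under eq_esumT do rewrite ep; under [in X in _ - X]eq_esumT do rewrite en.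
- by move=> x; rewrite fine_ge0// esumT_ge0// => y; rewrite lee_fin; case/andP: (p (h x y)).
- by move=> x; rewrite fine_ge0// esumT_ge0// => y; rewrite lee_fin; case/andP: (n (h x y)).
- by under eq_esumT do rewrite ep.
- by under eq_esumT do rewrite en.
Qed.

End rsum_fubini.

Lemma rsum_swap (R : realType) (T T' : countType) (h : T -> T' -> R) :
  (\esum_(x in [set: T]) \esum_(y in [set: T']) `|h x y|%:E < +oo)%E ->
  rsum (fun x => rsum (h x)) = rsum (fun y => rsum (h ^~ y)).
Proof.
move=> sh; rewrite rsum_rsum// rsum_rsum; last first.
  by rewrite esum_swap// => x y; rewrite lee_fin.
by congr (fine _ - fine _); rewrite esum_swap// => x y; rewrite lee_fin le_max lexx orbT.
Qed.

Section csum_theory.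
Variables (R : realType).
Local Notation C := R[i].

Lemma normc_ge0 (z : C) : 0 <= normc z.
Proof. by case: z => a b; exact: sqrtr_ge0. Qed.

Lemma normr_Re_le (z : C) : `|complex.Re z| <= normc z.
Proof.
case: z => a b /=; rewrite -sqrtr_sqr ler_sqrt ?addr_ge0 ?sqr_ge0//.
by rewrite lerDl sqr_ge0.
Qed.

Lemma normr_Im_le (z : C) : `|complex.Im z| <= normc z.
Proof.
case: z => a b /=; rewrite -sqrtr_sqr ler_sqrt ?addr_ge0 ?sqr_ge0//.
by rewrite lerDr sqr_ge0.
Qed.

Lemma normc_le_ReIm (z : C) : normc z <= `|complex.Re z| + `|complex.Im z|.
Proof.
case: z => a b /=; rewrite -[leRHS]ger0_norm ?addr_ge0// -sqrtr_sqr.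
rewrite ler_sqrt ?sqr_ge0// sqrrD.
rewrite -[a ^+ 2](real_normK (num_real a)) -[b ^+ 2](real_normK (num_real b)).
by have := mulr_ge0 (normr_ge0 a) (normr_ge0 b); rewrite mulr2n; lra.
Qed.

Lemma normc_leD (x y : C) : normc (x + y) <= normc x + normc y.
Proof. exact: (@le_normcD R x y). Qed.

Lemma normc_opp (x : C) : normc (- x) = normc x.
Proof. exact: (@normcN R x). Qed.

Lemma normc_real (a : R) : normc (Complex a 0) = `|a|.
Proof. by rewrite /= expr0n addr0 sqrtr_sqr. Qed.

Variable T : countType.
Implicit Types f g : T -> C.

Definition csummable f := (\esum_(x in [set: T]) (normc (f x))%:E < +oo)%E.

Lemma csummable_Re f : csummable f -> rsummable (fun x => complex.Re (f x)).
Proof.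
by apply: le_lt_trans; apply: le_esumT => x; rewrite lee_fin normr_Re_le.
Qed.

Lemma csummable_Im f : csummable f -> rsummable (fun x => complex.Im (f x)).
Proof.
by apply: le_lt_trans; apply: le_esumT => x; rewrite lee_fin normr_Im_le.
Qed.

Lemma csummableD f g : csummable f -> csummable g -> csummable (fun x => f x + g x).
Proof.
move=> sf sg; apply: le_lt_trans (lte_add_pinfty sf sg).
rewrite -esumTD; [|by move=> x; rewrite lee_fin normc_ge0..].
by apply: le_esumT => x; rewrite -EFinD lee_fin normc_leD.
Qed.

Lemma csummableZ c f : csummable f -> csummable (fun x => c * f x).
Proof.
move=> sf; rewrite /csummable; under eq_esumT do rewrite Normc.normcM EFinM.
have f0 x : (0 <= (normc (f x))%:E)%E by rewrite lee_fin normc_ge0.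
rewrite esumTZl// ?lee_fin ?normc_ge0//.
by rewrite -(fineK (esum_fin_num f0 sf)) -EFinM ltry.
Qed.

Lemma csumD f g : csummable f -> csummable g ->
  csum (fun x => f x + g x) = csum f + csum g.
Proof.
move=> sf sg; rewrite /csum.
rewrite (eq_rsum (k := fun x => complex.Re (f x) + complex.Re (g x))); last first.
  by move=> x; rewrite raddfD.
rewrite [X in Complex _ X](eq_rsum (k := fun x => complex.Im (f x) + complex.Im (g x)));
  last by move=> x; rewrite raddfD.
rewrite (rsumD (csummable_Re sf) (csummable_Re sg)).
by rewrite (rsumD (csummable_Im sf) (csummable_Im sg)).
Qed.

Lemma csumZ c f : csummable f -> csum (fun x => c * f x) = c * csum f.
Proof.
move=> sf; have sR := csummable_Re sf; have sI := csummable_Im sf.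
case: c => a b; rewrite /csum.
have sZ (d : R) h : rsummable h -> rsummable (fun x : T => d * h x).
  move=> sh; rewrite /rsummable; under eq_esumT do rewrite normrM EFinM.
  have h0 x : (0 <= `|h x|%:E)%E by rewrite lee_fin.
  by rewrite esumTZl// -(fineK (esum_fin_num h0 sh)) -EFinM ltry.
rewrite (eq_rsum (k := fun x => a * complex.Re (f x) + - b * complex.Im (f x))); last first.
  by move=> x; case: (f x) => u v /=; rewrite mulNr.
rewrite [X in Complex _ X](eq_rsum
  (k := fun x => a * complex.Im (f x) + b * complex.Re (f x)));
  last by move=> x; case: (f x) => u v /=.
rewrite (rsumD (sZ a _ sR) (sZ (- b) _ sI)) (rsumD (sZ a _ sI) (sZ b _ sR)).
by rewrite (rsumZ a sR) (rsumZ (- b) sI) (rsumZ a sI) (rsumZ b sR) mulNr.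
Qed.

Lemma csumN f : csummable f -> csum (fun x => - f x) = - csum f.
Proof.
move=> sf; rewrite -mulN1r -csumZ//; congr csum; apply/funext => x.
by rewrite mulN1r.
Qed.

Lemma csumB f g : csummable f -> csummable g ->
  csum (fun x => f x - g x) = csum f - csum g.
Proof.
move=> sf sg; rewrite csumD// ?csumN//.
by rewrite /csummable; under eq_esumT do rewrite normc_opp.
Qed.

(** The factor 2 comes from bounding the real and the imaginary part separately. It only enters
    multiplicative constants, never an exponential rate. *)
Lemma csum_norm f :
  ((normc (csum f))%:E <= 2%:E * \esum_(x in [set: T]) (normc (f x))%:E)%E.
Proof.
have n0 x : (0 <= (normc (f x))%:E)%E by rewrite lee_fin normc_ge0.
have H1 := rsum_abs (fun x => complex.Re (f x)).
have H2 := rsum_abs (fun x => complex.Im (f x)).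
apply: (@le_trans _ _ (`|rsum (fun x => complex.Re (f x))|%:E +
   `|rsum (fun x => complex.Im (f x))|%:E)%E).
  by rewrite -EFinD lee_fin normc_le_ReIm.
rewrite mule_natl mule2n; apply: leeD.
  by apply: le_trans H1 _; apply: le_esumT => x; rewrite lee_fin normr_Re_le.
by apply: le_trans H2 _; apply: le_esumT => x; rewrite lee_fin normr_Im_le.
Qed.

Lemma csum_real_ge0 (h : T -> R) : (forall x, 0 <= h x) ->
  csum (fun x => Complex (h x) 0) = Complex (fine (\esum_(x in [set: T]) (h x)%:E)) 0.
Proof.
move=> h0; rewrite /csum /= rsum_ge0E//; congr Complex.
by rewrite rsum_ge0E// esum1.
Qed.

Lemma csum_single f x0 : (forall x, x != x0 -> f x = 0) -> csum f = f x0.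
Proof.
move=> fx; rewrite /csum (rsum_single (x0 := x0)); last by move=> x /fx ->.
rewrite (rsum_single (x0 := x0)); last by move=> x /fx ->.
by case: (f x0).
Qed.

Lemma csum_bij (T' : countType) (h : T' -> T) (h' : T -> T') f :
  cancel h h' -> cancel h' h -> csum f = csum (f \o h).
Proof.
move=> hK h'K.
by rewrite /csum (rsum_bij _ hK h'K) [X in Complex _ X](rsum_bij _ hK h'K).
Qed.

End csum_theory.

Lemma csum_swap (R : realType) (T T' : countType) (f : T -> T' -> R[i]) :
  (\esum_(x in [set: T]) \esum_(y in [set: T']) (normc (f x y))%:E < +oo)%E ->
  csum (fun x => csum (f x)) = csum (fun y => csum (f ^~ y)).
Proof.
move=> sf; rewrite /csum /=; congr Complex; apply: rsum_swap.
- apply: le_lt_trans sf; apply: le_esumT => x; apply: le_esumT => y.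
  by rewrite lee_fin normr_Re_le.
- apply: le_lt_trans sf; apply: le_esumT => x; apply: le_esumT => y.
  by rewrite lee_fin normr_Im_le.
Qed.

Section csum_nat.
Variable R : realType.
Implicit Types f : nat -> R[i].

Lemma esum_nat_recl (u : nat -> \bar R) : (forall n, 0 <= u n)%E ->
  (\esum_(n in [set: nat]) u n = u 0%N + \esum_(n in [set: nat]) u n.+1)%E.
Proof.
move=> u0; rewrite (esumID [set 0%N])// !setTI esum_set1//; congr (_ + _)%E.
apply: (reindex_esum _ _ succn); split.
- by move=> n _ /=.
- by move=> m n _ _ [].
- by case=> [|n] //= _; exists n.
Qed.

Lemma csummableS f : csummable f -> csummable (fun n => f n.+1).
Proof.
rewrite /csummable esum_nat_recl; last by move=> n; rewrite lee_fin normc_ge0.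
by apply: le_lt_trans; rewrite leeDr// lee_fin normc_ge0.
Qed.

Lemma csum_recl f : csummable f -> csum f = f 0%N + csum (fun n => f n.+1).
Proof.
move=> sf.
have H (h : nat -> R) : rsummable h -> rsum h = h 0%N + rsum (fun n => h n.+1).
  move=> sh.
  have K (g : R -> R) : (forall y, 0 <= g y <= `|y|) ->
      fine (\esum_(n in [set: nat]) (g (h n))%:E) =
      g (h 0%N) + fine (\esum_(n in [set: nat]) (g (h n.+1))%:E).
    move=> g01.
    have g0 n : (0 <= (g (h n))%:E)%E by rewrite lee_fin; case/andP: (g01 (h n)).
    have s : (\esum_(n in [set: nat]) (g (h n))%:E < +oo)%E.
      apply: le_lt_trans sh; apply: le_esumT => n; rewrite lee_fin.
      by case/andP: (g01 (h n)).
    move: s; rewrite esum_nat_recl// => s; rewrite fineD//.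
    apply: esum_fin_num => //; apply: le_lt_trans s.
    by rewrite leeDr.
  rewrite /rsum (K (fun y => Num.max y 0)) ?(K (fun y => Num.max (- y) 0)).
  - rewrite opprD addrACA; congr (_ + _).
    by rewrite /Num.max; case: ifPn => h1; case: ifPn => h2; lra.
  - by move=> y; rewrite le_max lexx orbT ge_max normr_ge0 -normrN ler_norm.
  - by move=> y; rewrite le_max lexx orbT ge_max normr_ge0 ler_norm.
rewrite /csum (H _ (csummable_Re sf)) (H _ (csummable_Im sf)).
by case: (f 0%N).
Qed.

Lemma csum_telescope f : csummable f -> csum (fun n => f n - f n.+1) = f 0%N.
Proof.
by move=> sf; rewrite csumB// ?[csum f]csum_recl ?addrK//; exact: csummableS.
Qed.

Lemma csum_tail f N : csummable f ->
  csum f - \sum_(n < N) f n = csum (fun n => f (N + n)%N).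
Proof.
move=> sf; elim: N => [|N ih]; first by rewrite big_ord0 subr0.
rewrite big_ord_recr/= opprD addrA ih csum_recl ?addn0; last first.
  elim: N {ih} => [//|N ih]; rewrite /csummable.
  by under eq_esumT do rewrite addSnnS; exact: csummableS ih.
by rewrite addrAC subrr add0r; congr csum; apply/funext => n; rewrite addSnnS.
Qed.

End csum_nat.

(** * Sums of q-th powers and the l^q norm *)

Section lq_norm.
Variables (R : realType) (G : countType).
Implicit Types (g : G -> R[i]) (q M : R).

Definition enormc g : G -> \bar R := fun s => (normc (g s))%:E.

Lemma enormc_ge0 g s : (0 <= enormc g s)%E.
Proof. by rewrite lee_fin normc_ge0. Qed.

Lemma lqsumE q g : lqsum q g = \esum_(s in [set: G]) (enormc g s `^ q)%E.
Proof. by []. Qed.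

Lemma lqsum_ge0 q g : (0 <= lqsum q g)%E.
Proof. by apply: esumT_ge0 => s; rewrite lee_fin powR_ge0. Qed.

Lemma lqsum_real q (h : G -> R) : (forall s, 0 <= h s) ->
  lqsum q (mu_C h) = \esum_(s in [set: G]) (h s `^ q)%:E.
Proof. by move=> h0; apply: eq_esumT => s; rewrite normc_real ger0_norm. Qed.

Lemma powRV_le q (x M : R) : 0 < q -> 0 <= x -> 0 <= M ->
  (x `^ q^-1 <= M) = (x <= M `^ q).
Proof.
move=> q0 x0 M0; apply/idP/idP => H.
  rewrite -[x]powRr1// -(@mulVf _ q) ?gt_eqF// powRrM.
  by rewrite ge0_ler_powR// ?nnegrE ?powR_ge0// ltW.
rewrite -[M]powRr1// -(@mulfV _ q) ?gt_eqF// powRrM.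
by rewrite ge0_ler_powR// ?nnegrE ?powR_ge0// invr_ge0 ltW.
Qed.

Lemma lqnorm_le q g M : 0 < q -> 0 <= M ->
  (lqnorm q g <= M%:E)%E = (lqsum q g <= (M `^ q)%:E)%E.
Proof.
move=> q0 M0; rewrite /lqnorm; case: eqP => [->|/eqP foo]; first by rewrite !leye_eq.
have fin : lqsum q g \is a fin_num by rewrite ge0_fin_numE ?lqsum_ge0// ltey.
by rewrite lee_fin powRV_le ?fine_ge0 ?lqsum_ge0// -lee_fin fineK.
Qed.

Lemma lqnorm_le1 q g : 0 < q -> (lqnorm q g <= 1)%E = (lqsum q g <= 1)%E.
Proof. by move=> q0; rewrite lqnorm_le// powR1. Qed.

(** Pointwise (a + b)^q <= (2 max(a, b))^q. The crude constant stands in for Minkowski's inequality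
    and keeps all later estimates at the level of q-th powers. *)
Lemma lqsumD q g g' : 0 < q ->
  (lqsum q (fun s => (g s + g' s)%R) <= (2 `^ q)%:E * (lqsum q g + lqsum q g'))%E.
Proof.
move=> q0; rewrite !lqsumE -esumTD; [|by move=> s; exact: poweR_ge0..].
rewrite -esumTZl; [|by rewrite lee_fin powR_ge0|]; last first.
  by move=> s; rewrite adde_ge0// poweR_ge0.
apply: le_esumT => s; rewrite /enormc !poweR_EFin -EFinD -EFinM lee_fin.
set a := normc (g s); set b := normc (g' s).
have a0 : 0 <= a by exact: normc_ge0.
have b0 : 0 <= b by exact: normc_ge0.
have m0 : 0 <= Num.max a b by rewrite le_max a0.
apply: (@le_trans _ _ ((2 * Num.max a b) `^ q)).
  rewrite ge0_ler_powR ?nnegrE ?normc_ge0 ?mulr_ge0 ?(ltW q0)//.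
  apply: le_trans (normc_leD _ _) _; rewrite -/a -/b.
  have : a <= Num.max a b by rewrite le_max lexx.
  have : b <= Num.max a b by rewrite le_max lexx orbT.
  by lra.
rewrite powRM// ler_wpM2l ?powR_ge0//.
by rewrite /Num.max; case: ifPn => _; rewrite ?lerDl ?lerDr powR_ge0.
Qed.

Lemma lqsumZ q c g : 0 < q ->
  (lqsum q (fun s => (c * g s)%R) = (normc c `^ q)%:E * lqsum q g)%E.
Proof.
move=> q0; rewrite !lqsumE -esumTZl ?lee_fin ?powR_ge0//; last first.
  by move=> s; exact: poweR_ge0.
apply: eq_esumT => s; rewrite /enormc !poweR_EFin -EFinM Normc.normcM powRM//.
  exact: normc_ge0.
exact: normc_ge0.
Qed.

End lq_norm.

(** * Bounds for convolution operators and their interpolation *)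

Section operator_bounds.
Local Open Scope ereal_scope.
Variables (R : realType) (G : countType) (mul : G -> G -> G).
Variables (inv : G -> G) (e : G).
Hypothesis gp : is_group mul inv e.
Local Notation econv := (econv mul inv).
Implicit Types (u v : G -> \bar R) (q M : R).

(* [M] bounds the [q]-th power of the operator norm, not the norm itself. *)
Definition opbound q u M := forall g : G -> \bar R, (forall s, 0 <= g s) ->
  \esum_(s in [set: G]) (econv u g s `^ q) <=
  M%:E * \esum_(s in [set: G]) (g s `^ q).

Lemma le_opbound q u M M' : (M <= M')%R -> opbound q u M -> opbound q u M'.
Proof.
move=> MM H g g0; apply: le_trans (H g g0) _.
by rewrite lee_wpmul2r ?lee_fin// esumT_ge0// => s; exact: poweR_ge0.
Qed.

(** Jensen's inequality with respect to [mu] bounds the q-th power of the convolution by the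
    convolution of [mu] with g^q, whose total mass is that of g^q. *)
Lemma opbound_prob q (mu : G -> R) : (1 < q)%R -> is_prob mu ->
  opbound q (EFin \o mu) 1.
Proof.
move=> q1 [mu0 mu1] g g0.
have m0 t : 0 <= (EFin \o mu) t by rewrite lee_fin.
apply: (@le_trans _ _ (\esum_(s in [set: G])
   econv (EFin \o mu) (fun t => g t `^ q) s)).
  apply: le_esumT => s.
  apply: le_trans (esum_jensen q1 m0 _) _ => //.
  by rewrite /= mu1 poweR1r mul1e.
rewrite (esum_econv gp)//; last by move=> t; exact: poweR_ge0.
by rewrite /= mu1.
Qed.

Lemma opbound_econv q u v A B : (0 <= A)%R ->
  (forall t, 0 <= u t) -> (forall t, 0 <= v t) ->
  opbound q u A -> opbound q v B -> opbound q (econv u v) (A * B).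
Proof.
move=> A0 u0 v0 Hu Hv g g0; rewrite (econvA gp)//.
apply: le_trans (Hu _ _) _; first by move=> s; exact: econv_ge0.
by rewrite EFinM -muleA lee_wpmul2l// ?lee_fin// Hv.
Qed.

(** A positive form of interpolation between l^1, where [u] acts with norm at most A, and l^2, where
    [v] acts. Write g = a^(1-th) b^th with a = g^q and b = g^(q/2), so that a and b^2 have the same
    sum Y. Hoelder inside the convolution separates u * a from v * b, and a second Hoelder in s
    separates their sums. *)
Lemma interpolation (u v nu : G -> \bar R) (th q A M : R) :
  (0 < th < 1)%R -> (q * (1 - th / 2) = 1)%R ->
  (forall t, 0 <= u t) -> (forall t, 0 <= v t) -> (0 <= A)%R -> (0 <= M)%R ->
  \esum_(t in [set: G]) u t <= A%:E -> opbound 2 v M ->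
  (forall t, nu t = u t `^ (1 - th) * v t `^ th) ->
  opbound q nu (A `^ (q * (1 - th)) * M `^ (q * th / 2)).
Proof.
move=> /[dup] th01 /andP[th0 th1] qE u0 v0 A0 M0 uA vM nuE g g0.
have q0 : (0 < q)%R.
  have t2 : (0 < 1 - th / 2)%R by lra.
  by rewrite -(pmulr_lgt0 _ t2) qE.
pose a t := g t `^ q; pose b t := g t `^ (q / 2).
have a0 t : 0 <= a t by exact: poweR_ge0.
have b0 t : 0 <= b t by exact: poweR_ge0.
(* After raising to the power q, the factor u * a has exponent q (1 - th) = 1 - eta, and v * b has
   exponent q th = 2 eta: exactly a Hoelder pair for the sum of u * a and the sum of squares of v *
   b. *)
pose eta := (q * th / 2)%R.
have etaE : (1 - eta = q * (1 - th))%R by rewrite /eta; move: qE; lra.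
have eta01 : (0 < eta < 1)%R.
  rewrite /eta; apply/andP; split; first by rewrite !mulr_gt0// invr_gt0.
  have : (0 < q * (1 - th))%R by rewrite mulr_gt0// subr_gt0.
  by rewrite -etaE /eta; lra.
have eta0 : (0 < eta)%R by case/andP: eta01.
have eta1 : (0 < 1 - eta)%R by rewrite subr_gt0; case/andP: eta01.
set Y := \esum_(s in [set: G]) (g s `^ q).
have Y0 : 0 <= Y by exact: esumT_ge0.
have gE t : g t = a t `^ (1 - th) * b t `^ th.
  rewrite /a /b -!poweRrM (@poweR_merge _ _ _ _ 1%R) ?poweRe1//.
  - by rewrite mulr_gt0// subr_gt0.
  - by rewrite mulrAC; move: eta0; rewrite /eta.
  - by move: qE; lra.
have step1 s : econv nu g s `^ q <=
    (econv u a s) `^ (1 - eta) * (econv v b s `^ 2) `^ eta.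
  have H : econv nu g s <= econv u a s `^ (1 - th) * econv v b s `^ th.
    apply: le_trans (esum_hoelder th01 _ _); last 2 first.
    - by move=> t; rewrite mule_ge0.
    - by move=> t; rewrite mule_ge0.
    apply: le_esumT => t; rewrite nuE gE !poweRM//.
    by rewrite muleACA.
  have nu0 t : 0 <= nu t by rewrite nuE mule_ge0 ?poweR_ge0.
  have := le_poweR (ltW q0) (econv_ge0 mul inv s nu0 g0) H.
  rewrite poweRM ?poweR_ge0// -!poweRrM etaE mulrC /eta.
  have -> : (2 * (q * th / 2) = th * q)%R by lra.
  by [].
apply: (@le_trans _ _ (\esum_(s in [set: G])
   ((econv u a s) `^ (1 - eta) * (econv v b s `^ 2) `^ eta))).
  exact: le_esumT.
apply: le_trans (esum_hoelder eta01 _ _) _.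
- by move=> s; exact: econv_ge0.
- by move=> s; exact: poweR_ge0.
have h1 : \esum_(s in [set: G]) econv u a s <= A%:E * Y.
  by rewrite (esum_econv gp)// lee_wpmul2r.
have h2 : \esum_(s in [set: G]) (econv v b s `^ 2) <= M%:E * Y.
  apply: le_trans (vM b b0) _; rewrite lee_wpmul2l ?lee_fin//.
  apply: le_esumT => s; rewrite /b -poweRrM.
  by have -> : (q / 2 * 2 = q)%R by lra.
apply: (@le_trans _ _ ((A%:E * Y) `^ (1 - eta) * (M%:E * Y) `^ eta)).
  apply: lee_pmul; rewrite ?poweR_ge0//.
  - by apply: le_poweR => //; [exact: ltW|apply: esumT_ge0 => s; exact: econv_ge0].
  - by apply: le_poweR => //; [exact: ltW|apply: esumT_ge0 => s; exact: poweR_ge0].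
rewrite !poweRM ?lee_fin// muleACA !poweR_EFin -EFinM -/eta -etaE.
rewrite (@poweR_merge _ Y _ _ 1%R) ?poweRe1//.
by rewrite subrK.
Qed.

Lemma esum_econv_sqr u (b : G -> \bar R) :
  (forall t, 0 <= u t) -> (forall t, 0 <= b t) ->
  \esum_(s in [set: G]) (econv u b s `^ 2) =
  \esum_(k in [set: G * G]) \esum_(s in [set: G])
    ((u k.1 * b (mul (inv k.1) s)) * (u k.2 * b (mul (inv k.2) s))).
Proof.
move=> u0 b0; rewrite esum_swap; last by move=> k s; rewrite !mule_ge0.
apply: eq_esumT => s.
have ub0 t : 0 <= u t * b (mul (inv t) s) by rewrite mule_ge0.
have c0 : 0 <= econv u b s by exact: econv_ge0.
rewrite -(@poweR_merge _ _ 1%R 1%R)// poweRe1//.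
rewrite {1}/econv -esumTZr//.
rewrite (eq_esumT (b := fun t => \esum_(t' in [set: G])
  (u t * b (mul (inv t) s) * (u t' * b (mul (inv t') s))))); last first.
  by move=> t; rewrite esumTZl.
rewrite (@esum_esum _ _ _ [set: G] (fun=> [set: G])); last first.
  by move=> t t' _ _; rewrite mule_ge0.
by have -> : [set: G] `*`` (fun=> [set: G]) = setT by apply/seteqP; split.
Qed.

(* Expanding the square turns the left-hand side into a sum over [G * G], so a
   finite partial sum only sees a finite part of [u]; no limit is needed. *)
Lemma opbound2_finite_support u M : (forall t, 0 <= u t) ->
  (forall X : set G, finite_set X ->
     opbound 2 (fun t => if t \in X then u t else 0) M) ->
  opbound 2 u M.
Proof.
move=> u0 H b b0; rewrite esum_econv_sqr//.
apply: ge_ereal_sup => _ [Z [finZ _] <-].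
pose X := Z.`1 `|` Z.`2.
have finX : finite_set X.
  by rewrite finite_setU; split; [exact: finite_set_fst|exact: finite_set_snd].
pose uX t := if t \in X then u t else 0.
have uX0 t : 0 <= uX t by rewrite /uX; case: ifP.
apply: le_trans (H X finX b b0); rewrite -/uX esum_econv_sqr//.
apply: esum_ge; exists Z; first by split.
rewrite lee_fsum// => -[t t'] Zk.
have tX : t \in X by rewrite inE; left; exists t'.
have t'X : t' \in X by rewrite inE; right; exists t.
by rewrite /uX /= tX t'X.
Qed.

Lemma normc_lam (f g : G -> R[i]) s :
  enormc (lam mul inv f g) s <= 2%:E * econv (enormc f) (enormc g) s.
Proof.
apply: le_trans (csum_norm _) _; rewrite lee_wpmul2l// ?lee_fin//.
by apply: le_esumT => t; rewrite Normc.normcM EFinM.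
Qed.

Lemma lqsum_lam q (f g : G -> R[i]) u M : (0 < q)%R -> opbound q u M ->
  (forall t, enormc f t <= u t) ->
  lqsum q (lam mul inv f g) <= (2 `^ q)%:E * (M%:E * lqsum q g).
Proof.
move=> q0 H fu.
have f0 := enormc_ge0 f; have g0 := enormc_ge0 g.
have u0 t : 0 <= u t by apply: le_trans (fu t).
apply: le_trans (lee_wpmul2l _ (H (enormc g) g0)); last first.
  by rewrite lee_fin powR_ge0.
rewrite -esumTZl ?lee_fin ?powR_ge0//; last by move=> s; exact: poweR_ge0.
apply: le_esumT => s.
have -> : (2 `^ q)%:E * econv u (enormc g) s `^ q =
    (2%:E * econv u (enormc g) s) `^ q.
  by rewrite poweRM ?lee_fin// econv_ge0.
rewrite -[leLHS]/(enormc (lam mul inv f g) s `^ q).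
apply: le_poweR; [exact: ltW|exact: enormc_ge0|].
apply: le_trans (normc_lam f g s) _; rewrite lee_wpmul2l// ?lee_fin//.
exact: le_econv.
Qed.

End operator_bounds.

Lemma lam_real (R : realType) (G : countType) mul inv (v b : G -> R) s :
  (forall t, 0 <= v t) -> (forall t, 0 <= b t) ->
  lam mul inv (mu_C v) (mu_C b) s =
  Complex (fine (econv mul inv (EFin \o v) (EFin \o b) s)) 0.
Proof.
move=> v0 b0; rewrite /lam -[RHS]csum_real_ge0; last by move=> t; rewrite mulr_ge0.
congr csum; apply/funext => t; apply/eqP.
by rewrite eq_complex /= !(mulr0, mul0r) subr0 addr0 !eqxx.
Qed.

(** * Rapid decay for nonnegative functions of arbitrary support *)

Section rapid_decay.
Local Open Scope ereal_scope.
Variables (R : realType) (G : countType) (mul : G -> G -> G).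
Variables (inv : G -> G) (e : G) (L : G -> R).
Hypothesis gp : is_group mul inv e.
Hypothesis L0 : forall s, (0 <= L s)%R.
Local Notation econv := (econv mul inv).

Let opbound_RD_finite (v : G -> R) (d : nat) (K : R) :
  (0 < K)%R -> (forall t, 0 <= v t)%R ->
  \esum_(t in [set: G]) ((v t) ^+ 2 * ((1 + L t) ^+ d) ^+ 2)%:E <= 1 ->
  opnorm 2 (lam mul inv (mu_C v)) <= K%:E ->
  opbound mul inv 2 (EFin \o v) (K ^+ 2).
Proof.
move=> K0 v0 v1 op b b0.
set Y := \esum_(s in [set: G]) (b s `^ 2).
have Y0 : 0 <= Y by apply: esumT_ge0 => s; exact: poweR_ge0.
have [YE|Yn0] := eqVneq Y 0.
  rewrite esum1 ?mule_ge0 ?lee_fin ?sqr_ge0// => s _.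
  rewrite [econv _ _ _]esum1 ?poweR0r//.
  move=> t _; rewrite (@poweR_eq0_eq0 _ (b _) 2) ?mule0//.
  by apply: (esum_eq0 _ YE) => z; exact: poweR_ge0.
have [YE|Yfin] := eqVneq Y +oo.
  by rewrite YE gt0_muley ?leey// lte_fin exprn_gt0.
have Yf : Y \is a fin_num by rewrite ge0_fin_numE// ltey.
pose y := fine Y.
have YE : Y = y%:E by rewrite fineK.
have y0 : (0 < y)%R by rewrite -lte_fin -YE lt0e Yn0.
have bfin s : b s \is a fin_num.
  rewrite ge0_fin_numE//; apply: (@lty_poweRy _ _ 2) => //.
  apply: (@le_lt_trans _ _ Y); last by rewrite ltey.
  by apply: (@esum_term_le _ _ (fun s => b s `^ 2)) => z; exact: poweR_ge0.
pose b' s := fine (b s).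
have bE s : b s = (b' s)%:E by rewrite fineK.
have b'0 s : (0 <= b' s)%R by rewrite -lee_fin -bE.
(* [lam] on real functions is a [fine] of [econv], which would turn +oo into 0, so finiteness has to
   come first. It follows from Cauchy-Schwarz: the squares of [v] sum to at most 1, as the weights
   are at least 1. *)
have cfin s : econv (EFin \o v) b s < +oo.
  have h12 : (0 < (2^-1 : R) < 1)%R by lra.
  have := @esum_hoelder R G (fun t => (EFin \o v) t `^ 2)
    (fun t => b (mul (inv t) s) `^ 2) 2^-1 h12.
  have -> : (1 - 2^-1 = 2^-1 :> R)%R by lra.
  move=> H; have {H} := H (fun t => poweR_ge0 _ _) (fun t => poweR_ge0 _ _).
  rewrite (eq_esumT (b := fun t => (EFin \o v) t * b (mul (inv t) s))); last first.
    by move=> t; rewrite -!poweRrM mulfV// !poweRe1// lee_fin.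
  move=> /le_lt_trans; apply.
  rewrite (esum_translate_inv gp (fun t => b t `^ 2)) -/Y.
  apply: lte_mul_pinfty; first exact: poweR_ge0.
    apply: fin_num_poweR; rewrite ge0_fin_numE; last first.
      by apply: esumT_ge0 => t; exact: poweR_ge0.
    apply: le_lt_trans (ltry 1%R); apply: le_trans (v1); apply: le_esumT => t.
    rewrite /= lee_fin powR_mulrn// ler_peMr ?sqr_ge0//.
    by rewrite !exprn_ege1// lerDl.
  by rewrite YE poweR_EFin ltry.
(* Normalises [b] to unit l^2 norm, the only place where [opnorm] gives information. *)
pose c := (Num.sqrt y)^-1%R.
have c0 : (0 < c)%R by rewrite invr_gt0 sqrtr_gt0.
have c2 : (c `^ 2 = y^-1)%R.
  by rewrite powR_mulrn ?(ltW c0)// exprVn sqr_sqrtr// ltW.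
have cb0 s : (0 <= c * b' s)%R by rewrite mulr_ge0// ltW.
have gY : (lqnorm 2 (mu_C (fun s => c * b' s)%R) <= 1)%E.
  rewrite lqnorm_le1// lqsum_real//.
  under eq_esumT do rewrite powRM// ?(ltW c0)// EFinM.
  rewrite esumTZl ?lee_fin ?powR_ge0//; last by move=> s; rewrite lee_fin powR_ge0.
  rewrite (eq_esumT (b := fun s => b s `^ 2)); last by move=> s; rewrite bE.
  by rewrite -/Y YE c2 -EFinM mulVf// gt_eqF.
have : lqnorm 2 (lam mul inv (mu_C v) (mu_C (fun s => c * b' s)%R)) <= K%:E.
  by apply: le_trans op; apply: ereal_sup_ubound; exists (mu_C (fun s => c * b' s)%R).
rewrite lqnorm_le ?(ltW K0)//.
have lamE s : lam mul inv (mu_C v) (mu_C (fun s => c * b' s)%R) s =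
    Complex (c * fine (econv (EFin \o v) b s))%R 0%R.
  rewrite lam_real//; congr Complex.
  rewrite -[RHS]/(fine c%:E * fine (econv (EFin \o v) b s))%R -fineM//; last first.
    by rewrite ge0_fin_numE// econv_ge0// => t; rewrite lee_fin.
  rewrite -econvZr; [|by rewrite lee_fin ltW|by move=> t; rewrite lee_fin|by []].
  by congr fine; apply: eq_esumT => t; rewrite /= bE.
have ec0 s : 0 <= econv (EFin \o v) b s by apply: econv_ge0 => // t; rewrite lee_fin.
rewrite /lqsum (eq_esumT (b := fun s => (y^-1)%:E * econv (EFin \o v) b s `^ 2)); last first.
  move=> s; rewrite lamE normc_real ger0_norm ?mulr_ge0 ?(ltW c0) ?fine_ge0//.
  rewrite powRM ?(ltW c0) ?fine_ge0// c2 EFinM; congr (_ * _).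
  by rewrite -poweR_EFin fineK// ge0_fin_numE.
rewrite esumTZl ?lee_fin ?invr_ge0 ?(ltW y0)//; last by move=> s; exact: poweR_ge0.
move=> H; rewrite YE muleC.
have := lee_wpmul2l (ltW y0 : 0 <= y%:E) H.
by rewrite muleA -EFinM mulfV ?gt_eqF// mul1e powR_mulrn// ltW.
Qed.

(** [has_RD] tests finitely supported functions only. Truncating [v] keeps its weighted norm below
    1, and [opbound2_finite_support] removes the truncation. The constant is replaced by max(K, 1),
    since the given one may be negative and a nonnegative logarithm is wanted later. *)
Lemma opbound_RD : has_RD mul inv L -> exists (d : nat) (K : R), (1 <= K)%R /\
  forall v : G -> R, (forall t, 0 <= v t)%R ->
  \esum_(t in [set: G]) ((v t) ^+ 2 * ((1 + L t) ^+ d) ^+ 2)%:E <= 1 ->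
  opbound mul inv 2 (EFin \o v) (K ^+ 2).
Proof.
move=> [d [K HK]]; exists d, (Num.max K 1)%R; split; first by rewrite le_max lexx orbT.
move=> v v0 v1; apply: opbound2_finite_support => [t|X finX]; first by rewrite lee_fin.
pose vX t := if t \in X then v t else 0%R.
have vX0 t : (0 <= vX t)%R by rewrite /vX; case: ifP.
have vX1 : \esum_(t in [set: G]) ((vX t) ^+ 2 * ((1 + L t) ^+ d) ^+ 2)%:E <= 1.
  apply: le_trans (v1); apply: le_esumT => t; rewrite lee_fin ler_wpM2r ?sqr_ge0//.
  by rewrite /vX; case: ifP => // _; rewrite expr0n sqr_ge0.
have -> : (fun t => if t \in X then (EFin \o v) t else 0) = EFin \o vX.
  by apply/funext => t; rewrite /vX /=; case: ifP.
apply: (opbound_RD_finite (d := d)) => //; first by rewrite lt_max ltr01 orbT.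
apply: le_trans (HK (mu_C vX) _) _.
  apply: sub_finite_set finX => t /=; rewrite /mu_C /vX.
  by case: ifPn => [/set_mem//|_] /eqP.
rewrite lee_fin; set S := fine _.
have S0 : (0 <= S)%R.
  by rewrite fine_ge0// esumT_ge0// => t; rewrite lee_fin mulr_ge0 ?sqr_ge0.
have S1 : (Num.sqrt S <= 1)%R.
  rewrite -[leRHS]sqrtr1 ler_sqrt// -lee_fin.
  apply: le_trans (vX1).
  rewrite /S (eq_esumT (b := fun t => ((vX t) ^+ 2 * ((1 + L t) ^+ d) ^+ 2)%:E)); last first.
    by move=> t; rewrite normc_real ger0_norm.
  rewrite fineK// ge0_fin_numE; first exact: le_lt_trans vX1 (ltry _).
  by apply: esumT_ge0 => t; rewrite lee_fin mulr_ge0 ?sqr_ge0.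
apply: (@le_trans _ _ (Num.max K 1 * Num.sqrt S)%R).
  by rewrite ler_wpM2r ?sqrtr_ge0// le_max lexx.
by rewrite ler_piMr// le_max ler01 orbT.
Qed.

End rapid_decay.

(** * The Neumann series as an inverse inside the algebra of pseudofunctions *)

Lemma esum_geometric_le (R : realType) (b : R) (N : nat) : 0 <= b -> b < 1 ->
  (\esum_(k in [set: nat]) (b ^+ (N + k))%:E <= (b ^+ N / (1 - b))%:E)%E.
Proof.
move=> b0 b1.
have b2 : 0 < 1 - b by rewrite subr_gt0.
rewrite -nneseries_esumT; last by move=> k; rewrite lee_fin exprn_ge0.
apply: lime_le.
  by apply: is_cvg_nneseries => n _ _; rewrite lee_fin exprn_ge0.
apply: nearW => n; rewrite sumEFin lee_fin.
have -> : \sum_(0 <= i < n) b ^+ (N + i) = (b ^+ N - b ^+ (N + n)) / (1 - b).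
  elim: n => [|n ih]; first by rewrite big_nil addn0 subrr mul0r.
  by rewrite big_nat_recr//= ih addnS exprS; field; rewrite gt_eqF.
by rewrite ler_wpM2r ?invr_ge0 ?(ltW b2)// gerBl exprn_ge0.
Qed.

Section resolvent.
Variables (R : realType) (G : countType) (mul : G -> G -> G).
Variables (inv : G -> G) (e : G) (mu : G -> R).
Hypothesis gp : is_group mul inv e.
Hypothesis pm : is_prob mu.
Local Notation econv := (econv mul inv).
Local Notation lam := (lam mul inv).
Local Notation mun := (convpow mul inv e mu).
Local Notation C := R[i].
Implicit Types (g : G -> C).

Let mun0 k t : 0 <= mun k t. Proof. exact: (is_prob_convpow gp k pm).1. Qed.
Let emun0 k t : (0 <= (EFin \o mun k) t)%E. Proof. by rewrite lee_fin. Qed.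

Let enormc_mun k : enormc (mu_C (mun k)) = EFin \o mun k.
Proof. by apply/funext => t; rewrite /enormc normc_real ger0_norm. Qed.

Lemma csummable_lam (m : G -> R) g s : (forall t, 0 <= m t) ->
  (econv (EFin \o m) (enormc g) s < +oo)%E ->
  csummable (fun t => mu_C m t * g (mul (inv t) s)).
Proof.
move=> m0; apply: le_lt_trans; apply: le_esumT => t.
by rewrite Normc.normcM normc_real ger0_norm// EFinM.
Qed.

(** Fubini for complex g at a single point s; the hypothesis is the finiteness of the absolute
    double sum at that point. *)
Lemma lam_lam (m1 m2 : G -> R) g s : is_prob m1 -> is_prob m2 ->
  (econv (EFin \o conv mul inv m1 m2) (enormc g) s < +oo)%E ->
  lam (mu_C m1) (lam (mu_C m2) g) s = lam (mu_C (conv mul inv m1 m2)) g s.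
Proof.
move=> p1 p2 fin; have [m10 _] := p1; have [m20 _] := p2.
have g0 := enormc_ge0 g.
have e1 t : (0 <= (EFin \o m1) t)%E by rewrite lee_fin.
have e2 t : (0 <= (EFin \o m2) t)%E by rewrite lee_fin.
have cE : EFin \o conv mul inv m1 m2 = econv (EFin \o m1) (EFin \o m2).
  by apply/funext => t; rewrite /= (EFin_conv gp).
have fin2 : (\esum_(t in [set: G]) \esum_(x in [set: G])
    (normc (mu_C m1 t * (mu_C m2 (mul (inv t) x) * g (mul (inv x) s))))%:E < +oo)%E.
  move: fin; rewrite cE (econvA gp)// /econv; apply: le_lt_trans.
  apply: le_esumT => t.
  rewrite -esumTZl//; last by move=> x; rewrite mule_ge0.
  rewrite [leRHS](@esum_bij _ _ _ (mul (inv t)) (mul t)); last 2 first.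
  - exact: group_mulVK gp t.
  - exact: group_mulK gp t.
  apply: le_esumT => x.
  rewrite !Normc.normcM !normc_real !ger0_norm// !EFinM /=.
  have -> // : mul (inv (mul (inv t) x)) (mul (inv t) s) = mul (inv x) s.
  by rewrite (group_invM gp) (group_invK gp) -gp.1 (group_mulVK gp).
(* Where [m1] vanishes the inner sum may diverge, but then both sides of the identity carry the
   factor 0. *)
have fin1 t : m1 t != 0 ->
    (econv (EFin \o m2) (enormc g) (mul (inv t) s) < +oo)%E.
  move=> mt; move: fin; rewrite cE (econvA gp)// => fin.
  have mt0 : 0 < m1 t by rewrite lt0r mt m10.
  rewrite ltey; apply/eqP => E; move: fin; apply/negP; rewrite -leNgt.
  apply: le_trans (esum_term_le t _); last by move=> x; rewrite mule_ge0// econv_ge0.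
  by rewrite E gt0_muley// lte_fin.
transitivity (csum (fun t => csum (fun x =>
    mu_C m1 t * (mu_C m2 (mul (inv t) x) * g (mul (inv x) s))))).
  congr csum; apply/funext => t.
  rewrite /Defs.lam (csum_bij _ (group_mulVK gp t) (group_mulK gp t)).
  have E x : mul (inv (mul (inv t) x)) (mul (inv t) s) = mul (inv x) s.
    by rewrite (group_invM gp) (group_invK gp) -gp.1 (group_mulVK gp).
  have [mt|mt] := eqVneq (m1 t) 0.
    have -> : mu_C m1 t = 0 by rewrite /mu_C mt.
    rewrite mul0r -[LHS](@csum_single _ _ (fun=> 0) e)//.
    by congr csum; apply/funext => x; rewrite mul0r.
  rewrite csumZ; first by congr (_ * csum _); apply/funext => x /=; rewrite E.
  have := csummable_lam m20 (fin1 t mt).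
  rewrite /csummable (@esum_bij _ _ _ (mul (inv t)) (mul t)); last 2 first.
  - exact: group_mulVK gp t.
  - exact: group_mulK gp t.
  apply: le_lt_trans; apply: le_esumT => x /=; by rewrite E.
rewrite csum_swap//; congr csum; apply/funext => x.
transitivity (csum (fun t => g (mul (inv x) s) * mu_C (fun t => m1 t * m2 (mul (inv t) x)) t)).
  congr csum; apply/funext => t.
  rewrite mulrA mulrC; congr (_ * _).
  by apply/eqP; rewrite eq_complex /= !(mulr0, mul0r) subr0 addr0 !eqxx.
have m12 t : 0 <= m1 t * m2 (mul (inv t) x) by rewrite mulr_ge0.
rewrite csumZ.
  by rewrite mulrC; congr (_ * _); rewrite csum_real_ge0.
rewrite /csummable.
under eq_esumT do rewrite normc_real ger0_norm//.
have := EFin_conv gp x p1 p2; rewrite /econv /= => <-.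
by rewrite ltry.
Qed.

Lemma lam_dirac g s : lam (mu_C (dirac_e R e)) g s = g s.
Proof.
have i1 : inv e = e by have [_ [/(_ (inv e))[<- _] /(_ e)[]]] := gp.
rewrite /Defs.lam (@csum_single _ _ _ e).
  rewrite i1; have [_ [/(_ s)[-> _] _]] := gp.
  have -> : mu_C (dirac_e R e) e = 1 by rewrite /mu_C /dirac_e eqxx.
  by rewrite mul1r.
move=> t te; have -> : mu_C (dirac_e R e) t = 0 by rewrite /mu_C /dirac_e (negbTE te).
by rewrite mul0r.
Qed.

Variables (q D sg : R) (z : C).
Hypotheses (q1 : 1 < q) (D0 : 0 <= D) (sg0 : 0 < sg) (sgz : sg < normc z).
Hypothesis bnd : forall k, opbound mul inv q (EFin \o mun k) (D * (sg ^+ k) `^ q).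

Let q0 : 0 < q. Proof. by apply: lt_trans q1. Qed.
Let nz0 : 0 < normc z. Proof. exact: lt_trans sgz. Qed.
Let z0 : z != 0.
Proof. by apply/eqP => zE; move: nz0; rewrite zE Normc.normc0 ltxx. Qed.
Let b := sg / normc z.
Let b0 : 0 < b. Proof. exact: divr_gt0. Qed.
Let b1 : b < 1. Proof. by rewrite ltr_pdivrMr// mul1r. Qed.

Let w (k : nat) : R := (normc z)^-1 ^+ k.+1.
Let w0 k : 0 <= w k. Proof. by rewrite exprn_ge0// invr_ge0 ltW. Qed.

(** The absolute majorant of the tail from N on of the Neumann series for the inverse of z - T, with
    [w k] equal to |z|^-(k+1). *)
Definition neumann (N : nat) (g : G -> \bar R) (s : G) : \bar R :=
  (\esum_(k in [set: nat]) ((w (N + k))%:E * econv (EFin \o mun (N + k)) g s))%E.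

(** The mass of the geometric weights enters to the power q: q - 1 times from Jensen and once more
    from the outer sum over k. *)
Let CN (N : nat) : R := (b ^+ N / (1 - b)) `^ q * (D * (normc z)^-1 `^ q).

(* The weights [b ^+ k] with [b = sg / |z|] in Jensen's inequality are the choice for
   which the geometric factors of [bnd] cancel exactly. *)
Lemma neumann_le N (g : G -> \bar R) : (forall s, 0 <= g s)%E ->
  (\esum_(s in [set: G]) (neumann N g s `^ q)%E <=
   (CN N)%:E * \esum_(s in [set: G]) (g s `^ q)%E)%E.
Proof.
move=> g0; set Y := (\esum_(s in [set: G]) (g s `^ q)%E)%E.
have Y0 : (0 <= Y)%E by apply: esumT_ge0 => s; exact: poweR_ge0.
pose x k s := ((((sg ^+ k) * normc z)^-1)%:E * econv (EFin \o mun k) g s)%E.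
have ec0 k s : (0 <= econv (EFin \o mun k) g s)%E by apply: econv_ge0.
have sz0 k : 0 <= ((sg ^+ k) * normc z)^-1.
  by rewrite invr_ge0 mulr_ge0 ?exprn_ge0// ltW.
have x0 k s : (0 <= x k s)%E by rewrite /x mule_ge0 ?lee_fin.
have bk0 k : (0 <= (b ^+ (N + k))%:E)%E by rewrite lee_fin exprn_ge0// ltW.
have E s : neumann N g s =
    (\esum_(k in [set: nat]) ((b ^+ (N + k))%:E * x (N + k)%N s))%E.
  apply: eq_esumT => k; rewrite muleA -EFinM; congr (_%:E * _)%E.
  rewrite /w /b expr_div_n exprS exprVn; field.
  by rewrite !expf_neq0 ?gt_eqF.
pose S := (\esum_(k in [set: nat]) (b ^+ (N + k))%:E)%E.
have Sle : (S <= (b ^+ N / (1 - b))%:E)%E by apply: esum_geometric_le; rewrite // ltW.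
have S0 : (0 <= S)%E by exact: esumT_ge0.
have g1 : 0 <= b ^+ N / (1 - b).
  by rewrite divr_ge0 ?exprn_ge0 ?subr_ge0// ltW.
have c0 : 0 <= D * (normc z)^-1 `^ q by rewrite mulr_ge0// powR_ge0.
apply: (@le_trans _ _ (\esum_(s in [set: G]) ((S `^ (q - 1))%E *
    \esum_(k in [set: nat]) ((b ^+ (N + k))%:E * (x (N + k)%N s `^ q)%E)))%E).
  by apply: le_esumT => s; rewrite E; exact: esum_jensen.
have bx0 k s : (0 <= (b ^+ (N + k))%:E * (x (N + k)%N s `^ q)%E)%E.
  by rewrite mule_ge0// poweR_ge0.
rewrite esumTZl ?poweR_ge0//; last by move=> s; exact: esumT_ge0.
rewrite esum_swap//.
have xY k : (\esum_(s in [set: G]) (x k s `^ q)%E <= (D * (normc z)^-1 `^ q)%:E * Y)%E.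
  rewrite (eq_esumT (b := fun s => ((((sg ^+ k) * normc z)^-1 `^ q)%:E *
    (econv (EFin \o mun k) g s `^ q)%E)%E)); last first.
    by move=> s; rewrite /x poweRM ?lee_fin.
  rewrite esumTZl ?lee_fin ?powR_ge0//; last by move=> s; exact: poweR_ge0.
  apply: le_trans (lee_wpmul2l _ (bnd k g0)) _; first by rewrite lee_fin powR_ge0.
  rewrite -/Y muleA -EFinM lee_wpmul2r// lee_fin.
  rewrite invfM powRM ?invr_ge0 ?exprn_ge0 ?(ltW sg0) ?(ltW nz0)//.
  rewrite mulrC -mulrA ler_wpM2l// mulrA -powRM ?invr_ge0 ?exprn_ge0 ?(ltW sg0)//.
  by rewrite mulfV ?powR1 ?mul1r// expf_neq0// gt_eqF.
apply: (@le_trans _ _ ((S `^ (q - 1))%E * (S * ((D * (normc z)^-1 `^ q)%:E * Y)))%E).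
  rewrite lee_wpmul2l ?poweR_ge0// -esumTZr//; last by rewrite mule_ge0.
  apply: le_esumT => k; rewrite esumTZl//; last by move=> s; exact: poweR_ge0.
  by rewrite lee_wpmul2l.
rewrite muleA -[X in (_ * X * _ <= _)%E](@poweRe1 _ S)//.
rewrite (@poweR_merge _ S _ _ q) ?subr_gt0//; last by lra.
have -> : ((CN N)%:E * Y = ((b ^+ N / (1 - b)) `^ q)%:E *
    ((D * (normc z)^-1 `^ q)%:E * Y))%E by rewrite muleA -EFinM.
apply: lee_wpmul2r; first by rewrite mule_ge0.
by rewrite -poweR_EFin; apply: le_poweR => //; exact: ltW.
Qed.

Lemma neumann_ge0 N (g : G -> \bar R) s : (forall s, 0 <= g s)%E -> (0 <= neumann N g s)%E.
Proof.
by move=> g0; apply: esumT_ge0 => k; rewrite mule_ge0 ?lee_fin// econv_ge0.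
Qed.

(** A finite sum of q-th powers forces every term to be finite. All pointwise absolute convergence
    in this section rests on it. *)
Lemma neumann_fin g s : (lqsum q g < +oo)%E -> (neumann 0 (enormc g) s < +oo)%E.
Proof.
move=> gq; have g0 := enormc_ge0 g.
apply: (@lty_poweRy _ _ q); first by rewrite gt_eqF.
apply: le_lt_trans (@esum_term_le _ _ (fun s => (neumann 0 (enormc g) s `^ q)%E) s _) _.
  by move=> ?; exact: poweR_ge0.
apply: le_lt_trans (neumann_le 0 g0) _.
have gf : lqsum q g \is a fin_num by rewrite ge0_fin_numE// lqsum_ge0.
by rewrite -lqsumE -(fineK gf) -EFinM ltry.
Qed.

Lemma econv_fin g k s : (lqsum q g < +oo)%E ->
  (econv (EFin \o mun k) (enormc g) s < +oo)%E.
Proof.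
move=> gq; have g0 := enormc_ge0 g.
have nf := neumann_fin s gq; rewrite ltey; apply/eqP => E.
move: nf; apply/negP; rewrite -leNgt.
apply: le_trans (esum_term_le k _); last first.
  by move=> x; rewrite mule_ge0 ?lee_fin// econv_ge0.
rewrite add0n E gt0_muley// lte_fin exprn_gt0// invr_gt0//.
Qed.

Definition resolvent g : G -> C :=
  fun s => csum (fun k : nat => z^-1 ^+ k.+1 * lam (mu_C (mun k)) g s).

Let term_le g N k s : ((normc (z^-1 ^+ (N + k).+1 * lam (mu_C (mun (N + k))) g s))%:E
  <= 2%:E * ((w (N + k))%:E * econv (EFin \o mun (N + k)) (enormc g) s))%E.
Proof.
rewrite Normc.normcM EFinM muleCA.
have -> : normc (z^-1 ^+ (N + k).+1) = w (N + k).
  rewrite /w; elim: (N + k).+1 => [|n ih]; first by rewrite !expr0 Normc.normc1.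
  by rewrite !exprS Normc.normcM ih Normc.normcV.
rewrite lee_wpmul2l ?lee_fin//.
by rewrite -enormc_mun; exact: normc_lam.
Qed.

Lemma csummable_resolvent g s : (lqsum q g < +oo)%E ->
  csummable (fun k : nat => z^-1 ^+ k.+1 * lam (mu_C (mun k)) g s).
Proof.
move=> gq; have nf := neumann_fin s gq.
have n0 := neumann_ge0 0 s (enormc_ge0 g).
apply: (@le_lt_trans _ _ (2%:E * neumann 0 (enormc g) s)%E).
  rewrite -esumTZl ?lee_fin//; last first.
    by move=> k; rewrite mule_ge0 ?lee_fin// econv_ge0// => t; exact: enormc_ge0.
  by apply: le_esumT => k; exact: (term_le g 0 k s).
by rewrite lte_mul_pinfty.
Qed.

Let fN (N : nat) : G -> C := fun t => \sum_(k < N) z^-1 ^+ k.+1 * mu_C (mun k) t.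

Let csummable_fN N : csummable (fN N).
Proof.
elim: N => [|N ih].
  rewrite /csummable esum1 ?ltry// => t _.
  by rewrite /fN big_ord0 Normc.normc0.
have -> : fN N.+1 = fun t => fN N t + z^-1 ^+ N.+1 * mu_C (mun N) t.
  by apply/funext => t; rewrite /fN big_ord_recr.
apply: csummableD => //; apply: csummableZ; rewrite /csummable.
under eq_esumT do rewrite normc_real ger0_norm//.
by rewrite (is_prob_convpow gp N pm).2 ltry.
Qed.

Let lam_fN N g s : (lqsum q g < +oo)%E ->
  csummable (fun t => fN N t * g (mul (inv t) s)) /\
  lam (fN N) g s = \sum_(k < N) z^-1 ^+ k.+1 * lam (mu_C (mun k)) g s.
Proof.
move=> gq; elim: N => [|N [ih1 ih2]].
  have fE : (fun t => fN 0 t * g (mul (inv t) s)) = fun=> 0.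
    by apply/funext => t; rewrite /fN big_ord0 mul0r.
  rewrite /Defs.lam fE big_ord0; split; last by rewrite (@csum_single _ _ (fun=> 0) e).
  by rewrite /csummable esum1 ?ltry// => t _; rewrite Normc.normc0.
have fE : (fun t => fN N.+1 t * g (mul (inv t) s)) = (fun t => fN N t * g (mul (inv t) s) +
   z^-1 ^+ N.+1 * (mu_C (mun N) t * g (mul (inv t) s))).
  by apply/funext => t; rewrite /fN big_ord_recr/= mulrDl mulrA.
have sm := csummable_lam (mun0 N) (econv_fin N s gq).
rewrite /Defs.lam fE; split; first exact/csummableD/csummableZ.
rewrite csumD//; last exact: csummableZ.
by rewrite csumZ// big_ord_recr/= -ih2.
Qed.

(** The approximating l^1 functions are the partial sums [fN]; the error is a Neumann tail, whose
    norm decays like b^N. *)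
Lemma in_PF_resolvent : in_PF mul inv q resolvent.
Proof.
exists fN; split.
  move=> N; apply: le_lt_trans (csummable_fN N); apply: le_esumT => t.
  by rewrite powRr1// normc_ge0.
(* The 4 is 2 for the series ([csum_norm]) times 2 for [lam] ([normc_lam]); the other factors, with
   b^N, form the q-th root of [CN N]. *)
pose A := 4 * D `^ q^-1 / normc z / (1 - b).
have A0 : 0 <= A.
  by rewrite !mulr_ge0 ?powR_ge0// invr_ge0 ?subr_ge0 ltW.
have ub N : (opnorm q (fun g s => (resolvent g s - lam (fN N) g s)%R) <= (A * b ^+ N)%:E)%E.
  apply: ge_ereal_sup => _ [g /= g1 <-].
  have {}g1 : (lqsum q g <= 1)%E by rewrite -(lqnorm_le1 g q0).
  have gq : (lqsum q g < +oo)%E by apply: le_lt_trans g1 (ltry _).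
  have g0 := enormc_ge0 g.
  have Ab0 : 0 <= A * b ^+ N by rewrite mulr_ge0// exprn_ge0// ltW.
  rewrite (lqnorm_le _ q0 Ab0).
  apply: (@le_trans _ _ (\esum_(s in [set: G]) ((4%:E * neumann N (enormc g) s) `^ q)%E)%E).
    apply: le_esumT => s; rewrite -poweR_EFin; apply: le_poweR.
    - exact: ltW.
    - by rewrite lee_fin normc_ge0.
    rewrite (lam_fN N s gq).2 csum_tail; last exact: csummable_resolvent.
    apply: le_trans (csum_norm _) _.
    have -> : (4%:E = 2%:E * 2%:E :> \bar R)%E by rewrite -EFinM; congr EFin; lra.
    rewrite -muleA lee_wpmul2l ?lee_fin// -esumTZl ?lee_fin//; last first.
      by move=> k; rewrite mule_ge0 ?lee_fin// econv_ge0.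
    by apply: le_esumT => k; exact: term_le.
  have nn0 s : (0 <= neumann N (enormc g) s)%E by exact: neumann_ge0.
  under eq_esumT do rewrite poweRM ?lee_fin//.
  rewrite esumTZl ?poweR_ge0//; last by move=> s; exact: poweR_ge0.
  apply: le_trans (lee_wpmul2l _ (neumann_le N g0)) _; first exact: poweR_ge0.
  rewrite -lqsumE muleA poweR_EFin -EFinM.
  have -> : 4 `^ q * CN N = (A * b ^+ N) `^ q.
    have bN0 : 0 <= b ^+ N by rewrite exprn_ge0// ltW.
    have i0 : 0 <= (normc z)^-1 by rewrite invr_ge0 ltW.
    have j0 : 0 <= (1 - b)^-1 by rewrite invr_ge0 subr_ge0 ltW.
    rewrite /CN /A !powRM ?mulr_ge0 ?powR_ge0//.
    rewrite -powRrM mulVf ?gt_eqF// powRr1//; ring.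
  apply: le_trans (lee_wpmul2l _ g1) _; first by rewrite lee_fin powR_ge0.
  by rewrite mule1.
(* The lower half of the squeeze: the supremum in [opnorm] includes the value at g = 0. *)
have lb N : (0 <= opnorm q (fun g s => (resolvent g s - lam (fN N) g s)%R))%E.
  apply: (@le_trans _ _ (lqnorm q (fun s =>
      (resolvent (fun=> 0%R) s - lam (fN N) (fun=> 0%R) s)%R))).
    by rewrite /lqnorm; case: ifP => // _; rewrite lee_fin powR_ge0.
  apply: ereal_sup_ubound; exists (fun=> 0) => //=.
  rewrite (lqnorm_le1 _ q0) /lqsum esum1// => s _.
  by rewrite Normc.normc0 powR0// gt_eqF.
apply: (@squeeze_cvge _ _ _ _ (fun=> 0%E) _ (fun N => (A * b ^+ N)%:E)).
- by apply: nearW => N; rewrite lb ub.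
- exact: cvg_cst.
- apply: cvg_EFin; first by apply: nearW.
  rewrite -[X in _ --> X](mulr0 A); apply: cvgM; first exact: cvg_cst.
  by apply: cvg_expr; rewrite ger0_norm// ltW.
Qed.

Lemma econv_lam_le (m : G -> R) k g s : (forall t, 0 <= m t) ->
  (econv (EFin \o m) (enormc (lam (mu_C (mun k)) g)) s <=
   2%:E * econv (econv (EFin \o m) (EFin \o mun k)) (enormc g) s)%E.
Proof.
move=> m0; have e1 t : (0 <= (EFin \o m) t)%E by rewrite lee_fin.
have g0 := enormc_ge0 g.
have ec0 t : (0 <= econv (EFin \o mun k) (enormc g) t)%E by exact: econv_ge0.
rewrite (econvA gp)// -econvZr ?lee_fin//.
apply: le_econv => // t; first exact: enormc_ge0.
by rewrite -enormc_mun; exact: normc_lam.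
Qed.

Let resolvent_telescope g s : (lqsum q g < +oo)%E ->
  csummable (fun k : nat => z^-1 ^+ k * lam (mu_C (mun k)) g s) /\
  csum (fun k => z^-1 ^+ k * lam (mu_C (mun k)) g s -
     z^-1 ^+ k.+1 * lam (mu_C (mun k.+1)) g s) = g s.
Proof.
move=> gq; have sr := csummable_resolvent s gq.
have sH : csummable (fun k : nat => z^-1 ^+ k * lam (mu_C (mun k)) g s).
  have -> : (fun k : nat => z^-1 ^+ k * lam (mu_C (mun k)) g s) =
     fun k : nat => z * (z^-1 ^+ k.+1 * lam (mu_C (mun k)) g s).
    by apply/funext => k; rewrite exprS !mulrA mulfV// mul1r.
  exact: csummableZ.
split=> //.
by rewrite (csum_telescope sH) expr0 mul1r lam_dirac.
Qed.

(** Each term of the series applied to (z - T) g is a difference of consecutive terms z^-k T^k g, by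
    [lam_lam] alone; T never has to cross the infinite sum. *)
Lemma resolvent_left g : (lqsum q g < +oo)%E ->
  resolvent (fun s => z * g s - lam (mu_C mu) g s) = g.
Proof.
move=> gq; apply/funext => s.
rewrite -[RHS](resolvent_telescope s gq).2; congr csum; apply/funext => k.
have -> : lam (mu_C (mun k)) (fun s => z * g s - lam (mu_C mu) g s) s =
   z * lam (mu_C (mun k)) g s - lam (mu_C (mun k.+1)) g s.
  have sm := csummable_lam (mun0 k) (econv_fin k s gq).
  have s2 : csummable (fun t => mu_C (mun k) t * lam (mu_C mu) g (mul (inv t) s)).
    apply: (@csummable_lam (mun k) (lam (mu_C mu) g) s) => //.
    have := econv_lam_le 1 g s (mun0 k).
    rewrite (convpow1 gp pm) => /le_lt_trans; apply.
    rewrite -{2}(convpow1 gp pm) (econv_convpowD gp)//.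
    by rewrite lte_mul_pinfty// ?lee_fin//; exact: econv_fin.
  rewrite -[mun k.+1]/(conv mul inv (mun k) mu) -lam_lam//; last 2 first.
  - exact: is_prob_convpow.
  - exact: (econv_fin k.+1 s gq).
  rewrite /Defs.lam -csumZ// -csumB//; last exact: csummableZ.
  by congr csum; apply/funext => t; rewrite mulrBr mulrCA.
by rewrite mulrBr; congr (_ - _); rewrite mulrA exprSr -[X in X * _ = _]mulrA mulVf ?mulr1.
Qed.

(** Here T acts on the summed series and must be moved inside it, which needs absolute convergence
    of a double sum over G and k. *)
Lemma resolvent_right g : (lqsum q g < +oo)%E ->
  (fun s => z * resolvent g s - lam (mu_C mu) (resolvent g) s) = g.
Proof.
move=> gq; apply/funext => s.
have [sH tel] := resolvent_telescope s gq.
have g0 := enormc_ge0 g.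
rewrite -[RHS]tel csumB//; last exact: (csummableS sH).
congr (_ - _).
  rewrite -csumZ; last exact: csummable_resolvent.
  by congr csum; apply/funext => k; rewrite exprS !mulrA mulfV// mul1r.
have e1 t : (0 <= (EFin \o mu) t)%E by rewrite lee_fin pm.1.
have mu1 k : econv (EFin \o mu) (EFin \o mun k) = EFin \o mun k.+1.
  by rewrite -{1}(convpow1 gp pm) (econv_convpowD gp)// add1n.
rewrite {1}/Defs.lam /resolvent.
transitivity (csum (fun t => csum (fun k : nat =>
   mu_C mu t * (z^-1 ^+ k.+1 * lam (mu_C (mun k)) g (mul (inv t) s))))).
  by congr csum; apply/funext => t; rewrite csumZ//; exact: csummable_resolvent.
(* Convolving with [mu] shifts the index k by one, and |z| w(k+1) = w(k), so the double sum is at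
   most 2 |z| times the shifted Neumann majorant. *)
have fin : (\esum_(t in [set: G]) \esum_(k in [set: nat]) (normc
   (mu_C mu t * (z^-1 ^+ k.+1 * lam (mu_C (mun k)) g (mul (inv t) s))))%:E < +oo)%E.
  rewrite esum_swap; last by move=> t k; rewrite lee_fin normc_ge0.
  apply: (@le_lt_trans _ _ (\esum_(k in [set: nat]) ((2 * normc z)%:E *
     ((w k.+1)%:E * econv (EFin \o mun k.+1) (enormc g) s)))%E).
    apply: le_esumT => k.
    have ec0 t : (0 <= econv (EFin \o mun k) (enormc g) t)%E by exact: econv_ge0.
    rewrite muleA -EFinM.
    have -> : 2 * normc z * w k.+1 = 2 * w k.
      by rewrite /w [_ ^+ k.+2]exprS; field; rewrite gt_eqF.
    rewrite -mu1 (econvA gp)// {1}/econv -esumTZl//; last 2 first.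
    - by rewrite lee_fin mulr_ge0.
    - by move=> t; rewrite mule_ge0.
    apply: le_esumT => t; rewrite Normc.normcM normc_real ger0_norm ?pm.1// EFinM.
    rewrite [leRHS]muleCA; apply: lee_wpmul2l; first exact: e1.
    by rewrite EFinM -muleA; exact: (term_le g 0 k).
  have ec0 k : (0 <= (w k)%:E * econv (EFin \o mun k) (enormc g) s)%E.
    by rewrite mule_ge0 ?lee_fin// econv_ge0.
  rewrite esumTZl// ?lee_fin ?mulr_ge0 ?(ltW nz0)//.
  have : (\esum_(k in [set: nat]) ((w k)%:E * econv (EFin \o mun k) (enormc g) s) < +oo)%E.
    exact: neumann_fin.
  rewrite esum_nat_recl// => nf.
  apply: lte_mul_pinfty => //; first by rewrite lee_fin mulr_ge0// ltW.
  by apply: le_lt_trans nf; rewrite leeDr.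
rewrite (csum_swap fin); congr csum; apply/funext => k.
have fk := econv_fin k.+1 s gq.
have sk : csummable (fun t => mu_C mu t * lam (mu_C (mun k)) g (mul (inv t) s)).
  apply: csummable_lam; first exact: pm.1.
  apply: le_lt_trans (econv_lam_le k g s pm.1) _.
  by rewrite mu1 lte_mul_pinfty// ?lee_fin.
have -> : mun k.+1 = conv mul inv mu (mun k).
  by rewrite -{2}(convpow1 gp pm) -(convpowD gp)// add1n.
rewrite -lam_lam//; last 2 first.
- exact: is_prob_convpow.
- by rewrite -{1}(convpow1 gp pm) -(convpowD gp)// add1n.
rewrite {2}/Defs.lam -csumZ//.
by congr csum; apply/funext => t; rewrite mulrCA.
Qed.

Lemma not_in_spectrum : ~ PF_spectrum mul inv q mu z.
Proof.
apply; exists resolvent; split; first exact: in_PF_resolvent.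
by move=> g gq; split; [exact: resolvent_left|exact: resolvent_right].
Qed.

End resolvent.

(** * Growth rates under a summation inequality *)

Section growth.
Variable R : realType.

Lemma midpoint_lt (a b : R) : a < b -> a < (a + b) / 2 < b.
Proof. by move=> ab; lra. Qed.

(** If y > z, Bernoulli's inequality makes (y/z)^n exceed any constant D. *)
Lemma geometric_le (y z D : R) : 0 < y -> 0 < z ->
  (forall n, y ^+ n <= D * z ^+ n) -> y <= z.
Proof.
move=> y0 z0 H; rewrite leNgt; apply/negP => zy.
have r1 : 1 < y / z by rewrite ltr_pdivlMr// mul1r.
pose x := y / z - 1.
have x0 : 0 < x by rewrite /x subr_gt0.
have D0 : 0 <= D by have := H 0%N; rewrite !expr0 mulr1; lra.
have bern n : 1 + n%:R * x <= (y / z) ^+ n.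
  elim: n => [|n ih]; first by rewrite mul0r addr0 expr0.
  rewrite exprS -natr1; have -> : y / z = 1 + x by rewrite /x; lra.
  have nx : 0 <= n%:R * x * x by rewrite !mulr_ge0// ltW.
  apply: (@le_trans _ _ ((1 + x) * (1 + n%:R * x))); first by lra.
  by rewrite ler_wpM2l//; [lra|have <- : y / z = 1 + x by rewrite /x; lra].
have bd n : (y / z) ^+ n <= D.
  by rewrite expr_div_n ler_pdivrMr ?exprn_gt0.
have [n nD] : exists n : nat, D / x < n%:R.
  by exists (Num.Def.archi_bound (D / x)); apply: archi_boundP; rewrite divr_ge0// ltW.
have := le_trans (bern n) (bd n).
by move: nD; rewrite ltr_pdivrMr//; lra.
Qed.

(** If a_n = nu_n / v^n is unbounded, some term exceeds 2C, hence so do all later partial sums S.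
    The hypothesis gives a >= S/C - 1, which is at least S/(2C) once S >= 2C. So S is multiplied by
    at least 1 + 1/(2C) at every step, and the upper rate t/v of a_n cannot be smaller. *)
Lemma growth_dichotomy (nu : nat -> R) (v C t D : R) :
  0 < v -> 0 < C -> 0 < t -> (forall n, 0 <= nu n) ->
  (forall N, \sum_(n < N) nu n / v ^+ n <= C * (1 + nu N / v ^+ N)) ->
  (forall n, nu n <= D * t ^+ n) ->
  (exists D', forall n, nu n <= D' * v ^+ n) \/ v * (1 + (2 * C)^-1) <= t.
Proof.
move=> v0 C0 t0 nu0 rec nuD; case: (pselect (exists D', forall n, nu n <= D' * v ^+ n)).
  by left.
move=> nD; right.
pose a n := nu n / v ^+ n; pose S N := \sum_(n < N) a n; pose ka := 1 + (2 * C)^-1.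
have vn n : 0 < v ^+ n by rewrite exprn_gt0.
have a0 n : 0 <= a n by rewrite divr_ge0// ltW.
have C2 : 0 < 2 * C by rewrite mulr_gt0.
have [n0 an0] : exists n, 2 * C < a n.
  apply/not_existsP => H; apply: nD; exists (2 * C) => n.
  by rewrite -ler_pdivrMr//; have /negP := H n; rewrite -leNgt.
have S0 k : 2 * C * ka ^+ k <= S (n0.+1 + k)%N.
  elim: k => [|k ih].
    rewrite expr0 mulr1 addn0 /S big_ord_recr/= (le_trans (ltW an0))// lerDr.
    by apply: sumr_ge0.
  have ka1 : 1 <= ka by rewrite /ka lerDl invr_ge0 ltW.
  have S2 : 2 * C <= S (n0.+1 + k)%N.
    by apply: le_trans ih; rewrite ler_peMr ?(ltW C2)// exprn_ege1.
  rewrite addnS /S big_ord_recr/= -/(S _).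
  have := rec (n0.+1 + k)%N; rewrite -/(S _) -/(a _) => r.
  have aS : S (n0.+1 + k)%N * (2 * C)^-1 <= a (n0.+1 + k)%N.
    by rewrite ler_pdivrMr//; lra.
  apply: (@le_trans _ _ (S (n0.+1 + k)%N * ka)).
    by rewrite exprSr mulrA ler_wpM2r// (le_trans ler01).
  by rewrite /ka mulrDr mulr1 lerD2l.
have ka0 : 0 < ka by rewrite /ka addr_gt0// invr_gt0.
suff : ka <= t / v by rewrite ler_pdivlMr// mulrC.
(* The shift by the starting index [n0.+1] is paid for in the constant. *)
apply: (@geometric_le _ _ (2 * D * (t / v) ^+ n0.+1)) => //; first exact: divr_gt0.
move=> k; rewrite -!mulrA -exprD.
have aS : ka ^+ k <= 2 * a (n0.+1 + k)%N.
  have ka1 : 1 <= ka ^+ k by rewrite exprn_ege1// /ka lerDl invr_ge0 ltW.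
  have := rec (n0.+1 + k)%N; rewrite -/(S _) -/(a _) => r.
  have := le_trans (S0 k) r; rewrite -mulrA mulrCA ler_pM2l//.
  by lra.
apply: le_trans aS _; rewrite ler_wpM2l//.
by rewrite expr_div_n mulrA ler_wpM2r// invr_ge0 ltW.
Qed.

Lemma powR_superadditive (a b q : R) : 1 <= q -> 0 <= a -> 0 <= b ->
  a `^ q + b `^ q <= (a + b) `^ q.
Proof.
move=> q1 a0 b0; have q0 : 0 < q by lra.
have q2 : 0 <= q - 1 by lra.
rewrite -(mulr_powRB1 a0 q0) -(mulr_powRB1 b0 q0) -(mulr_powRB1 (addr_ge0 a0 b0) q0).
rewrite mulrDl lerD// ler_wpM2l//.
  by rewrite ge0_ler_powR// ?nnegrE ?addr_ge0// lerDl.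
by rewrite ge0_ler_powR// ?nnegrE ?addr_ge0// lerDr.
Qed.

Lemma powR_sum_superadditive (q : R) (N : nat) (a : nat -> R) : 1 <= q ->
  (forall n, 0 <= a n) ->
  \sum_(n < N) a n `^ q <= (\sum_(n < N) a n) `^ q.
Proof.
move=> q1 a0; elim: N => [|N ih]; first by rewrite !big_ord0 powR_ge0.
rewrite !big_ord_recr/=; apply: le_trans (powR_superadditive q1 _ (a0 N)).
  by rewrite lerD2r.
by apply: sumr_ge0.
Qed.

End growth.

(** * A spectral point at the growth rate of the convolution powers *)

Section spectral_lower_bound.
Variables (R : realType) (G : countType) (mul : G -> G -> G).
Variables (inv : G -> G) (e : G) (mu : G -> R).
Hypothesis gp : is_group mul inv e.
Hypothesis pm : is_prob mu.
Local Notation econv := (econv mul inv).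
Local Notation lam := (lam mul inv).
Local Notation mun := (convpow mul inv e mu).
Local Notation C := R[i].
Variable q : R.
Hypothesis q1 : 1 < q.

Let q0 : 0 < q. Proof. by apply: lt_trans q1. Qed.
Let mu0 t : 0 <= mu t. Proof. exact: pm.1. Qed.
Let mun0 k t : 0 <= mun k t. Proof. exact: (is_prob_convpow gp k pm).1. Qed.

(** Young's inequality; the constant is A^q in the form in which it arises, A^(q-1) from Jensen and
    A from the total mass. *)
Lemma opbound_l1 (u : G -> \bar R) (A : R) : (forall t, 0 <= u t)%E ->
  (\esum_(t in [set: G]) u t <= A%:E)%E -> opbound mul inv q u (A `^ (q - 1) * A).
Proof.
move=> u0 uA g g0; set Y := (\esum_(s in [set: G]) (g s `^ q)%E)%E.
have U0 : (0 <= \esum_(t in [set: G]) u t)%E by exact: esumT_ge0.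
have Y0 : (0 <= Y)%E by apply: esumT_ge0 => s; exact: poweR_ge0.
apply: (@le_trans _ _ (\esum_(s in [set: G])
   (((\esum_(t in [set: G]) u t) `^ (q - 1))%E * econv u (fun t => (g t `^ q)%E) s))%E).
  by apply: le_esumT => s; exact: esum_jensen.
have gq0 t : (0 <= g t `^ q)%E by exact: poweR_ge0.
rewrite esumTZl ?poweR_ge0//; last by move=> s; exact: econv_ge0.
rewrite (esum_econv gp)// EFinM -muleA; apply: lee_pmul => //.
- exact: poweR_ge0.
- exact: mule_ge0.
- by rewrite -poweR_EFin; apply: le_poweR => //; rewrite subr_ge0 ltW.
- exact: lee_wpmul2r.
Qed.

(** Some [lam (fs n)] lies within distance 1 of B on the unit ball and is bounded by its l^1 norm.
    Linearity of B is not part of [in_PF], so the bound is confined to the ball. *)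
Lemma PF_bounded_on_ball B : in_PF mul inv q B ->
  exists2 M : R, 0 <= M & forall h, (lqsum q h <= 1)%E -> (lqsum q (B h) <= M%:E)%E.
Proof.
move=> [fs [fs1 cv]].
have [n on] : exists n, (opnorm q (fun g s => (B g s - lam (fs n) g s)%R) <= 1)%E.
  move/fine_cvgP: cv => [fin /cvgrPdist_lt /(_ 1 ltr01) c1].
  near \oo => n; exists n.
  have fn : opnorm q (fun g s => (B g s - lam (fs n) g s)%R) \is a fin_num.
    by near: n; exact: fin.
  have h : `|0 - fine (opnorm q (fun g s => (B g s - lam (fs n) g s)%R))| < 1.
    by near: n; exact: c1.
  rewrite -(fineK fn) lee_fin; apply: le_trans (ltW h); rewrite sub0r normrN.
  exact: ler_norm.
have f0 := enormc_ge0 (fs n).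
have fE : lqsum 1 (fs n) = (\esum_(t in [set: G]) enormc (fs n) t)%E.
  by apply: eq_esumT => t; rewrite powRr1// normc_ge0.
have ff : lqsum 1 (fs n) \is a fin_num by rewrite ge0_fin_numE ?lqsum_ge0.
pose A := fine (lqsum 1 (fs n)).
have A0 : 0 <= A by rewrite fine_ge0// lqsum_ge0.
have ob : opbound mul inv q (enormc (fs n)) (A `^ (q - 1) * A).
  by apply: opbound_l1 => //; rewrite -fE fineK.
pose M1 := A `^ (q - 1) * A.
have M10 : 0 <= M1 by rewrite mulr_ge0// powR_ge0.
exists (2 `^ q * (1 + 2 `^ q * M1)).
  by rewrite mulr_ge0 ?powR_ge0// addr_ge0// mulr_ge0 ?powR_ge0.
move=> h h1.
have -> : B h = fun s => (B h s - lam (fs n) h s) + lam (fs n) h s.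
  by apply/funext => s; rewrite subrK.
apply: le_trans (lqsumD _ _ q0) _; rewrite EFinM EFinD.
apply: lee_wpmul2l; first by rewrite lee_fin powR_ge0.
apply: leeD.
  rewrite -(lqnorm_le1 _ q0); apply: le_trans on; apply: ereal_sup_ubound.
  by exists h => //=; rewrite (lqnorm_le1 _ q0).
apply: le_trans (lqsum_lam h q0 ob _) _ => //.
rewrite [leRHS]EFinM; apply: lee_wpmul2l; first by rewrite lee_fin powR_ge0.
rewrite -[leRHS]mule1; exact: lee_wpmul2l.
Unshelve. all: by end_near. Qed.

Lemma econv_prob_fin g s : (lqsum q g < +oo)%E ->
  (econv (EFin \o mu) (enormc g) s < +oo)%E.
Proof.
move=> gq; have g0 := enormc_ge0 g.
apply: (@lty_poweRy _ _ q); first by rewrite gt_eqF.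
apply: le_lt_trans (@esum_term_le _ _
  (fun s => (econv (EFin \o mu) (enormc g) s `^ q)%E) s _) _.
  by move=> ?; exact: poweR_ge0.
apply: le_lt_trans (opbound_prob gp q1 pm g0) _.
by rewrite mul1e.
Qed.

(** The scaling is done on g, before B is applied: with c^q = 1/(1+Y) the image of c g under gm - T
    lies in the unit ball, and B returns c g. Using 1 + Y instead of Y avoids dividing by 0. *)
Lemma inverse_bound (gm : R) :
  PF_invertible mul inv q (fun g s => Complex gm 0 * g s - lam (mu_C mu) g s) ->
  exists2 M : R, 0 <= M & forall g Y, (lqsum q g < +oo)%E -> 0 <= Y ->
    (lqsum q (fun s => (Complex gm 0 * g s - lam (mu_C mu) g s)%R) <= Y%:E)%E ->
    (lqsum q g <= (M * (1 + Y))%:E)%E.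
Proof.
move=> [B [PFB BT]]; have [M M0 HM] := PF_bounded_on_ball PFB.
exists M => // g Y gq Y0 gY.
have Y1 : 0 < 1 + Y by lra.
pose c := (1 + Y) `^ (- q^-1).
have c0 : 0 < c by rewrite powR_gt0.
have cq : normc (Complex c 0) `^ q = (1 + Y)^-1.
  by rewrite normc_real gtr0_norm// /c -powRrM mulNr mulVf ?gt_eqF// powR_inv1// ltW.
have lcg : (lqsum q (fun s => (Complex c 0 * g s)%R) =
    ((1 + Y)^-1)%:E * lqsum q g)%E by rewrite lqsumZ// cq.
have gf : lqsum q g \is a fin_num by rewrite ge0_fin_numE ?lqsum_ge0.
have cgq : (lqsum q (fun s => (Complex c 0 * g s)%R) < +oo)%E.
  by rewrite lcg -(fineK gf) -EFinM ltry.
have := HM _ (_ : (lqsum q (fun s => (Complex gm 0 * (Complex c 0 * g s) -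
   lam (mu_C mu) (fun s => Complex c 0 * g s) s)%R) <= 1)%E).
rewrite (BT _ cgq).1 lcg => H.
have /(lee_wpmul2l (ltW Y1 : (0 <= (1 + Y)%:E)%E)) : (((1 + Y)^-1)%:E * lqsum q g <= M%:E)%E.
  apply: H.
  have -> : (fun s => Complex gm 0 * (Complex c 0 * g s) -
      lam (mu_C mu) (fun s => Complex c 0 * g s) s) =
      fun s => Complex c 0 * (Complex gm 0 * g s - lam (mu_C mu) g s).
    apply/funext => s; rewrite mulrBr mulrCA; congr (_ - _).
    rewrite /Defs.lam -csumZ; last exact: (csummable_lam mu0 (econv_prob_fin s gq)).
    by congr csum; apply/funext => t; rewrite mulrCA.
  rewrite lqsumZ// cq.
  have i0 : (0 <= ((1 + Y)^-1)%:E :> \bar R)%E by rewrite lee_fin invr_ge0 ltW.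
  apply: le_trans (lee_wpmul2l i0 gY) _; rewrite -EFinM lee_fin mulrC ler_pdivrMr//; lra.
by rewrite muleA -EFinM mulfV ?gt_eqF// mul1e -EFinM mulrC.
Qed.

Let pn n := fine (lqsum q (mu_C (mun n))).

Lemma lqsum_convpow_le1 n : (lqsum q (mu_C (mun n)) <= 1)%E.
Proof.
have p := is_prob_convpow gp n pm.
rewrite lqsum_real// -p.2; apply: le_esumT => s; rewrite lee_fin.
have := mun0 n s; rewrite le_eqVlt => /predU1P[<-|m0]; first by rewrite powR0// gt_eqF.
by rewrite ge1r_powR// ?m0 ?prob_le1// ltW.
Qed.

Lemma lqsum_convpowE n : lqsum q (mu_C (mun n)) = (pn n)%:E.
Proof.
rewrite fineK// ge0_fin_numE ?lqsum_ge0//.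
by apply: le_lt_trans (lqsum_convpow_le1 n) (ltry _).
Qed.

Let pn0 n : 0 <= pn n. Proof. by rewrite fine_ge0// lqsum_ge0. Qed.
Let pn1 n : pn n <= 1. Proof. by rewrite -lee_fin -lqsum_convpowE lqsum_convpow_le1. Qed.

Section truncated_resolvent.
Variable w : R.
Hypothesis w0 : 0 < w.
Let x N t := \sum_(n < N) w^-1 ^+ n.+1 * mun n t.
Let wi0 n : 0 <= w^-1 ^+ n. Proof. by rewrite exprn_ge0// invr_ge0 ltW. Qed.
Let x0 N t : 0 <= x N t. Proof. by apply: sumr_ge0 => n _; rewrite mulr_ge0. Qed.

Let xS N : mu_C (x N.+1) = fun s => mu_C (x N) s + Complex (w^-1 ^+ N.+1) 0 * mu_C (mun N) s.
Proof.
apply/funext => s; rewrite /mu_C /x big_ord_recr/=; apply/eqP.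
by rewrite eq_complex /= !(mulr0, mul0r, subr0, addr0) !eqxx.
Qed.

(** [PF_invertible] speaks of functions with finite q-sum only, and the absorption of half of this
    q-sum in [truncated_recursion] needs a finite number. *)
Lemma lqsum_truncated_fin N : (lqsum q (mu_C (x N)) < +oo)%E.
Proof.
elim: N => [|N ih].
  rewrite lqsum_real// esum1 ?ltry// => s _.
  by rewrite /x big_ord0 powR0// gt_eqF.
rewrite xS; apply: le_lt_trans (lqsumD _ _ q0) _.
rewrite lqsumZ// lqsum_convpowE -EFinM.
have xf : lqsum q (mu_C (x N)) \is a fin_num by rewrite ge0_fin_numE ?lqsum_ge0.
by rewrite -(fineK xf) -EFinD -EFinM ltry.
Qed.

Lemma econv_truncated N s : econv (EFin \o mu) (EFin \o x N) s =
  (\sum_(n < N) w^-1 ^+ n.+1 * mun n.+1 s)%:E.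
Proof.
have em t : (0 <= (EFin \o mu) t)%E by rewrite lee_fin.
elim: N => [|N ih].
  rewrite big_ord0 [LHS]esum1// => t _; by rewrite /= /x big_ord0 mule0.
rewrite big_ord_recr/= EFinD -ih.
have -> : (w^-1 ^+ N.+1 * conv mul inv (mun N) mu s)%:E =
    econv (EFin \o mu) (fun t => (w^-1 ^+ N.+1)%:E * (EFin \o mun N) t)%E s.
  rewrite econvZr ?lee_fin//; last by move=> t; rewrite lee_fin.
  rewrite EFinM; congr (_ * _)%E.
  have := congr1 (@^~ s) (econv_convpowD gp 1 N pm).
  by rewrite (convpow1 gp pm) add1n => /= ->.
rewrite -esumTD; last 2 first.
- by move=> t; rewrite mule_ge0 ?lee_fin.
- by move=> t; rewrite !mule_ge0 ?lee_fin.
apply: eq_esumT => t; rewrite -ge0_muleDr ?mule_ge0 ?lee_fin//.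
by congr (_ * _)%E; rewrite /= /x big_ord_recr/= EFinD.
Qed.

Lemma truncated_resolvent_eq (gm : R) N :
  (fun s => Complex gm 0 * mu_C (x N) s - lam (mu_C mu) (mu_C (x N)) s) =
  fun s => Complex (gm - w) 0 * mu_C (x N) s +
    (mu_C (mun 0) s + Complex (- w^-1 ^+ N) 0 * mu_C (mun N) s).
Proof.
apply/funext => s; rewrite lam_real// econv_truncated.
have E : w * x N s - \sum_(n < N) w^-1 ^+ n.+1 * mun n.+1 s =
    mun 0 s - w^-1 ^+ N * mun N s.
  elim: N => [|N ih]; first by rewrite /x !big_ord0 expr0 mulr0 mul1r !subrr.
  have wE : w * (w^-1 ^+ N.+1 * mun N s) = w^-1 ^+ N * mun N s.
    by rewrite exprS !mulrA mulfV ?gt_eqF// mul1r.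
  by rewrite /x !big_ord_recr/= -/(x N s) mulrDr wE; move: ih => /=; lra.
apply/eqP; rewrite eq_complex /= !(mulr0, mul0r, subr0, addr0) eqxx andbT.
by apply/eqP; move: E => /=; lra.
Qed.

(** The summands are nonnegative and x^q is superadditive for q >= 1, so nothing cancels and the
    q-sums add up. *)
Lemma truncated_lower N :
  ((\sum_(n < N) (w^-1 ^+ n.+1) `^ q * pn n)%:E <= lqsum q (mu_C (x N)))%E.
Proof.
rewrite lqsum_real//.
apply: (@le_trans _ _ (\esum_(s in [set: G])
    \sum_(n < N) ((w^-1 ^+ n.+1 * mun n s) `^ q)%:E)%E); last first.
  apply: le_esumT => s; rewrite sumEFin lee_fin.
  apply: (@powR_sum_superadditive _ q N (fun n => w^-1 ^+ n.+1 * mun n s)).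
    exact: ltW.
  by move=> n; rewrite mulr_ge0.
rewrite esum_sum; last by move=> s n _ _; rewrite lee_fin powR_ge0.
rewrite -sumEFin; apply: lee_sum => n _.
under eq_esumT do rewrite powRM// EFinM.
rewrite esumTZl ?lee_fin ?powR_ge0//; last by move=> s; rewrite lee_fin powR_ge0.
by rewrite EFinM -lqsum_convpowE lqsum_real.
Qed.

(** Let X be the q-sum of x_N. In the bound for X, the term (gm - w) x_N contributes at most X/2 by
    the smallness hypothesis and is absorbed on the left, whence the 2 M. The two factors 2^q come
    from two uses of [lqsumD], and w^q from the exponent n.+1 in the resolvent. *)
Lemma truncated_recursion (gm M : R) N : 0 < M -> w <= gm ->
  (forall g Y, (lqsum q g < +oo)%E -> 0 <= Y ->
    (lqsum q (fun s => (Complex gm 0 * g s - lam (mu_C mu) g s)%R) <= Y%:E)%E ->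
    (lqsum q g <= (M * (1 + Y))%:E)%E) ->
  M * (2 `^ q * (gm - w) `^ q) <= 2^-1 ->
  \sum_(n < N) pn n / (w `^ q) ^+ n <=
  w `^ q * (2 * M * (1 + 2 `^ q * 2 `^ q)) * (1 + pn N / (w `^ q) ^+ N).
Proof.
move=> M0 wg HM small.
have wq0 : 0 < w `^ q by rewrite powR_gt0.
have wXq n : (w^-1 ^+ n) `^ q = ((w `^ q) ^+ n)^-1.
  have wn : 0 <= w ^+ n by rewrite exprn_ge0// ltW.
  rewrite exprVn -powR_inv1// powRAC powR_inv1 ?powR_ge0//.
  by rewrite powR_exprn// ltW.
pose a := pn N / (w `^ q) ^+ N.
have a0 : 0 <= a by rewrite divr_ge0// exprn_ge0// ltW.
have xf : lqsum q (mu_C (x N)) \is a fin_num.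
  by rewrite ge0_fin_numE ?lqsum_ge0 ?lqsum_truncated_fin.
pose X := fine (lqsum q (mu_C (x N))).
have XE : lqsum q (mu_C (x N)) = X%:E by rewrite fineK.
have X0 : 0 <= X by rewrite fine_ge0// lqsum_ge0.
pose d := (gm - w) `^ q; pose p := 2 `^ q : R.
have d0 : 0 <= d by exact: powR_ge0.
have p0 : 0 <= p by exact: powR_ge0.
pose Y := p * (d * X + p * (1 + a)).
have Y0 : 0 <= Y by rewrite /Y mulr_ge0// addr_ge0// mulr_ge0// addr_ge0.
have := HM _ Y (lqsum_truncated_fin N) Y0.
rewrite truncated_resolvent_eq XE lee_fin => H.
have XM : X <= M * (1 + Y).
  apply: H; apply: le_trans (lqsumD _ _ q0) _; rewrite /Y EFinM.
  apply: lee_wpmul2l; first by rewrite lee_fin.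
  rewrite lqsumZ// normc_real ger0_norm ?subr_ge0// XE EFinD EFinM.
  apply: leeD => //; apply: le_trans (lqsumD _ _ q0) _; rewrite EFinM.
  apply: lee_wpmul2l; first by rewrite lee_fin.
  rewrite lqsumZ// normc_real normrN ger0_norm// wXq !lqsum_convpowE.
  by rewrite -EFinM -EFinD lee_fin /a [X in _ + X]mulrC lerD2r.
have XM2 : X <= 2 * M * (1 + p * p) * (1 + a).
  have h1 : M * (p * d) * X <= 2^-1 * X by rewrite ler_wpM2r.
  have h2 : 0 <= M * a by rewrite mulr_ge0// ltW.
  move: XM; rewrite /Y => XM; lra.
have low := truncated_lower N; rewrite XE lee_fin in low.
have -> : \sum_(n < N) pn n / (w `^ q) ^+ n =
    w `^ q * \sum_(n < N) (w^-1 ^+ n.+1) `^ q * pn n.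
  rewrite big_distrr/=; apply: eq_bigr => n _.
  by rewrite wXq exprS; field; rewrite !gt_eqF// exprn_gt0.
rewrite -mulrA ler_wpM2l ?(ltW wq0)//.
exact: le_trans XM2.
Qed.

End truncated_resolvent.

(** tau is the exponential rate of the q-sums, which are q-th powers of norms, so the spectral point
    is gm = tau^(1/q). The point w is taken below gm but so close that both outcomes of
    [growth_dichotomy] contradict the minimality of tau. *)
Lemma spectrum_ge (c r : R) : 0 < c -> 0 < r ->
  (forall n, ((c * r ^+ n)%:E <= lqsum q (mu_C (mun n)))%E) ->
  exists2 gm, r `^ q^-1 <= gm & PF_spectrum mul inv q mu (Complex gm 0).
Proof.
move=> c0 r0 rle.
have {}rle n : c * r ^+ n <= pn n by rewrite -lee_fin -lqsum_convpowE.
pose A := [set t | 0 < t /\ exists D, forall n, pn n <= D * t ^+ n].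
have Alb t : A t -> r <= t.
  move=> [t0 [D HD]]; apply: (@geometric_le _ r t (c^-1 * D)) => // n.
  by rewrite -mulrA ler_pdivlMl//; exact: le_trans (HD n).
have A1 : A 1 by split => //; exists 1 => n; rewrite expr1n mulr1.
have Ainf : has_inf A by split; [exists 1|exists r => t; exact: Alb].
pose tau := inf A.
have rt : r <= tau by apply: lb_le_inf; [exists 1|exact: Alb].
have t0 : 0 < tau by exact: lt_le_trans rt.
pose gm := tau `^ q^-1.
have gm0 : 0 < gm by rewrite powR_gt0.
have gmq : gm `^ q = tau by rewrite /gm -powRrM mulVf ?gt_eqF// powRr1// ltW.
have iq0 : 0 <= q^-1 by rewrite invr_ge0 ltW.
exists gm.
  by rewrite ge0_ler_powR// nnegrE ltW.
move=> /inverse_bound[M M0 HM].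
pose M' := M + 1.
have M'0 : 0 < M' by rewrite /M'; lra.
have {}HM g Y : (lqsum q g < +oo)%E -> 0 <= Y ->
    (lqsum q (fun s => (Complex gm 0 * g s - lam (mu_C mu) g s)%R) <= Y%:E)%E ->
    (lqsum q g <= (M' * (1 + Y))%:E)%E.
  move=> h1 h2 h3; apply: le_trans (HM _ _ h1 h2 h3) _; rewrite lee_fin.
  by rewrite ler_wpM2r// /M'; lra.
pose p := 2 `^ q : R.
have p0 : 0 < p by rewrite powR_gt0.
(* Chosen so that gm - w <= dl is precisely the smallness hypothesis of [truncated_recursion]. *)
pose dl := (2 * M' * p)^-1 `^ q^-1.
have mp0 : 0 < 2 * M' * p by rewrite !mulr_gt0.
have dl0 : 0 < dl by rewrite powR_gt0// invr_gt0.
have dlq : dl `^ q = (2 * M' * p)^-1.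
  by rewrite /dl -powRrM mulVf ?gt_eqF// powRr1// invr_ge0 ltW.
(* The constant of [truncated_recursion] with w^q replaced by its bound tau. Independence of w
   matters: the gain [ka] must be fixed before w is chosen. *)
pose C' := tau * (2 * M' * (1 + p * p)).
have C'0 : 0 < C' by rewrite !mulr_gt0// addr_gt0// mulr_gt0.
pose ka := 1 + (2 * C')^-1.
have ka1 : 1 < ka by rewrite /ka ltrDl invr_gt0 mulr_gt0.
have ka0 : 0 < ka by exact: lt_trans ka1.
(* Above [lo], w is within dl of gm, is positive, and satisfies w^q ka > tau. *)
pose lo := Num.max (gm - dl) (Num.max ((tau / ka) `^ q^-1) 0).
have tk : tau / ka < tau by rewrite ltr_pdivrMr// ltr_pMr.
have lo1 : lo < gm.
  rewrite /lo !gt_max gm0 andbT ltrBlDr ltrDl dl0 /=.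
  by rewrite gt0_ltr_powR// ?nnegrE ?invr_gt0// ?divr_ge0// ltW.
pose w := (lo + gm) / 2.
have /andP[wlo wg] : lo < w < gm by exact: midpoint_lt.
have [lo2 lo3 lo4] : [/\ gm - dl < w, (tau / ka) `^ q^-1 < w & 0 < w].
  by move: wlo; rewrite /lo !gt_max => /andP[? /andP[? ?]].
have wt : w `^ q < tau by rewrite -gmq gt0_ltr_powR// nnegrE ltW.
have wk : tau < w `^ q * ka.
  rewrite -ltr_pdivrMr// -[ltLHS]powRr1; last by rewrite divr_ge0// ltW.
  rewrite -(@mulVf _ q) ?gt_eqF// powRrM gt0_ltr_powR// nnegrE ?powR_ge0//.
  exact: ltW.
have wq0 : 0 < w `^ q by rewrite powR_gt0.
have small : M' * (2 `^ q * (gm - w) `^ q) <= 2^-1.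
  have h : (gm - w) `^ q <= dl `^ q.
    rewrite ge0_ler_powR ?nnegrE ?subr_ge0 ?(ltW q0) ?(ltW dl0) ?(ltW wg)//.
    by rewrite lerBlDr -lerBlDl ltW.
  apply: (@le_trans _ _ (M' * (p * (2 * M' * p)^-1))).
    by rewrite ler_wpM2l ?(ltW M'0)// ler_wpM2l ?(ltW p0)// -dlq.
  rewrite le_eqVlt; apply/orP; left; apply/eqP; field.
  by rewrite !gt_eqF.
have eps0 : 0 < w `^ q * ka - tau by rewrite subr_gt0.
(* An admissible rate t below w^q ka excludes the second alternative; the first would make w^q < tau
   admissible. *)
have [t [tp [D HD]] tlt] := inf_adherent eps0 Ainf.
have {}tlt : t < w `^ q * ka by move: tlt; rewrite -/tau addrC subrK.
case: (@growth_dichotomy _ pn (w `^ q) C' t D) => //.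
- move=> N; apply: le_trans (truncated_recursion lo4 N M'0 (ltW wg) HM small) _.
  rewrite ler_wpM2r//.
    by rewrite addr_ge0// divr_ge0// exprn_ge0// ltW.
  rewrite ler_wpM2r ?(ltW wt)//.
  by rewrite !mulr_ge0 ?(ltW M'0)// addr_ge0// mulr_ge0// ltW.
- move=> HD'; have Aw : A (w `^ q) by split.
  have := ge_inf Ainf.2 Aw.
  by rewrite leNgt wt.
- by rewrite leNgt -/ka tlt.
Qed.

End spectral_lower_bound.

(** * Power sums of a probability measure compared with its entropy *)

Section renyi.
Variables (R : realType) (G : countType) (nu : G -> R).
Hypothesis pn : is_prob nu.
Let nu0 s : 0 <= nu s. Proof. exact: pn.1. Qed.
Let nu1 s : nu s <= 1. Proof. exact: prob_le1. Qed.

(** Jensen's inequality in tangent form: expanding exp at c = - (q-1) H bounds nu^(q-1) below by e^c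
    (1 + (q-1) ln nu - c), and averaging over [nu] leaves exactly e^c. *)
Lemma lqsum_ge_entropy (q : R) : 1 < q -> (shannon nu < +oo)%E ->
  ((expR (- ((q - 1) * fine (shannon nu))))%:E <= lqsum q (mu_C nu))%E.
Proof.
move=> q1 fin; have q0 : 0 < q by lra.
have sh0 := shannon_ge0 pn.
have shf : shannon nu \is a fin_num by rewrite ge0_fin_numE.
set H := fine (shannon nu); pose c := - ((q - 1) * H).
have H0 : 0 <= H by rewrite fine_ge0.
have qH : 0 <= (q - 1) * H by rewrite mulr_ge0// subr_ge0 ltW.
rewrite lqsum_real//.
(* The entropy term stands on the right so that all three sums have nonnegative terms. *)
have pt s : expR c * (1 - c) * nu s <=
    nu s `^ q + expR c * (q - 1) * - (nu s * ln (nu s)).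
  have := nu0 s; rewrite le_eqVlt => /predU1P[<-|n0].
    by rewrite !mul0r mulr0 powR0 ?gt_eqF// oppr0 mulr0 addr0.
  rewrite -(mulr_powRB1 (nu0 s) q0) /powR gt_eqF//.
  have := expR_ge1Dx ((q - 1) * ln (nu s) - c).
  rewrite expRB ler_pdivlMr ?expR_gt0// => h.
  have := ler_wpM2l (nu0 s) h; lra.
have e0 : 0 <= expR c * (q - 1) by rewrite mulr_ge0 ?expR_ge0// subr_ge0 ltW.
have e1 : 0 <= expR c * (1 - c) by rewrite mulr_ge0 ?expR_ge0// /c; lra.
have sum : ((expR c * (1 - c))%:E * 1 <= \esum_(s in [set: G]) (nu s `^ q)%:E +
   (expR c * (q - 1))%:E * shannon nu)%E.
  rewrite -pn.2 shannonE -!esumTZl//; last by move=> s; exact: entropy_term_ge0.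
  rewrite -esumTD; last 2 first.
  - by move=> s; rewrite lee_fin powR_ge0.
  - by move=> s; apply: mule_ge0; [rewrite lee_fin|exact: entropy_term_ge0].
  by apply: le_esumT => s; rewrite -!EFinM -EFinD lee_fin.
move: sum; rewrite mule1 -(fineK shf) -/H -EFinM -leeBlDr// -EFinB.
apply: le_trans; rewrite lee_fin -/c.
by rewrite /c; lra.
Qed.

(** The sum of nu^(1+r) is 1 minus the sum of the nonnegative terms nu (1 - nu^r). Keeping only a
    finite part S of the latter gives 1 - S <= exp(- S). *)
Lemma renyi_sum_le (X : set G) (r : R) : 0 < r -> finite_set X ->
  (\esum_(s in [set: G]) (nu s `^ (1 + r))%:E <=
   (expR (- \sum_(s \in X) (nu s * (1 - nu s `^ r))))%:E)%E.
Proof.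
move=> r0 finX.
have d0 s : 0 <= nu s * (1 - nu s `^ r).
  rewrite mulr_ge0// subr_ge0; have := nu0 s; rewrite le_eqVlt => /predU1P[<-|n0].
    by rewrite powR0 ?gt_eqF// ler01.
  by rewrite -[leRHS](powRr0 (nu s)) ger_powR ?n0 ?nu1// ltW.
have sE : (\esum_(s in [set: G]) (nu s `^ (1 + r))%:E +
    \esum_(s in [set: G]) (nu s * (1 - nu s `^ r))%:E = 1)%E.
  rewrite -esumTD; last 2 first.
  - by move=> s; rewrite lee_fin powR_ge0.
  - by move=> s; rewrite lee_fin.
  rewrite -pn.2; apply: eq_esumT => s; rewrite -EFinD; congr EFin.
  rewrite powRD; last by rewrite gt_eqF// addr_gt0.
  by rewrite powRr1//; lra.
have XS : ((\sum_(s \in X) (nu s * (1 - nu s `^ r)))%:E <=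
    \esum_(s in [set: G]) (nu s * (1 - nu s `^ r))%:E)%E.
  apply: esum_ge; exists X; first by split.
  by rewrite -fsumEFin.
set S := \sum_(s \in X) _ in XS *.
apply: (@le_trans _ _ (1 - S%:E)%E); last first.
  by rewrite -EFinB lee_fin; exact: expR_ge1Dx.
rewrite leeBrDr// -sE.
by apply: leeD.
Qed.

(** With x = - r ln nu >= 0 one has exp(- x) <= 1/(1 + x) <= 1 - x + x^2, the last step because (1 +
    x)(1 - x + x^2) = 1 + x^3. *)
Lemma renyi_term_ge (r : R) s : 0 < r ->
  r * (- (nu s * ln (nu s)) - r * (nu s * ln (nu s) ^+ 2)) <= nu s * (1 - nu s `^ r).
Proof.
move=> r0; have := nu0 s; rewrite le_eqVlt => /predU1P[<-|n0].
  by rewrite !mul0r !(oppr0, mulr0, subr0).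
have l0 : ln (nu s) <= 0 by exact: ln_le0.
pose x := - (r * ln (nu s)).
have x0 : 0 <= x by rewrite /x -mulrN mulr_ge0 ?oppr_ge0// ltW.
have -> : nu s `^ r = (expR x)^-1 by rewrite /powR gt_eqF// /x expRN invrK.
have e1 : (expR x)^-1 <= (1 + x)^-1.
  by rewrite lef_pV2 ?posrE ?expR_gt0 ?expR_ge1Dx//; lra.
have e2 : (1 + x)^-1 <= 1 - x + x ^+ 2.
  rewrite -[leLHS]mul1r ler_pdivrMr; last by lra.
  have : 0 <= x ^+ 3 by rewrite exprn_ge0.
  by rewrite !exprS expr0 mulr1; lra.
have h := ler_wpM2l (nu0 s) (le_trans e1 e2).
have -> : r * (- (nu s * ln (nu s)) - r * (nu s * ln (nu s) ^+ 2)) =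
   nu s * (x - x ^+ 2) by rewrite /x; ring.
lra.
Qed.

End renyi.

(** * Moments of convolution powers *)

(** Each share x/(a+b) lies in (0,1] and is at most its power al <= 1; the two shares add up to
    1. *)
Lemma powR_subadditive (R : realType) (a b al : R) : 0 < al <= 1 -> 0 < a -> 0 < b ->
  (a + b) `^ al <= a `^ al + b `^ al.
Proof.
move=> /andP[al0 al1] a0 b0.
have c0 : 0 < a + b by rewrite addr_gt0.
have H x : 0 < x -> x <= a + b -> (a + b) `^ al * (x / (a + b)) <= x `^ al.
  move=> x0 xc.
  have -> : x `^ al = (a + b) `^ al * (x / (a + b)) `^ al.
    rewrite -powRM ?divr_ge0 ?(ltW c0) ?(ltW x0)//.
    by rewrite mulrCA mulfV ?mulr1// gt_eqF.
  rewrite ler_wpM2l ?powR_ge0// ger1_powR// divr_gt0//=.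
  by rewrite ler_pdivrMr// mul1r.
have h1 := H a a0; have h2 := H b b0.
have -> : (a + b) `^ al = (a + b) `^ al * (a / (a + b)) + (a + b) `^ al * (b / (a + b)).
  by rewrite -mulrDr -mulrDl mulfV ?mulr1// gt_eqF.
by apply: lerD; [apply: h1|apply: h2]; rewrite ?lerDl ?lerDr ltW.
Qed.

Section moments.
Variables (R : realType) (G : countType) (mul : G -> G -> G).
Variables (inv : G -> G) (e : G) (mu : G -> R) (W : G -> R).
Hypothesis gp : is_group mul inv e.
Hypothesis pm : is_prob mu.
Hypothesis W0 : forall s, 0 <= W s.
Hypothesis WM : forall s t, W (mul s t) <= W s + W t.
Local Notation mun := (convpow mul inv e mu).

(** Subadditivity of W bounds the moment of a convolution by the sum of the moments. The index
    starts at [n.+1]: at 0 the measure is the Dirac mass at e, and W e need not vanish. *)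
Lemma moment_convpow n :
  (\esum_(s in [set: G]) (mun n.+1 s * W s)%:E <=
   n.+1%:R%:E * \esum_(s in [set: G]) (mu s * W s)%:E)%E.
Proof.
have m0 s : 0 <= mu s by exact: pm.1.
set M := (\esum_(s in [set: G]) (mu s * W s)%:E)%E.
have M0 : (0 <= M)%E by apply: esumT_ge0 => s; rewrite lee_fin mulr_ge0.
elim: n => [|n ih]; first by rewrite (convpow1 gp pm) mul1e.
have pn := is_prob_convpow gp n.+1 pm.
have n0 s : 0 <= mun n.+1 s by exact: pn.1.
have mm0 t s : (0 <= (mun n.+1 t * mu s)%:E)%E by rewrite lee_fin mulr_ge0.
have nE0 s : (0 <= (mun n.+1 s)%:E)%E by rewrite lee_fin.
have mE0 s : (0 <= (mu s)%:E)%E by rewrite lee_fin.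
have WE0 s : (0 <= (W s)%:E)%E by rewrite lee_fin.
apply: (@le_trans _ _ (\esum_(s in [set: G]) \esum_(t in [set: G])
   ((mun n.+1 t)%:E * ((mu (mul (inv t) s))%:E * (W t + W (mul (inv t) s))%:E)))%E).
  apply: le_esumT => s.
  rewrite EFinM -[mun n.+2]/(conv mul inv (mun n.+1) mu) (EFin_conv gp)//.
  rewrite /econv -esumTZr//; last by move=> t; apply: mule_ge0; [exact: nE0|exact: mE0].
  apply: le_esumT => t; rewrite -muleA; apply: lee_wpmul2l; first exact: nE0.
  apply: lee_wpmul2l; [exact: mE0|rewrite lee_fin].
  by rewrite -{1}(group_mulVK gp t s).
rewrite esum_swap; last by move=> s t; rewrite !mule_ge0// lee_fin addr_ge0.
have E t : (\esum_(s in [set: G]) ((mun n.+1 t)%:E *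
     ((mu (mul (inv t) s))%:E * (W t + W (mul (inv t) s))%:E)) =
     (mun n.+1 t * W t)%:E + (mun n.+1 t)%:E * M)%E.
  rewrite esumTZl//; last by move=> s; rewrite mule_ge0// lee_fin addr_ge0.
  rewrite (esum_translate gp (fun s => (mu s)%:E * (W t + W s)%:E)%E).
  have -> : (\esum_(s in [set: G]) ((mu s)%:E * (W t + W s)%:E) = (W t)%:E + M)%E.
    rewrite -[X in (X + _)%E]mul1e -pm.2 -esumTZr// -esumTD; last 2 first.
    - by move=> s; rewrite mule_ge0.
    - by move=> s; rewrite lee_fin mulr_ge0.
    by apply: eq_esumT => s; rewrite -!EFinM -EFinD mulrDr.
  by rewrite ge0_muleDr.
rewrite (eq_esumT E) esumTD; last 2 first.
- by move=> t; rewrite lee_fin mulr_ge0.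
- by move=> t; rewrite mule_ge0.
rewrite esumTZr// pn.2 mul1e -[n.+2%:R]natr1 EFinD ge0_muleDl ?lee_fin//.
by rewrite mul1e leeD2r.
Qed.

End moments.

(** * From a bound on one power to a bound on the spectrum *)

Section spectral_upper_bound.
Variables (R : realType) (G : countType) (mul : G -> G -> G).
Variables (inv : G -> G) (e : G) (mu : G -> R).
Hypothesis gp : is_group mul inv e.
Hypothesis pm : is_prob mu.
Local Notation mun := (convpow mul inv e mu).
Variable q : R.
Hypothesis q1 : 1 < q.

Lemma opbound_convpowM (n j : nat) (ka : R) : 0 <= ka ->
  opbound mul inv q (EFin \o mun n) ka ->
  opbound mul inv q (EFin \o mun (j * n)) (ka ^+ j).
Proof.
move=> ka0 H; elim: j => [|j ih].
  by rewrite mul0n expr0; apply: (opbound_prob gp) => //; exact: is_prob_dirac.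
have p0 k s : (0 <= (EFin \o mun k) s)%E.
  by rewrite lee_fin; exact: (is_prob_convpow gp k pm).1.
rewrite mulSn exprS -(econv_convpowD gp)//.
exact: (opbound_econv gp).
Qed.

(** [ka] bounds the q-th power of the norm of T^n, so its (n q)-th root is a rate per step. Writing
    k = j n + i with i < n spreads it to all powers, and the Neumann series inverts z - T beyond
    that rate. *)
Lemma spectrum_le (n : nat) (ka : R) z : (0 < n)%N -> 0 < ka ->
  opbound mul inv q (EFin \o mun n) ka -> PF_spectrum mul inv q mu z ->
  normc z <= ka `^ (n%:R * q)^-1.
Proof.
move=> n0 ka0 H zs; rewrite leNgt; apply/negP => lt; move: zs.
have q0 : 0 < q by apply: lt_trans q1.
pose sg := ka `^ (n%:R * q)^-1.
have nR : 0 < n%:R :> R by rewrite ltr0n.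
have sg0 : 0 < sg by rewrite powR_gt0.
pose b := sg `^ q.
have b0 : 0 < b by rewrite powR_gt0.
have bn : b ^+ n = ka.
  rewrite /b /sg -powR_mulrn ?powR_ge0// -!powRrM.
  by rewrite (mulrC q) mulVf ?powRr1 ?(ltW ka0)// mulf_neq0// gt_eqF.
(* 1 + 1/ka pays for the remainder i < n: b^i is at least 1 if b >= 1, and at least b^n = ka
   otherwise. *)
have D0 : 0 <= 1 + ka^-1 by rewrite addr_ge0// invr_ge0 ltW.
apply: (@not_in_spectrum _ _ _ _ _ _ gp pm q (1 + ka^-1) sg z) => // k.
have p0 m s : (0 <= (EFin \o mun m) s)%E.
  by rewrite lee_fin; exact: (is_prob_convpow gp m pm).1.
rewrite {1}(divn_eq k n) -(econv_convpowD gp)//.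
apply: (@le_opbound _ _ _ _ _ _ (ka ^+ (k %/ n) * 1)); last first.
  apply: (opbound_econv gp) => //; first by rewrite exprn_ge0// ltW.
    by apply: opbound_convpowM => //; exact: ltW.
  by apply: (opbound_prob gp) => //; exact: is_prob_convpow.
have -> : (sg ^+ k) `^ q = b ^+ k.
  by rewrite /b powR_exprn// ltW.
have -> : b ^+ k = ka ^+ (k %/ n) * b ^+ (k %% n).
  by rewrite {1}(divn_eq k n) exprD mulnC exprM bn.
rewrite mulrCA ler_wpM2l ?exprn_ge0 ?(ltW ka0)//.
have bi0 : 0 <= b ^+ (k %% n) by rewrite exprn_ge0// ltW.
have [b1|b1] := leP 1 b.
  have : 1 <= b ^+ (k %% n) by rewrite exprn_ege1.
  have : 0 <= ka^-1 * b ^+ (k %% n) by rewrite mulr_ge0// invr_ge0 ltW.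
  by rewrite mulrDl mul1r; lra.
have : ka <= b ^+ (k %% n).
  rewrite -bn ler_wiXn2l ?(ltW b0) ?(ltW b1)//.
  by rewrite ltnW// ltn_mod.
move=> h; have : 1 <= ka^-1 * b ^+ (k %% n).
  by rewrite -[leLHS](@mulVf _ ka) ?gt_eqF// ler_wpM2l// invr_ge0 ltW.
by rewrite mulrDl mul1r; lra.
Qed.

Lemma spectrum_le1 z : PF_spectrum mul inv q mu z -> normc z <= 1.
Proof.
move=> zs; have := @spectrum_le 1 1 z isT ltr01 _ zs.
rewrite powR1; apply; rewrite (convpow1 gp pm).
exact: (opbound_prob gp).
Qed.

End spectral_upper_bound.

(** * Rapid decay turned into a bound by power sums and moments *)

Section rapid_decay_bound.
Variables (R : realType) (G : countType) (mul : G -> G -> G).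
Variables (inv : G -> G) (e : G) (L nu : G -> R) (d : nat) (K : R).
Hypothesis gp : is_group mul inv e.
Hypothesis L0 : forall s, 0 <= L s.
Hypothesis pn : is_prob nu.
Hypothesis RD : forall v : G -> R, (forall t, 0 <= v t) ->
  (\esum_(t in [set: G]) ((v t) ^+ 2 * ((1 + L t) ^+ d) ^+ 2)%:E <= 1)%E ->
  opbound mul inv 2 (EFin \o v) (K ^+ 2).
Variable t : R.
Hypothesis t0 : 0 < t.

Let p := 2 + t^-1.
Let q := p / (p - 1).
Let th := 2 / p.
Let om s := (1 + L s) ^+ d.
Let om0 s : 0 < om s. Proof. by rewrite exprn_gt0// ltr_pwDl. Qed.
Let nu0 s : 0 <= nu s. Proof. exact: pn.1. Qed.
Let ti0 : 0 < t^-1. Proof. by rewrite invr_gt0. Qed.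
Let p2 : 2 < p. Proof. by rewrite /p ltrDl. Qed.
Let p0 : 0 < p. Proof. exact: lt_trans p2. Qed.
Let th01 : 0 < th < 1.
Proof. by rewrite /th divr_gt0//= ltr_pdivrMr// mul1r. Qed.
Let tE : t * (1 - th) = p^-1.
Proof.
have pe : p - 2 = t^-1 by rewrite /p addrAC subrr add0r.
rewrite /th -[X in X - _](@divff _ p) ?gt_eqF// -mulrBl pe mulrA.
by rewrite mulfV ?mul1r// gt_eqF.
Qed.

(** [interpolation] with v = nu^(1/2) / om, normalised because v^2 om^2 sums to the mass of [nu].
    For p = 2 + 1/t and th = 2/p the relation t (1 - th) = th/2 = 1/p cancels the powers of om and
    makes the exponents of [nu] add up to 1. *)
Lemma opbound_weighted (A : R) : 0 < A ->
  (\esum_(s in [set: G]) (nu s `^ (1 + t) * om s `^ (2 * t))%:E <= A%:E)%E ->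
  opbound mul inv q (EFin \o nu) (A `^ (q * (1 - th)) * (K ^+ 2) `^ (q * th / 2)).
Proof.
move=> A0 HA; case/andP: (th01) => th0 th1.
have thp : th / 2 = p^-1 by rewrite /th mulrAC divff// mul1r.
have pm1 : 0 < p - 1 by rewrite subr_gt0; apply: lt_trans p2; rewrite ltr1n.
pose v s := nu s `^ 2^-1 / om s.
have v0 s : 0 <= v s by rewrite divr_ge0 ?powR_ge0// ltW.
apply: (@interpolation _ _ _ _ _ gp (fun s => (nu s `^ (1 + t) * om s `^ (2 * t))%:E)
   (EFin \o v)) => //.
- by rewrite thp /q; field; rewrite !gt_eqF.
- by move=> s; rewrite lee_fin mulr_ge0 ?powR_ge0.
- exact: ltW.
- exact: sqr_ge0.
- apply: RD => //; rewrite -pn.2; apply: le_esumT => s; rewrite lee_fin -/(om s).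
  have nu2 : (nu s `^ 2^-1) ^+ 2 = nu s.
    by rewrite -powR_mulrn ?powR_ge0// -powRrM mulVf// powRr1.
  rewrite /v expr_div_n nu2.
  by rewrite mulfVK// expf_neq0// gt_eqF.
move=> s; rewrite /= -EFinM; congr EFin.
rewrite !powRM ?powR_ge0 ?invr_ge0 ?(ltW (om0 s))// -!powRrM.
have -> : (om s)^-1 `^ th = om s `^ (- (2 * t * (1 - th))).
  rewrite -powR_inv1 ?(ltW (om0 s))// -powRrM -mulrA tE; congr (_ `^ _).
  by rewrite mulN1r.
rewrite powRN mulrACA mulfV ?mulr1; last by rewrite gt_eqF// powR_gt0.
rewrite -powRD.
  have -> : (1 + t) * (1 - th) + 2^-1 * th = 1.
    by rewrite mulrDl tE mul1r [2^-1 * th]mulrC thp -thp; lra.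
  by rewrite powRr1.
have -> : (1 + t) * (1 - th) + 2^-1 * th = 1.
  by rewrite mulrDl tE mul1r [2^-1 * th]mulrC thp -thp; lra.
by rewrite oner_eq0.
Qed.

(** The summand is the geometric mean of nu^(1+2t), which carries the entropy, and nu om^(4t), which
    carries the moment; hence the halves in the exponent. *)
Lemma weighted_sum_le (X : set G) (al M : R) : (0 < d)%N -> finite_set X -> 0 < al ->
  0 < M -> 4 * d%:R * t < al ->
  (\esum_(s in [set: G]) (nu s * (1 + L s) `^ al)%:E <= M%:E)%E ->
  (\esum_(s in [set: G]) (nu s `^ (1 + t) * om s `^ (2 * t))%:E <=
   (expR (2 * d%:R * t / al * ln M - 2^-1 *
     \sum_(s \in X) (nu s * (1 - nu s `^ (2 * t)))))%:E)%E.
Proof.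
move=> d0 finX al0 M0 tal mom.
set S := \sum_(s \in X) _.
have L1 s : 0 < 1 + L s by rewrite ltr_pwDl.
have h12 : 0 < (2^-1 : R) < 1 by lra.
have h2 : 1 - 2^-1 = 2^-1 :> R by lra.
have t2 : 0 < 2 * t by rewrite mulr_gt0.
have nE0 s : (0 <= (nu s)%:E)%E by rewrite lee_fin.
(* om^(4t) is (1 + L)^al to the power th2, so Hoelder against [nu] itself gives M^th2. Positivity of
   d and the bound on t place th2 strictly between 0 and 1. *)
pose th2 := 4 * d%:R * t / al.
have th20 : 0 < th2 by rewrite /th2 divr_gt0// !mulr_gt0// ltr0n.
have th201 : 0 < th2 < 1 by rewrite th20 /th2 ltr_pdivrMr// mul1r.
have S2 : (\esum_(s in [set: G]) (nu s * om s `^ (4 * t))%:E <= (M `^ th2)%:E)%E.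
  have W0 s : (0 <= (nu s * (1 + L s) `^ al)%:E)%E by rewrite lee_fin mulr_ge0 ?powR_ge0.
  have := esum_hoelder th201 nE0 W0; rewrite pn.2 poweR1r mul1e => H.
  apply: (le_trans _ (le_trans H _)); last first.
    rewrite -poweR_EFin; apply: le_poweR => //; first exact: ltW.
    by apply: esumT_ge0.
  apply: le_esumT => s; rewrite !poweR_EFin -EFinM lee_fin.
  rewrite powRM ?powR_ge0// -powRrM mulrA -powRD; last by rewrite subrK oner_eq0.
  rewrite subrK powRr1// /om -powR_mulrn ?(ltW (L1 s))// -powRrM.
  have -> // : d%:R * (4 * t) = al * th2.
  by rewrite /th2; field; rewrite gt_eqF.
have S1 := renyi_sum_le pn t2 finX; rewrite -/S in S1.
have a0 s : (0 <= (nu s `^ (1 + 2 * t))%:E)%E by rewrite lee_fin powR_ge0.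
have b0 s : (0 <= (nu s * om s `^ (4 * t))%:E)%E by rewrite lee_fin mulr_ge0 ?powR_ge0.
have := esum_hoelder h12 a0 b0; rewrite h2 => H.
apply: (le_trans _ (le_trans H _)).
  apply: le_esumT => s; rewrite !poweR_EFin -EFinM lee_fin.
  rewrite powRM ?powR_ge0// -!powRrM mulrA -powRD; last first.
    by rewrite gt_eqF// addr_gt0// mulr_gt0// ?addr_gt0 ?invr_gt0.
  have -> : (1 + 2 * t) / 2 + 2^-1 = 1 + t by lra.
  by have -> : 4 * t / 2 = 2 * t by lra.
apply: (@le_trans _ _ ((expR (- S))%:E `^ 2^-1 * (M `^ th2)%:E `^ 2^-1)%E).
  by apply: lee_pmul; rewrite ?poweR_ge0//; apply: le_poweR => //;
    rewrite ?invr_ge0//; exact: esumT_ge0.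
rewrite !poweR_EFin -EFinM lee_fin.
have -> : expR (- S) `^ 2^-1 = expR (- (2^-1 * S)).
  by rewrite /powR gt_eqF ?expR_gt0// expRK mulrN.
rewrite -powRrM /powR gt_eqF// -expRD ler_expR.
rewrite addrC lerD2r le_eqVlt; apply/orP; left; apply/eqP; rewrite /th2.
by field; rewrite gt_eqF.
Qed.

End rapid_decay_bound.

Section spectral_radius_upper.
Variables (R : realType) (G : countType) (mul : G -> G -> G).
Variables (inv : G -> G) (e : G) (L mu : G -> R) (d : nat) (K : R).
Hypothesis gp : is_group mul inv e.
Hypothesis L0 : forall s, 0 <= L s.
Hypothesis pm : is_prob mu.
Hypothesis K1 : 1 <= K.
Hypothesis d0 : (0 < d)%N.
Hypothesis RD : forall v : G -> R, (forall t, 0 <= v t) ->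
  (\esum_(t in [set: G]) ((v t) ^+ 2 * ((1 + L t) ^+ d) ^+ 2)%:E <= 1)%E ->
  opbound mul inv 2 (EFin \o v) (K ^+ 2).
Local Notation mun := (convpow mul inv e mu).

Lemma spectrum_upper (n : nat) (X : set G) (al M p : R) z : (0 < n)%N ->
  finite_set X -> 0 < al -> 0 < M -> 2 < p -> 4 * d%:R / al < p - 2 ->
  (\esum_(s in [set: G]) (mun n s * (1 + L s) `^ al)%:E <= M%:E)%E ->
  PF_spectrum mul inv (p / (p - 1)) mu z ->
  normc z <= expR ((2 * d%:R / al * ln M + 2 * ln K + 2 * (p - 2)^-1 *
     \sum_(s \in X) (mun n s * ln (mun n s) ^+ 2) +
     \sum_(s \in X) (mun n s * ln (mun n s))) / (n%:R * p)).
Proof.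
move=> n0 finX al0 M0 p2 pal mom zs.
pose t := (p - 2)^-1; pose nu := mun n.
have pn : is_prob nu by exact: is_prob_convpow.
have pm2 : 0 < p - 2 by rewrite subr_gt0.
have t0 : 0 < t by rewrite invr_gt0.
have pE : p = 2 + t^-1 by rewrite /t invrK addrC subrK.
have p0 : 0 < p by apply: lt_trans p2.
have K0 : 0 < K by apply: lt_le_trans K1.
have nR : 0 < n%:R :> R by rewrite ltr0n.
have tal : 4 * d%:R * t < al.
  by rewrite /t ltr_pdivrMr// (mulrC al) -ltr_pdivrMr.
have WS := weighted_sum_le L0 pn t0 d0 finX al0 M0 tal mom.
set A := expR _ in WS.
have A0 : 0 < A by exact: expR_gt0.
have := opbound_weighted gp L0 pn RD t0 A0 WS; rewrite -pE.
set q := p / (p - 1); set th := 2 / p => ob.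
have pm1 : 0 < p - 1 by lra.
have q0 : 0 < q by rewrite divr_gt0.
have q1 : 1 < q by rewrite /q ltr_pdivlMr// mul1r ltrBlDr ltrDl.
have ka0 : 0 < A `^ (q * (1 - th)) * (K ^+ 2) `^ (q * th / 2).
  by rewrite mulr_gt0 ?powR_gt0// exprn_gt0.
apply: le_trans (spectrum_le gp pm q1 n0 ka0 ob zs) _.
rewrite {1}/powR gt_eqF// ler_expR lnM ?posrE ?powR_gt0 ?exprn_gt0// !ln_powR.
rewrite lnXn// expRK.
set S := \sum_(s \in X) (nu s * (1 - _)).
(* [renyi_term_ge] with r = 2 t. After division by 2 t the entropy part has coefficient 1 and the
   error is 2 t S2, which vanishes as p grows with X fixed. *)
have Sge : 2 * t * (- \sum_(s \in X) (nu s * ln (nu s)) -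
    2 * t * \sum_(s \in X) (nu s * ln (nu s) ^+ 2)) <= S.
  have t2 : 0 < 2 * t by rewrite mulr_gt0.
  rewrite /S !fsbig_finite//= -sumrN !mulr_sumr -sumrB mulr_sumr.
  by apply: ler_sum => s _; exact: renyi_term_ge.
set S1 := \sum_(s \in X) (nu s * ln (nu s)) in Sge *.
set S2 := \sum_(s \in X) (nu s * ln (nu s) ^+ 2) in Sge *.
(* The conjugate exponent q cancels, and 1 - th = 1/(t p) turns the exponent of A, which is of order
   t, into one of order 1/p. *)
have -> : (n%:R * q)^-1 * (q * (1 - th) * (2 * d%:R * t / al * ln M - 2^-1 * S) +
    q * th / 2 * (ln K *+ 2)) =
   (2 * d%:R / al * ln M + 2 * ln K - (2 * t)^-1 * S) / (n%:R * p).
  rewrite /t /th mulr2n; field.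
  by rewrite !gt_eqF.
rewrite ler_wpM2r ?invr_ge0 ?mulr_ge0 ?(ltW nR) ?(ltW p0)//.
have h : - S1 - 2 * t * S2 <= (2 * t)^-1 * S.
  by rewrite ler_pdivlMl ?mulr_gt0.
by rewrite -/t; lra.
Qed.

End spectral_radius_upper.

(** * Entropy along convolution powers and the lower bound for the spectral radius *)

Section convolution_entropy.
Variables (R : realType) (G : countType) (mul : G -> G -> G).
Variables (inv : G -> G) (e : G) (mu : G -> R).
Hypothesis gp : is_group mul inv e.
Hypothesis pm : is_prob mu.
Hypothesis sh : (shannon mu < +oo)%E.
Local Notation mun := (convpow mul inv e mu).

Definition entropy_convpow n := fine (shannon (mun n)).
Local Notation H := entropy_convpow.

Let pn n : is_prob (mun n). Proof. exact: is_prob_convpow. Qed.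

Lemma shannon_convpow_fin n : (shannon (mun n) < +oo)%E.
Proof.
elim: n => [|n ih]; first by rewrite shannon_dirac ltry.
by apply: le_lt_trans (shannon_conv gp (pn n) pm) _; exact: lte_add_pinfty.
Qed.

Lemma entropy_convpowE n : shannon (mun n) = (H n)%:E.
Proof. by rewrite fineK// ge0_fin_numE ?shannon_ge0 ?shannon_convpow_fin. Qed.

Lemma entropy_convpow_ge0 n : 0 <= H n.
Proof. by rewrite fine_ge0// shannon_ge0. Qed.

Lemma entropy_convpowD m n : H (m + n)%N <= H m + H n.
Proof.
rewrite -lee_fin EFinD -!entropy_convpowE (convpowD gp)//.
exact: (shannon_conv gp (pn m) (pn n)).
Qed.

Lemma entropy_convpow_linear n : H n <= n%:R * H 1%N.
Proof.
elim: n => [|n ih]; first by rewrite mul0r /entropy_convpow /= shannon_dirac.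
have := entropy_convpowD n 1; rewrite addn1 -natr1 mulrDl mul1r.
by move=> h; apply: le_trans h _; rewrite lerD2r.
Qed.

Lemma avez_cvg : exists2 h,
  (fun n : nat => fine (shannon (mun n)) / n%:R) @ \oo --> h /\ avez mul inv e mu = h &
  forall n, (0 < n)%N -> h <= H n / n%:R.
Proof.
have [h cv hle] := fekete entropy_convpow_ge0 entropy_convpowD.
exists h => //; split => //; exact: cvg_lim.
Qed.

(** [sup] has its intended value only on bounded nonempty sets; nonemptiness is the second
    conclusion of [specrad_ge]. *)
Lemma specrad_ub (q : R) : 1 < q ->
  has_ubound [set normc z | z in PF_spectrum mul inv q mu].
Proof. by move=> q1; exists 1 => _ [z zs <-]; exact: (spectrum_le1 gp pm q1 zs). Qed.

Lemma specrad_ge (h p : R) : 1 < p ->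
  (\forall n \near \oo, H n / n%:R <= h) ->
  expR (- (h / p)) <= PF_specrad mul inv (p / (p - 1)) mu /\
  [set normc z | z in PF_spectrum mul inv (p / (p - 1)) mu] !=set0.
Proof.
move=> p1 [N0 _ HN0]; set q := p / (p - 1).
have p0 : 0 < p by apply: lt_trans p1.
have pm1 : 0 < p - 1 by rewrite subr_gt0.
have q1 : 1 < q by rewrite /q ltr_pdivlMr// mul1r ltrBlDr ltrDl.
have q0 : 0 < q by apply: lt_trans q1.
have qm1 : 0 < q - 1 by rewrite subr_gt0.
have H10 := entropy_convpow_ge0 1.
(* Absorbs the finitely many n for which H n / n <= h may fail; the absolute value covers a negative
   h. *)
pose C := N0.+1%:R * (H 1%N + `|h|).
have C0 : 0 <= C by rewrite mulr_ge0// addr_ge0.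
have HC n : H n <= C + n%:R * h.
  have [nN|nN] := leqP N0.+1 n.
    have n0 : 0 < n%:R :> R by rewrite ltr0n; apply: leq_trans nN.
    have := HN0 n (ltnW nN); rewrite ler_pdivrMr// mulrC => h1.
    by apply: le_trans h1 _; rewrite lerDr.
  apply: le_trans (entropy_convpow_linear n) _.
  have nN' : n%:R <= N0.+1%:R :> R by rewrite ler_nat ltnW.
  have h1 : n%:R * H 1%N <= N0.+1%:R * H 1%N by rewrite ler_wpM2r.
  have h2 : n%:R * `|h| <= N0.+1%:R * `|h| by rewrite ler_wpM2r.
  have h3 : - (n%:R * `|h|) <= n%:R * h.
    by rewrite -mulrN ler_wpM2l// lerNl -normrN ler_norm.
  by rewrite /C mulrDr; lra.
have low n : ((expR (- ((q - 1) * C)) * expR (- ((q - 1) * h)) ^+ n)%:E <=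
    lqsum q (mu_C (mun n)))%E.
  apply: le_trans (lqsum_ge_entropy (pn n) q1 (shannon_convpow_fin n)).
  rewrite lee_fin -expRM_natl -expRD ler_expR.
  have := ler_wpM2l (ltW qm1) (HC n).
  rewrite -/(H n); lra.
have [gm gmge gms] := spectrum_ge gp pm q1 (expR_gt0 _) (expR_gt0 _) low.
(* (q - 1)/q = 1/p passes from the rate of the q-sums to the rate of the norms. *)
have gE : expR (- ((q - 1) * h)) `^ q^-1 = expR (- (h / p)).
  rewrite /powR gt_eqF ?expR_gt0// expRK; congr expR.
  by rewrite /q; field; rewrite !gt_eqF.
have g0 : 0 < gm by apply: lt_le_trans gmge; rewrite powR_gt0// expR_gt0.
have ing : [set normc z | z in PF_spectrum mul inv q mu] gm.
  by exists (Complex gm 0) => //; rewrite normc_real gtr0_norm.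
split; last by exists gm.
by rewrite -gE; apply: le_trans gmge _; apply: ub_le_sup => //; exact: specrad_ub.
Qed.

End convolution_entropy.

(** * Choice of the parameters and passage to the limit *)

Lemma ln_le_sqrt (R : realType) (x : R) : 0 < x -> ln x <= 2 * Num.sqrt x.
Proof.
move=> x0; have s0 : 0 < Num.sqrt x by rewrite sqrtr_gt0.
rewrite -{1}(sqr_sqrtr (ltW x0)) lnXn// mulr2n.
by have := ln_sublinear s0; lra.
Qed.

Lemma exists_large_nat (R : realType) (a b M eps : R) :
  0 <= a -> 0 < M -> 0 < eps ->
  exists n : nat, (0 < n)%N /\ a * ln (n%:R * M) + b <= eps * n%:R.
Proof.
move=> a0 M0 eps0.
(* Makes 2 dl (a + 1) = eps/2, half of the budget, with a + 1 guarding against a = 0. From n >= M /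
   dl^2 one gets sqrt(n M) <= dl n; the other half of the budget goes to b. *)
pose dl := eps / (4 * (a + 1)).
have a1 : 0 < a + 1 by lra.
have dl0 : 0 < dl by rewrite divr_gt0// mulr_gt0.
pose x := M / dl ^+ 2 + `|2 * b / eps|.
have x0 : 0 <= x by rewrite addr_ge0// divr_ge0 ?sqr_ge0// ltW.
exists (Num.Def.archi_bound x).+1; split => //.
set n := (Num.Def.archi_bound x).+1.
have nx : x <= n%:R.
  by apply: le_trans (ltW (archi_boundP x0)) _; rewrite ler_nat.
have n0 : 0 < n%:R :> R by rewrite ltr0n.
have nM : M / dl ^+ 2 <= n%:R by apply: le_trans nx; rewrite lerDl.
have nb : `|2 * b / eps| <= n%:R.
  by apply: le_trans nx; rewrite lerDr divr_ge0 ?sqr_ge0// ltW.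
have sq : Num.sqrt (n%:R * M) <= dl * n%:R.
  have dn0 : 0 <= dl * n%:R by rewrite mulr_ge0// ltW.
  rewrite -(ger0_norm dn0) -sqrtr_sqr ler_sqrt ?sqr_ge0//.
  rewrite exprMn [_ ^+ 2 * _]mulrC expr2 -mulrA ler_wpM2l ?(ltW n0)//.
  by move: nM; rewrite ler_pdivrMr ?exprn_gt0.
have ln1 : ln (n%:R * M) <= 2 * (dl * n%:R).
  apply: le_trans (ln_le_sqrt _) _; first by rewrite mulr_gt0.
  by rewrite ler_wpM2l.
have h1 : a * ln (n%:R * M) <= (a + 1) * (2 * (dl * n%:R)).
  apply: (@le_trans _ _ (a * (2 * (dl * n%:R)))); first by rewrite ler_wpM2l.
  apply: ler_wpM2r; last by rewrite lerDl.
  by rewrite mulr_ge0// mulr_ge0// ltW.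
have h2 : (a + 1) * (2 * (dl * n%:R)) = eps / 2 * n%:R.
  by rewrite /dl; field; rewrite gt_eqF.
have h3 : b <= eps / 2 * n%:R.
  have := le_trans (ler_norm _) nb; rewrite ler_pdivrMr//; lra.
lra.
Qed.

Lemma finite_entropy_approx (R : realType) (G : countType) (nu : G -> R) (H eps : R) :
  shannon nu = H%:E -> 0 < eps ->
  exists2 X : set G, finite_set X &
    H - eps <= - \sum_(s \in X) (nu s * ln (nu s)).
Proof.
move=> HE eps0.
have : ((H - eps)%:E < shannon nu)%E by rewrite HE lte_fin ltrBlDr ltrDl.
rewrite shannonE => /ereal_sup_gt[_ [X [finX _] <-] lt].
exists X => //; move: lt; rewrite fsumEFin// lte_fin => /ltW.
by rewrite !fsbig_finite//= sumrN.
Qed.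

Theorem theorem5p2 (R : realType) (G : countType) (mul : G -> G -> G)
  (inv : G -> G) (e : G) (L : G -> R) (mu : G -> R) :
  is_group mul inv e ->
  is_length_function mul inv e L ->
  has_RD mul inv L ->
  is_prob mu ->
  (shannon mu < +oo)%E ->
  (exists alpha : R, 0 < alpha /\
     (\esum_(s in [set: G]) (mu s * (1 + L s) `^ alpha)%:E < +oo)%E) ->
  (fun n : nat => fine (shannon (convpow mul inv e mu n)) / n%:R) @ \oo
     --> avez mul inv e mu /\
  (fun p : R => - p * ln (PF_specrad mul inv (p / (p - 1)) mu)) @ +oo
     --> avez mul inv e mu.
Proof.
move=> gp [L0 [_ [_ LM]]] RD pm sh [al0 [al0_gt0 mom0]].
have [h [hcv ->] hle] := avez_cvg gp pm sh.
split=> //.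
have [d' [K [K1 RD']]] := opbound_RD gp L0 RD.
have L1 s : 1 <= 1 + L s by rewrite lerDl.
have L1' s : 0 < 1 + L s by apply: lt_le_trans (L1 s).
(* A positive exponent is wanted for th2 > 0 in [weighted_sum_le]. Raising it only strengthens the
   condition on v, as 1 + L >= 1. *)
pose d := d'.+1.
have {RD'}RDd v : (forall t, 0 <= v t) ->
    (\esum_(t in [set: G]) ((v t) ^+ 2 * ((1 + L t) ^+ d) ^+ 2)%:E <= 1)%E ->
    opbound mul inv 2 (EFin \o v) (K ^+ 2).
  move=> v0 v1; apply: RD' => //; apply: le_trans v1; apply: le_esumT => s.
  rewrite lee_fin ler_wpM2l ?sqr_ge0// ler_pXn2r ?nnegrE ?exprn_ge0 ?(ltW (L1' s))//.
  by rewrite /d exprS ler_peMl ?exprn_ge0 ?(ltW (L1' s)).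
(* Capping the exponent at 1 makes (1 + L)^al subadditive and keeps its moment finite. *)
pose al := Num.min al0 1.
have al_gt0 : 0 < al by rewrite lt_min al0_gt0 ltr01.
have al_le1 : al <= 1 by rewrite ge_min lexx orbT.
pose W s := (1 + L s) `^ al.
have W0 s : 0 <= W s by exact: powR_ge0.
have mu0 s : 0 <= mu s by exact: pm.1.
have mom : (\esum_(s in [set: G]) (mu s * W s)%:E < +oo)%E.
  apply: le_lt_trans mom0; apply: le_esumT => s; rewrite lee_fin ler_wpM2l//.
  by rewrite ler_powR// ge_min lexx.
have WM s t : W (mul s t) <= W s + W t.
  apply: (@le_trans _ _ (((1 + L s) + (1 + L t)) `^ al)).
    rewrite ge0_ler_powR ?nnegrE ?addr_ge0// ?(ltW al_gt0)//.
    by have := LM s t; lra.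
  by rewrite powR_subadditive// al_gt0.
pose M := fine (\esum_(s in [set: G]) (mu s * W s)%:E).
have ME : (\esum_(s in [set: G]) (mu s * W s)%:E)%E = M%:E.
  rewrite fineK// esum_fin_num// => s; rewrite lee_fin mulr_ge0//.
have M1 : 1 <= M.
  rewrite -lee_fin -ME -pm.2; apply: le_esumT => s; rewrite lee_fin.
  by rewrite ler_peMr// /W -[leLHS](powRr0 (1 + L s)) ler_powR// ltW.
have M0 : 0 < M by apply: lt_le_trans M1.
apply/cvgrPdist_le => eps eps0.
have e3 : 0 < eps / 3 by rewrite divr_gt0.
have a0 : 0 <= 2 * d%:R / al by rewrite divr_ge0 ?mulr_ge0// ltW.
(* n is fixed first, to make the error that does not depend on p at most eps/3 per step. *)
have [n [n0 nbig]] := exists_large_nat (2 * ln K) a0 M0 e3.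
pose nu := convpow mul inv e mu n.
have [X finX HX] := finite_entropy_approx (entropy_convpowE gp pm sh n) e3.
have nR : 1 <= n%:R :> R by rewrite ler1n.
have nR0 : 0 < n%:R :> R by rewrite ltr0n.
have momn : (\esum_(s in [set: G]) (nu s * W s)%:E <= (n%:R * M)%:E)%E.
  have := moment_convpow gp pm W0 WM n.-1; rewrite prednK// ME => mm.
  by apply: le_trans mm _; rewrite -EFinM.
pose E2 := \sum_(s \in X) (nu s * ln (nu s) ^+ 2).
have E20 : 0 <= E2.
  rewrite /E2 fsbig_finite//=; apply: sumr_ge0 => s _; rewrite mulr_ge0 ?sqr_ge0//.
  exact: (is_prob_convpow gp n pm).1.
near=> p.
have p2 : 2 < p by near: p; exact: nbhs_pinfty_gt.
have pal : 4 * d%:R / al < p - 2.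
  by rewrite ltrBrDr; near: p; apply: nbhs_pinfty_gt; exact: num_real.
(* Makes the second-order error 2 E2 / (p - 2) at most eps/3; n and X, hence E2, are already
   fixed. *)
have pE : 6 * E2 / eps <= p - 2.
  by rewrite lerBrDr; near: p; apply: nbhs_pinfty_ge; exact: num_real.
have p0 : 0 < p by apply: lt_trans p2.
have p1 : 1 < p by apply: lt_trans p2; rewrite ltr1n.
have pm2 : 0 < p - 2 by rewrite subr_gt0.
have pm1 : 0 < p - 1 by rewrite subr_gt0.
set q := p / (p - 1).
set r := PF_specrad mul inv q mu.
have hn : \forall n \near \oo, entropy_convpow mul inv e mu n / n%:R <= h + eps.
  move/cvgrPdist_le: hcv => /(_ eps eps0); apply: filterS => k.
  by rewrite distrC ler_distl => /andP[].
have [rge ne] := specrad_ge gp pm sh p1 hn.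
have r0 : 0 < r by apply: lt_le_trans rge; exact: expR_gt0.
have up : - p * ln r <= h + eps.
  rewrite mulNr lerNl -ler_pdivrMl// -ler_expR lnK ?posrE//.
  by rewrite mulrC mulNr.
have lo : h - eps <= - p * ln r.
  have nM0 : 0 < n%:R * M by rewrite mulr_gt0.
  set B := (2 * d%:R / al * ln (n%:R * M) + 2 * ln K + 2 * (p - 2)^-1 * E2 +
     \sum_(s \in X) (nu s * ln (nu s))).
  have rle : r <= expR (B / (n%:R * p)).
    apply: ge_sup => // _ [z zs <-].
    exact: (spectrum_upper gp L0 pm K1 _ RDd n0 finX al_gt0 nM0 p2 pal momn zs).
  have lnr : ln r <= B / (n%:R * p).
    by rewrite -[leRHS]expRK ler_ln ?posrE ?expR_gt0.
  have plnr : p * ln r <= B / n%:R.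
    have -> : B / n%:R = p * (B / (n%:R * p)) by field; rewrite !gt_eqF.
    by rewrite ler_wpM2l// ltW.
  have E3 : 2 * (p - 2)^-1 * E2 <= eps / 3.
    rewrite mulrAC ler_pdivrMr//; move: pE; rewrite ler_pdivrMr//; lra.
  have Hn := hle n n0.
  (* The three errors are each at most (eps/3) n, as n >= 1, and H n >= h n because h is the infimum
     in Fekete's lemma. *)
  have BH : B <= (eps - h) * n%:R.
    move: Hn; rewrite ler_pdivlMr// => Hn.
    have : eps / 3 <= eps / 3 * n%:R by rewrite ler_peMr// ltW.
    by rewrite /B; lra.
  have : B / n%:R <= eps - h by rewrite ler_pdivrMr.
  by rewrite mulNr; lra.
by rewrite ler_distl; apply/andP; split; lra.
Unshelve. all: by end_near. Qed.
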